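(* Let the density-greedy algorithm for trees be as defined in the context. Then: (i) the algorithm can be implemented to run in time polynomial in the size of the instance when the input graph $G$ is a tree; (ii) for every instance in which $G$ is a tree, every $\alpha \geq \chi$ (where $\chi$ is the root eccentricity of that instance) and every $\mu \geq 1$, the output $\pi$ of the algorithm satisfies $\mu\, p(\textsc{Alg}(B+\alpha)) \geq p(\textsc{Opt}(B))$ for all $B \in \mathbb{R}_{\geq 0}$ (in particular $p(\textsc{Alg}(B+\chi)) \geq p(\textsc{Opt}(B))$ for all $B\ge 0$); (iii) conversely, the algorithm is not $(\alpha,\mu)$-competitive on trees for any finite $\mu\ge 1$ when $\alpha<\chi$: for every $\chi>0$ and every $\alpha\in[0,\chi)$ there is an instance in which $G$ is a tree with root eccentricity $\chi$ such that, for every $\mu \geq 1$, the output of the algorithm satisfies $\mu\, p(\textsc{Alg}(B+\alpha)) < p(\textsc{Opt}(B))$ for some $B \geq 0$.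
   Context: An instance consists of a finite undirected graph $G=(V,E)$, edge costs $c(e)>0$ for $e\in E$, vertex prizes $p(v)\ge 0$ for $v\in V$, and a root $r\in V$. For a subgraph $G'=(V',E')$ write $p(G')=\sum_{v\in V'}p(v)$ and $c(G')=\sum_{e\in E'}c(e)$. A rooted subtree is a subtree of $G$ containing $r$; $\mathcal{T}$ denotes the set of rooted subtrees. For $B\ge 0$, $\textsc{Opt}(B)$ is a rooted subtree maximizing $p(T)$ subject to $c(T)\le B$. Let $V^*=\{v: p(v)>0\}$. An incremental solution is a sequence $\pi=(e_1,\dots,e_l)$ of distinct edges such that for every $j\le l$ the edges $e_1,\dots,e_j$ together with $r$ form a rooted subtree, and the tree formed by all of $e_1,\dots,e_l$ spans $V^*$. For $B\ge0$, $\textsc{Alg}(B)$ denotes the rooted subtree formed by $r$ and the edges $e_i$ with $\sum_{j\le i}c(e_j)\le B$, where $\pi$ is the output of the algorithm under consideration. An algorithm is $(\alpha,\mu)$-competitive ($\alpha\ge0,\mu\ge1$) if for every instance its output satisfies $\mu\,p(\textsc{Alg}(B+\alpha))\ge p(\textsc{Opt}(B))$ for all $B\ge 0$. The root eccentricity is $\chi=\max_{v\in V}\ell(v)$, where $\ell(v)$ is the minimum cost of an $r$-$v$ path. Density: for a rooted subtree $T$ (of a graph with root $r$) with at least one edge, $d(T)=p(T)/c(T)$; the trivial tree $(\{r\},\emptyset)$ has density $0$. A min-max subtree is an inclusion-wise minimal rooted subtree among those of maximum density. Contraction: for a rooted subtree $\overline{T}$ of $G$, $G/\overline{T}$ is obtained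 by identifying all vertices of $\overline{T}$ with $r$ and deleting the edges of $\overline{T}$, keeping all other edges (as possible parallel edges or loops) with their costs; each edge of $G/\overline{T}$ corresponds to a unique edge of $G$ not in $\overline{T}$. Prizes are unchanged, except that the root gets prize $0$. Density-greedy algorithm for trees (input: tree $G$ with root $r$): set $\pi=()$, $\overline{T}=(\{r\},\emptyset)$. While the total prize of $G/\overline{T}$ is nonzero: choose an arbitrary min-max subtree $T^*$ of $G/\overline{T}$ (it has exactly one edge $e^*$ incident to $r$), append to $\pi$ the edge $e$ of $G$ corresponding to $e^*$, and add $e$ to $\overline{T}$. Output $\pi$. *)

(* Defs.v *)
From mathcomp Require Import all_boot all_order all_algebra.
Set Implicit Arguments.
Unset Strict Implicit.
Unset Printing Implicit Defensive.
Import Order.TTheory GRing.Theory Num.Theory.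
Local Open Scope ring_scope.

(* Parallel edges and loops are allowed, because contraction creates them.
   The order of the two ends of an edge carries no meaning. *)
Record instance (R : realFieldType) := Instance {
  vert : finType;
  edge : finType;
  end1 : edge -> vert;
  end2 : edge -> vert;
  cost : edge -> R;
  prize : vert -> R;
  root : vert;
  cost_gt0 : forall e, 0 < cost e;
  prize_ge0 : forall v, 0 <= prize v
}.
Arguments root {R} i.

Section Graphs.
Variables (R : realFieldType) (I : instance R).

Definition subgraph : Type := ({set vert I} * {set edge I})%type.

Definition joins (e : edge I) (x y : vert I) : bool :=
  (end1 e == x) && (end2 e == y) || (end1 e == y) && (end2 e == x).

Definition incident (e : edge I) (v : vert I) : bool :=
  (end1 e == v) || (end2 e == v).

(* A walk from [x] is given by its successive steps [(e, y)]: traverse the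
   edge [e] and arrive at the vertex [y]. *)
Fixpoint walk (x : vert I) (s : seq (edge I * vert I)) : bool :=
  if s is (e, y) :: s' then joins e x y && walk y s' else true.

Definition walk_from_to (x y : vert I) (s : seq (edge I * vert I)) : bool :=
  walk x s && (last x (unzip2 s) == y).

Definition is_path (x y : vert I) (s : seq (edge I * vert I)) : bool :=
  walk_from_to x y s && uniq (x :: unzip2 s).

(* A loop is a cycle of length 1, two parallel edges form one of length 2. *)
Definition is_cycle (x : vert I) (s : seq (edge I * vert I)) : bool :=
  [&& s != [::], walk_from_to x x s, uniq (unzip1 s) & uniq (unzip2 s)].

Definition is_subgraph (H : subgraph) : Prop :=
  forall e, e \in H.2 -> (end1 e \in H.1) && (end2 e \in H.1).

Definition connected (H : subgraph) : Prop :=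
  forall x y, x \in H.1 -> y \in H.1 ->
  exists s, walk_from_to x y s /\ {subset unzip1 s <= H.2}.

Definition acyclic (H : subgraph) : Prop :=
  forall x s, {subset unzip1 s <= H.2} -> ~~ is_cycle x s.

Definition subtree (H : subgraph) : Prop :=
  [/\ is_subgraph H, connected H & acyclic H].

Definition rooted_subtree (T : subgraph) : Prop :=
  subtree T /\ root I \in T.1.

Definition is_tree : Prop := subtree ([set: vert I], [set: edge I]).

Definition prize_of (H : subgraph) : R := \sum_(v in H.1) prize v.
Definition cost_of (H : subgraph) : R := \sum_(e in H.2) cost e.
Definition total_prize : R := \sum_(v : vert I) prize v.

Definition is_opt (B : R) (T : subgraph) : Prop :=
  [/\ rooted_subtree T, cost_of T <= B &
      forall T', rooted_subtree T' -> cost_of T' <= B ->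
        prize_of T' <= prize_of T].

Definition is_dist (v : vert I) (l : R) : Prop :=
  (exists s, is_path (root I) v s /\ \sum_(st <- s) cost st.1 = l) /\
  (forall s, is_path (root I) v s -> l <= \sum_(st <- s) cost st.1).

Definition is_eccentricity (chi : R) : Prop :=
  (exists v, is_dist v chi) /\
  (forall v, exists l, is_dist v l /\ l <= chi).

Definition formed_by (F : {set edge I}) : subgraph :=
  ([set v | (v == root I) || [exists e in F, incident e v]], F).

Definition incremental_solution (pi : seq (edge I)) : Prop :=
  [/\ uniq pi,
      forall j, (j <= size pi)%N ->
        rooted_subtree (formed_by [set e in take j pi]) &
      forall v, 0 < prize v -> v \in (formed_by [set e in pi]).1].

Definition alg (pi : seq (edge I)) (B : R) : subgraph :=
  formed_by [set e in pi | \sum_(f <- take (index e pi).+1 pi) cost f <= B].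

Definition density (T : subgraph) : R :=
  if T.2 == set0 then 0 else prize_of T / cost_of T.

Definition max_density (T : subgraph) : Prop :=
  rooted_subtree T /\
  forall T', rooted_subtree T' -> density T' <= density T.

Definition min_max_subtree (T : subgraph) : Prop :=
  max_density T /\
  forall T', max_density T' -> T'.1 \subset T.1 -> T'.2 \subset T.2 -> T' = T.

End Graphs.

Section Contraction.
Variables (R : realFieldType) (I : instance R) (T : subgraph I).

(* The vertices of [T] are represented by the root alone. *)
Definition contract_vert : finType :=
  {v : vert I | (v \notin T.1) || (v == root I)}.
Definition contract_edge : finType := {e : edge I | e \notin T.2}.

Lemma contract_root_subproof : (root I \notin T.1) || (root I == root I).
Proof. by rewrite eqxx orbT. Qed.

Definition contract_root : contract_vert := Sub (root I) contract_root_subproof.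

(* [insubd] sends the vertices of [T] to [contract_root] and leaves the other
   ones unchanged. *)
Definition contract_proj (v : vert I) : contract_vert :=
  insubd contract_root v.

Definition contract_prize (v : contract_vert) : R :=
  if v == contract_root then 0 else prize (val v).

Lemma contract_prize_ge0 v : 0 <= contract_prize v.
Proof. by rewrite /contract_prize; case: ifP => // _; apply: prize_ge0. Qed.

Definition contract : instance R :=
  @Instance R contract_vert contract_edge
    (fun e => contract_proj (end1 (val e)))
    (fun e => contract_proj (end2 (val e)))
    (fun e => cost (val e))
    contract_prize contract_root
    (fun e => cost_gt0 (val e)) contract_prize_ge0.

End Contraction.

Section Greedy.
Variables (R : realFieldType) (I : instance R).

(* The tree under construction is always [formed_by [set e in pi]], so the
   state of the algorithm is [pi] alone. *)
Definition greedy_quotient (pi : seq (edge I)) : instance R :=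
  contract (formed_by [set e in pi]).

Definition greedy_step (pi : seq (edge I)) (e : edge I) : Prop :=
  total_prize (greedy_quotient pi) != 0 /\
  exists (T : subgraph (greedy_quotient pi)) (e' : edge (greedy_quotient pi)),
    [/\ min_max_subtree T, e' \in T.2,
        incident e' (root (greedy_quotient pi)) & e = val e'].

Inductive greedy_reachable : seq (edge I) -> Prop :=
| greedy_start : greedy_reachable [::]
| greedy_next pi e :
    greedy_reachable pi -> greedy_step pi e -> greedy_reachable (rcons pi e).

(* One run per way of resolving the arbitrary choices. *)
Definition greedy_output (pi : seq (edge I)) : Prop :=
  greedy_reachable pi /\ total_prize (greedy_quotient pi) = 0.

End Greedy.

(* A random access machine with structured control flow and logarithmic cost:
   memory cells hold natural numbers, addresses may be computed, and every
   number that is read or produced is charged its length in binary.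
   Up to a polynomial, running time is that of a Turing machine. *)
Local Open Scope nat_scope.

Definition bitsize (n : nat) : nat := (trunc_log 2 n).+1.

Definition memory := nat -> nat.

Inductive expr :=
| Const of nat
| Read of expr
| Add of expr & expr
| Monus of expr & expr
| Mul of expr & expr.

Inductive cmd :=
| Skip
| Store of expr & expr
| Seq of cmd & cmd
| If of expr & cmd & cmd
| While of expr & cmd.

Fixpoint eval (M : memory) (a : expr) : nat :=
  match a with
  | Const k => k
  | Read b => M (eval M b)
  | Add b c => eval M b + eval M c
  | Monus b c => eval M b - eval M c
  | Mul b c => eval M b * eval M c
  end.

Fixpoint eval_cost (M : memory) (a : expr) : nat :=
  bitsize (eval M a) +
  match a with
  | Const _ => 0
  | Read b => eval_cost M b
  | Add b c | Monus b c | Mul b c => eval_cost M b + eval_cost M c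
  end.

Definition update (M : memory) (a v : nat) : memory :=
  fun i => if i == a then v else M i.

(* [exec P M M' t]: started in [M], the program [P] halts in [M'] and its run
   costs [t]. *)
Inductive exec : cmd -> memory -> memory -> nat -> Prop :=
| exec_skip M : exec Skip M M 1
| exec_store a b M :
    exec (Store a b) M (update M (eval M a) (eval M b))
         (1 + eval_cost M a + eval_cost M b)
| exec_seq P Q M M1 M2 t1 t2 :
    exec P M M1 t1 -> exec Q M1 M2 t2 -> exec (Seq P Q) M M2 (1 + t1 + t2)
| exec_if a P Q M M' t :
    exec (if eval M a != 0 then P else Q) M M' t ->
    exec (If a P Q) M M' (1 + eval_cost M a + t)
| exec_while_stop a P M :
    eval M a = 0 -> exec (While a P) M M (1 + eval_cost M a)
| exec_while_loop a P M M1 M2 t1 t2 :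
    eval M a != 0 -> exec P M M1 t1 -> exec (While a P) M1 M2 t2 ->
    exec (While a P) M M2 (1 + eval_cost M a + t1 + t2).

Definition holds_list (M : memory) (s : seq nat) : Prop :=
  forall i, i < size s -> M i = nth 0 s i.

Definition initial_memory (s : seq nat) : memory := nth 0 s.

(* The first two entries are the numbers of vertices and edges; vertices and
   edges are numbered from 0; rationals are given in lowest terms. *)
Definition encode_rat (x : rat) : seq nat := [:: `|numq x|%N; `|denq x|%N].

Definition encode_instance (I : instance rat) : seq nat :=
  [:: #|vert I|; #|edge I|; nat_of_ord (enum_rank (root I))] ++
  flatten [seq [:: nat_of_ord (enum_rank (end1 e)),
                   nat_of_ord (enum_rank (end2 e)) & encode_rat (cost e)]
          | e <- enum (edge I)] ++
  flatten [seq encode_rat (prize v) | v <- enum (vert I)].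

Definition instance_size (I : instance rat) : nat :=
  \sum_(k <- encode_instance I) bitsize k.

Definition encode_edges (I : instance rat) (pi : seq (edge I)) : seq nat :=
  size pi :: [seq nat_of_ord (enum_rank e) | e <- pi].

(* The costs and prizes of an instance handed to a machine are rational. *)
Definition greedy_trees_polytime : Prop :=
  exists (P : cmd) (a k : nat), forall I : instance rat, is_tree I ->
  exists (M : memory) (t : nat) (pi : seq (edge I)),
    [/\ exec P (initial_memory (encode_instance I)) M t,
        t <= a * instance_size I ^ k + a,
        greedy_output pi &
        holds_list M (encode_edges pi)].

(* Main.v *)
(* A tree with a root is encoded by edge sets: a rooted subtree is a set of
   edges closed under taking ancestors, and contracting a rooted subtree removes
   such a set. Let D(e) be the largest density of a connected set of edges with
   topmost edge e. The number D(e) does not change under contraction, and the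
   greedy step takes an edge of maximal D among those hanging from the root.

   Upper bound: let X be a prefix of the output, e the next edge, P the path
   from the root to e, and let l be the least D of the edges taken up to and
   including e, attained at a prefix Y. Then Y maximizes prize - l * cost over
   all rooted subtrees. Greedy completes every smallest densest subtree that it
   enters unless e lies in it, so the edges of X outside Y and P split into
   complete subtrees of density at least l. Hence any rooted subtree that costs
   at most c(X \ P) has at most the prize of X, and c(P) <= chi.

   Running time: only the order of the edges by D is needed. Start with each
   edge as its own group and repeatedly merge a densest group into the group
   above it. When the group of e is merged its density is D(e), and these
   densities never increase, so the merge order sorts the edges by D. Greedy
   then takes the first edge in this order that hangs from the current tree. *)
From mathcomp Require Import all_boot all_order all_algebra.
From mathcomp Require Import ring lra zify.
From mathcomp Require Import reals.
Require Import Defs.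
Set Implicit Arguments.
Unset Strict Implicit.
Unset Printing Implicit Defensive.
Import Order.TTheory GRing.Theory Num.Theory.
Local Open Scope ring_scope.

(** * Rooted trees and the densest subtree below an edge *)

(* [anc v] is the edge set of the path from the root to [v]. *)
Record rooting (R : realFieldType) (I : instance R) := Rooting {
  up : edge I -> vert I;
  dn : edge I -> vert I;
  anc : vert I -> {set edge I};
  joins_up_dn : forall e, joins e (up e) (dn e);
  dn_inj : injective dn;
  dn_onto : forall v, v != root I -> exists e, v = dn e;
  anc_root : anc (root I) = set0;
  anc_dn : forall e, anc (dn e) = e |: anc (up e);
  anc_up : forall e, e \notin anc (up e)
}.

Section Forest.
Variables (R : realFieldType) (I : instance R) (rt : rooting I).
Implicit Types (e f g h : edge I) (S T X Y O : {set edge I}).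

Definition lineage e : {set edge I} := anc rt (dn rt e).

Lemma mem_lineage e : e \in lineage e.
Proof. by rewrite /lineage anc_dn setU11. Qed.

Lemma dn_neq_root e : dn rt e != root I.
Proof.
by apply/eqP => E; have := mem_lineage e; rewrite /lineage E anc_root inE.
Qed.

Lemma rooting_ind (P : vert I -> Prop) :
  P (root I) -> (forall e, P (up rt e) -> P (dn rt e)) -> forall v, P v.
Proof.
move=> P0 PS v; have [k] := ubnP #|anc rt v|.
elim: k v => // k IH v; case: (eqVneq v (root I)) => [-> //|/(dn_onto rt) [e ->]].
by rewrite anc_dn cardsU1 anc_up add1n ltnS => lt_k; apply: PS; apply: IH.
Qed.

Lemma anc_lineage v e : e \in anc rt v -> lineage e \subset anc rt v.
Proof.
elim/rooting_ind: v e => [e|f IH e]; first by rewrite anc_root inE.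
rewrite anc_dn in_setU1 => /orP[/eqP->|/IH le]; first by rewrite /lineage anc_dn.
by apply: subset_trans le _; apply: subsetUr.
Qed.

Lemma lineage_sub e f : f \in lineage e -> lineage f \subset lineage e.
Proof. exact: anc_lineage. Qed.

Lemma lineage_trans e f g : f \in lineage e -> g \in lineage f -> g \in lineage e.
Proof. by move=> /lineage_sub/subsetP; apply. Qed.

Lemma anc_total v f g : f \in anc rt v -> g \in anc rt v ->
  (f \in lineage g) || (g \in lineage f).
Proof.
elim/rooting_ind: v => [|e IH]; first by rewrite anc_root inE.
rewrite anc_dn !in_setU1 => /orP[/eqP->|fe] /orP[/eqP->|ge].
- by rewrite mem_lineage.
- by rewrite orbC /lineage anc_dn in_setU1 ge orbT.
- by rewrite /lineage anc_dn in_setU1 fe orbT.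
- exact: IH.
Qed.

Lemma lineage_total e f g : f \in lineage e -> g \in lineage e ->
  (f \in lineage g) || (g \in lineage f).
Proof. exact: anc_total. Qed.

Lemma lineage_anti e f : f \in lineage e -> e \in lineage f -> e = f.
Proof.
rewrite {1}/lineage anc_dn in_setU1 => /orP[/eqP->//|fe] /(subsetP (anc_lineage fe)).
by rewrite (negPf (anc_up rt e)).
Qed.

Lemma lineage_card e f : f \in lineage e -> f != e ->
  (#|lineage f| < #|lineage e|)%N.
Proof.
move=> fe nfe; apply/proper_card/properP; split; first exact: lineage_sub.
exists e; first exact: mem_lineage.
by apply: contra nfe => /(lineage_anti fe)->.
Qed.

Definition closed X : bool := [forall e in X, lineage e \subset X].

Lemma closedP X : reflect (forall e f, e \in X -> f \in lineage e -> f \in X) (closed X).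
Proof.
apply: (iffP forall_inP) => [H e f /H/subsetP|H e eX]; first exact.
by apply/subsetP => f; apply: H.
Qed.

Lemma closed0 : closed set0.
Proof. by apply/closedP => e f; rewrite inE. Qed.

Lemma closedU X Y : closed X -> closed Y -> closed (X :|: Y).
Proof.
move=> /closedP HX /closedP HY; apply/closedP => e f.
by rewrite !inE => /orP[/HX H /H->//|/HY H /H->]; rewrite orbT.
Qed.

Definition frontier X e : bool := (e \notin X) && (lineage e :\ e \subset X).

Lemma frontierP X e :
  reflect (e \notin X /\ forall f, f \in lineage e -> f != e -> f \in X) (frontier X e).
Proof.
apply: (iffP andP) => -[eX H]; split=> //.
  by move=> f fe nfe; apply: (subsetP H); rewrite !inE nfe.
by apply/subsetP => f; rewrite !inE => /andP[nfe fe]; apply: H.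
Qed.

Lemma closed_frontier X e : closed X -> frontier X e -> closed (e |: X).
Proof.
move=> /closedP HX /frontierP[_ H]; apply/closedP => f g.
rewrite !inE => /orP[/eqP-> ge|/HX H' /H'->]; last by rewrite orbT.
by case: eqP => //= /eqP; apply: H.
Qed.

Lemma frontier_below X g : g \notin X -> exists2 f, frontier X f & f \in lineage g.
Proof.
move=> gX; pose P f := (f \notin X) && (f \in lineage g).
have Pg : P g by rewrite /P gX mem_lineage.
case: (arg_minnP (fun f => #|lineage f|) Pg) => f /andP[fX fg] fmin.
exists f => //; apply/frontierP; split=> // h hf nhf.
apply: contraTT (lineage_card hf nhf) => hX; rewrite -leqNgt; apply: fmin.
by rewrite /P hX (lineage_trans fg).
Qed.

(* The edge sets of the connected subtrees with topmost edge [e]. *)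
Definition topped e S : bool :=
  (e \in S) && [forall g in S, (e \in lineage g) &&
    [forall h in lineage g, (e \in lineage h) ==> (h \in S)]].

Lemma toppedP e S : reflect
  [/\ e \in S, (forall g, g \in S -> e \in lineage g) &
      forall g h, g \in S -> h \in lineage g -> e \in lineage h -> h \in S]
  (topped e S).
Proof.
apply: (iffP andP) => [[eS /forall_inP H]|[eS H1 H2]]; split=> //.
- by move=> g /H/andP[].
- move=> g h /H/andP[_ /forall_inP/(_ h)] H' /H' /implyP; exact.
- apply/forall_inP => g gS; rewrite H1 //=; apply/forall_inP => h hg.
  by apply/implyP; apply: H2 hg.
Qed.

Lemma topped1 e : topped e [set e].
Proof.
apply/toppedP; split=> [|g|g h]; rewrite ?inE //; first by move/eqP->; apply: mem_lineage.
by move=> /eqP-> he eh; rewrite (lineage_anti he eh).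
Qed.

Lemma topped_closedU X e S :
  closed X -> frontier X e -> topped e S -> closed (X :|: S).
Proof.
move=> /closedP HX /frontierP[eX He] /toppedP[eS S1 S2]; apply/closedP => f g.
rewrite !inE => /orP[/HX H /H->//|fS gf]; case: (boolP (g \in X)) => //= gX.
apply: (S2 _ _ fS gf); have /orP[//|ge] := lineage_total (S1 _ fS) gf.
by case: (eqVneq g e) => [->|/(He _ ge)]; rewrite ?mem_lineage // (negPf gX).
Qed.

Lemma topped_disjoint X e S :
  closed X -> e \notin X -> topped e S -> [disjoint S & X].
Proof.
move=> /closedP HX eX /toppedP[_ S1 _].
by apply/pred0P => g /=; apply/negP => /andP[/S1 eg /HX/(_ eg)]; rewrite (negPf eX).
Qed.

Lemma below_topped X Y e : closed (X :|: Y) -> closed X -> e \in Y -> frontier X e ->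
  topped e [set g in Y | e \in lineage g].
Proof.
move=> /closedP XY /closedP cX eY /frontierP[eX _]; apply/toppedP; split.
- by rewrite inE eY mem_lineage.
- by move=> g; rewrite inE => /andP[].
- move=> g h; rewrite !inE => /andP[gY eg] hg eh; rewrite eh andbT.
  have := XY g h; rewrite !inE gY orbT => /(_ isT hg) /orP[/cX/(_ eh)|//].
  by rewrite (negPf eX).
Qed.

Definition gain e : R := prize (dn rt e).
Definition wt S : R := \sum_(e in S) gain e.
Definition ct S : R := \sum_(e in S) cost e.

Lemma wt_ge0 S : 0 <= wt S.
Proof. by apply: sumr_ge0 => e _; apply: prize_ge0. Qed.

Lemma ct_ge0 S : 0 <= ct S.
Proof. by apply: sumr_ge0 => e _; rewrite ltW ?cost_gt0. Qed.

Lemma ct_gt0 S e : e \in S -> 0 < ct S.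
Proof.
move=> eS; rewrite /ct (bigD1 e) //= ltr_pwDl ?cost_gt0 //.
by apply: sumr_ge0 => f _; rewrite ltW ?cost_gt0.
Qed.

Lemma wtU S T : [disjoint S & T] -> wt (S :|: T) = wt S + wt T.
Proof. by move=> dST; rewrite /wt -bigU //; apply: eq_bigl => e; rewrite !inE. Qed.

Lemma ctU S T : [disjoint S & T] -> ct (S :|: T) = ct S + ct T.
Proof. by move=> dST; rewrite /ct -bigU //; apply: eq_bigl => e; rewrite !inE. Qed.

Lemma wtID S T : wt S = wt (S :&: T) + wt (S :\: T).
Proof. exact: big_setID. Qed.

Lemma ctID S T : ct S = ct (S :&: T) + ct (S :\: T).
Proof. exact: big_setID. Qed.

Lemma wtS S T : S \subset T -> wt S <= wt T.
Proof. by move=> /setIidPr ST; rewrite (wtID T S) ST lerDl wt_ge0. Qed.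

Lemma ctS S T : S \subset T -> ct S <= ct T.
Proof. by move=> /setIidPr ST; rewrite (ctID T S) ST lerDl ct_ge0. Qed.

Definition topdens e : R := \big[Num.max/0]_(S | topped e S) (wt S / ct S).

Lemma topdens_ge0 e : 0 <= topdens e.
Proof.
rewrite /topdens; elim/big_rec: _ => // S x _ x0.
by rewrite le_max x0 orbT.
Qed.

Lemma topdens_ub e S : topped e S -> wt S <= topdens e * ct S.
Proof.
move=> eS; have [eS' _ _] := toppedP _ _ eS.
rewrite -ler_pdivrMr ?(ct_gt0 eS') // /topdens.
by rewrite (bigD1 S) //= le_max lexx.
Qed.

Lemma topdens_attained e : exists2 S, topped e S & wt S = topdens e * ct S.
Proof.
case: (Order.TotalTheory.arg_maxP (fun S => wt S / ct S) (topped1 e)) => S eS Smax.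
exists S => //; have [eS' _ _] := toppedP _ _ eS.
apply/le_anti; rewrite topdens_ub //= -ler_pdivlMr ?(ct_gt0 eS') //.
rewrite /topdens; elim/big_rec: _ => [|T x /Smax ? ?].
  by rewrite divr_ge0 ?wt_ge0 ?ct_ge0.
by rewrite ge_max; apply/andP.
Qed.

Lemma topdens_le e l : 0 <= l -> (forall S, topped e S -> wt S <= l * ct S) ->
  topdens e <= l.
Proof.
move=> l0 H; rewrite /topdens; elim/big_rec: _ => [//|S x eS xl].
have [eS' _ _] := toppedP _ _ eS.
by rewrite ge_max xl andbT ler_pdivrMr ?(ct_gt0 eS') // H.
Qed.

Lemma frontier_wt_le X Y l : closed X -> closed (X :|: Y) -> [disjoint Y & X] ->
  (forall f, frontier X f -> f \in Y -> topdens f <= l) -> wt Y <= l * ct Y.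
Proof.
move=> cX; have [k] := ubnP #|Y|; elim: k Y => // k IH Y ltk cXY dYX Hl.
case: (set_0Vmem Y) => [->|[g gY]]; first by rewrite /wt /ct !big_set0 mulr0.
have [f frf fg] : exists2 f, frontier X f & f \in lineage g.
  by apply: frontier_below; rewrite (disjointFr dYX).
have fY : f \in Y.
  have /closedP/(_ g f) := cXY; rewrite !inE gY orbT => /(_ isT fg).
  by have /andP[/negPf->] := frf.
pose Z := [set g in Y | f \in lineage g].
have tZ : topped f Z by apply: below_topped cXY cX fY frf.
have sZY : Z \subset Y by apply/subsetP => h; rewrite inE => /andP[].
rewrite (wtID Y Z) (ctID Y Z) (setIidPr sZY) mulrDr lerD //.
  apply: le_trans (topdens_ub tZ) _.
  by rewrite ler_wpM2r ?ct_ge0 ?Hl.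
apply: IH.
- apply: leq_trans (_ : #|Y| <= k)%N; last by rewrite -ltnS.
  apply/proper_card/properP; split; first exact: subsetDl.
  by exists f => //; rewrite !inE fY mem_lineage.
- apply/closedP => h h'; rewrite !inE => /orP[hX|/andP[hZ hY]] hh'.
    by have /closedP/(_ h h' hX hh')-> := cX.
  have /closedP/(_ h h') := cXY; rewrite !inE hY orbT => /(_ isT hh') /orP[->//|h'Y].
  rewrite h'Y andbT /=; apply/orP; right.
  by apply: contra hZ => fh'; rewrite hY (lineage_trans hh').
- by apply: disjointWl dYX; apply: subsetDl.
- by move=> h frh; rewrite inE => /andP[_]; apply: Hl.
Qed.

Definition greedy_choice X e : Prop :=
  frontier X e /\ forall f, frontier X f -> topdens f <= topdens e.

End Forest.

(** * Runs of the greedy rule *)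

Section Run.
Variables (R : realFieldType) (I : instance R) (rt : rooting I).
Variables (pi : seq (edge I)) (e0 : edge I).
Implicit Types (S T M W O : {set edge I}).

Let X k : {set edge I} := [set e in take k pi].
Let E k : edge I := nth e0 pi k.
Let L := lineage rt.
Let D := topdens rt.

Hypothesis run : forall k, (k < size pi)%N -> greedy_choice rt (X k) (E k).

Lemma run_setS k : (k < size pi)%N -> X k.+1 = E k |: X k.
Proof. by move=> ltk; apply/setP => e; rewrite !inE (take_nth e0) // mem_rcons inE. Qed.

Lemma run_closed k : closed rt (X k).
Proof.
elim: k => [|k IH]; first by rewrite /X take0; apply: closed0.
case: (ltnP k (size pi)) => ltk.
  by rewrite run_setS //; apply: closed_frontier => //; case: (run ltk).
by move: IH; rewrite /X !take_oversize // leqW.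
Qed.

Lemma run_mono i k : (i <= k)%N -> X i \subset X k.
Proof.
move=> le; apply/subsetP => e; rewrite !inE.
by rewrite -{1}(take_takel pi le); apply: mem_take.
Qed.

Lemma run_memP k e :
  reflect (exists i, [/\ (i < k)%N, (i < size pi)%N & e = E i]) (e \in X k).
Proof.
rewrite inE; apply: (iffP idP) => [|[i [ik isz ->]]].
  case/(nthP e0) => i; rewrite size_take_min leq_min => /andP[ik isz] <-.
  by exists i; rewrite nth_take.
by rewrite /E -(nth_take _ ik) mem_nth // size_take_min leq_min ik.
Qed.

Lemma run_mem_diff i k e : e \in X k -> e \notin X i ->
  exists j, [/\ (i <= j)%N, (j < k)%N, (j < size pi)%N & e = E j].
Proof.
move=> /run_memP[j [jk jsz ej]] eXi; exists j; split=> //.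
by rewrite leqNgt; apply: contra eXi => ji; apply/run_memP; exists j.
Qed.

Lemma run_frontier k : (k < size pi)%N -> frontier rt (X k) (E k).
Proof. by case/run. Qed.

Definition min_densest g (S : {set edge I}) : Prop :=
  [/\ topped rt g S, wt rt S = D g * ct S &
      forall T, topped rt g T -> wt rt T = D g * ct T -> (#|S| <= #|T|)%N].

Lemma min_densest_exists g : exists S, min_densest g S.
Proof.
have [S0 tS0 dS0] := topdens_attained rt g.
pose P S := topped rt g S && (wt rt S == D g * ct S).
have PS0 : P S0 by rewrite /P tS0 dS0 eqxx.
case: (arg_minnP (fun S : {set edge I} => #|S|) PS0) => S /andP[tS /eqP dS] minS.
by exists S; split=> // T tT dT; apply: minS; rewrite /P tT dT eqxx.
Qed.

(* What remains of a smallest densest subtree once a part of it has been taken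
   is strictly denser than the whole, so greedy does not leave it. *)
Lemma run_stays i k S : (i <= k < size pi)%N -> min_densest (E i) S ->
  S \subset X k \/ E k \in S.
Proof.
move=> /andP[ik ksz] [tS dS minS].
have [gS S1 S2] := toppedP _ _ _ tS.
elim/ltn_ind: k ik ksz => k IH ik ksz.
case: (boolP (S \subset X k)) => [|nSX]; [by left | right].
case: (ltngtP i k) ik => // [lt_ik _|<- _ //].
have isz : (i < size pi)%N by apply: ltn_trans ksz.
have steps j : (i <= j < k)%N -> E j \in S.
  case/andP=> ij jk; have [sSX|//] := IH j jk ij (ltn_trans jk ksz).
  by case/negP: nSX; apply: subset_trans sSX (run_mono (ltnW jk)).
apply: contraT => eS.
have cX := run_closed k; have cXP := closedP _ _ cX.
have gX : E i \in X k by apply/run_memP; exists i.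
have tQ : topped rt (E i) (S :&: X k).
  apply/toppedP; split=> [|x|x h]; rewrite ?in_setI ?gS //.
    by case/andP=> /S1.
  by case/andP=> xS xX hx gh; rewrite (S2 _ _ xS hx gh) (cXP _ _ xX hx).
have ltQ : wt rt (S :&: X k) < D (E i) * ct (S :&: X k).
  rewrite lt_neqAle topdens_ub // andbT; apply/eqP => dQ.
  have := minS _ tQ dQ; apply/negP; rewrite -ltnNge; apply/proper_card.
  by rewrite properE subsetIl subsetI subxx.
have gtS : D (E i) * ct (S :\: X k) < wt rt (S :\: X k).
  by move: dS; rewrite (wtID rt S (X k)) (ctID S (X k)); lra.
have cXS : closed rt (X k :|: S :\: X k).
  have -> : X k :|: S :\: X k = X k :|: (X i :|: S).
    apply/setP => x; rewrite !in_setU in_setD; case: (boolP (x \in X k)) => //= xX.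
    case: (boolP (x \in X i)) => //= /(subsetP (run_mono (ltnW lt_ik))).
    by rewrite (negPf xX).
  apply: closedU => //; apply: topped_closedU (tS); first exact: run_closed.
  exact: run_frontier.
have [f frf Df] : exists2 f, frontier rt (X k) f & D (E i) < D f.
  case: (boolP [exists f, frontier rt (X k) f && (D (E i) < D f)]).
    by case/existsP=> f /andP[]; exists f.
  rewrite negb_exists => /forallP H; exfalso; move: gtS; apply/negP; rewrite -leNgt.
  apply: (frontier_wt_le cX cXS); first by rewrite -setI_eq0 setIDAC -setIDA setDv setI0.
  by move=> f frf _; have := H f; rewrite frf -leNgt.
have De : D (E i) < D (E k) by apply: lt_le_trans Df _; have [_] := run ksz; apply.
have /frontierP[eX He] := run_frontier ksz.
have [h [he neh hi]] : exists h, [/\ h \in L (E k), h != E k & h \notin X i].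
  case: (boolP (frontier rt (X i) (E k))) => [fr|].
    by have [_ /(_ _ fr)] := run isz; rewrite leNgt De.
  rewrite negb_and negbK; case/orP=> [eXi|/subsetPn[h]].
    by case/negP: eX; apply: subsetP eXi; apply: run_mono (ltnW _).
  by rewrite !inE => /andP[neh hl] nhX; exists h; rewrite inE.
have hS : h \in S.
  have [j [ij jk _ ->]] := run_mem_diff (He _ he neh) hi.
  by apply: steps; rewrite ij.
have ge : E i \in L (E k) by apply: lineage_trans he (S1 _ hS).
have [T tT dT] := topdens_attained rt (E k).
have [eT T1 T2] := toppedP _ _ _ tT.
have dST : [disjoint S & T].
  apply/pred0P => x /=; apply/negP => /andP[xS xT]; case/negP: eS.
  exact: (S2 x) (T1 _ xT) _.
have tU : topped rt (E i) (S :|: T).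
  apply/toppedP; split=> [|x|x y]; rewrite !inE ?gS //.
    by case/orP=> [/S1//|/T1 ex]; apply: lineage_trans ex ge.
  case/orP=> [xS yx gy|xT yx gy]; first by rewrite (S2 _ _ xS).
  have /orP[ey|ye] := lineage_total (T1 _ xT) yx; first by rewrite (T2 _ _ xT) ?orbT.
  case: (eqVneq y (E k)) => [->|nye]; first by rewrite eT orbT.
  have yi : y \notin X i.
    apply/negP => /(closedP _ _ (run_closed i))/(_ gy).
    by apply/negP; have /frontierP[] := run_frontier isz.
  have [j [ij jk _ ->]] := run_mem_diff (He _ ye nye) yi.
  by rewrite steps ?ij.
have := topdens_ub tU; rewrite wtU // ctU // dS dT mulrDr lerD2l.
by rewrite leNgt ltr_pM2r ?De // (ct_gt0 eT).
Qed.

Lemma run_up_wt k W l : (k < size pi)%N -> W \subset X k ->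
  [disjoint W & L (E k)] ->
  (forall x y, x \in W -> y \in X k -> x \in L y -> y \in W) ->
  (forall x, x \in W -> l <= D x) -> l * ct W <= wt rt W.
Proof.
move=> ksz; have [n] := ubnP #|W|; elim: n W => // n IH W ltn sWX dW upW Dl.
case: (set_0Vmem W) => [->|[g0 g0W]]; first by rewrite /ct /wt !big_set0 mulr0.
case: (arg_minnP (fun g => #|L g|) g0W) => {g0 g0W} g gW ming.
have [i [ik isz gE]] := run_memP _ _ (subsetP sWX _ gW).
have [S mS] := min_densest_exists g; have [tS dS _] := mS.
have [gS S1 S2] := toppedP _ _ _ tS.
have sSX : S \subset X k.
  have iksz : (i <= k < size pi)%N by rewrite (ltnW ik).
  move: mS; rewrite gE => /(run_stays iksz)[//|/S1]; rewrite -/L => gk.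
  by have := disjointFr dW gW; rewrite gk.
have sSW : S \subset W.
  by apply/subsetP => x xS; apply: (upW g) => //; [apply: subsetP xS | apply: S1].
rewrite (wtID rt W S) (ctID W S) (setIidPr sSW) mulrDr lerD //.
  by rewrite dS ler_wpM2r ?ct_ge0 ?Dl.
apply: IH.
- apply: leq_trans (_ : #|W| <= n)%N; last by rewrite -ltnS.
  apply/proper_card/properP; split; first exact: subsetDl.
  by exists g; rewrite // !inE gS.
- by apply: subset_trans sWX; apply: subsetDl.
- by apply: disjointWl dW; apply: subsetDl.
- move=> x y; rewrite !inE => /andP[xS xW] yX xy; rewrite (upW x) ?andbT ?inE //.
  apply: contra xS => yS; have /orP[gx|xg] := lineage_total (S1 _ yS) xy.
    exact: (S2 y).
  case: (eqVneq x g) => [->//|nxg].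
  by have := lineage_card xg nxg; rewrite ltnNge ming.
- by move=> x; rewrite inE => /andP[_]; apply: Dl.
Qed.

Lemma run_maximizer i O : (i < size pi)%N ->
  (forall j, (j < i)%N -> D (E i) <= D (E j)) -> closed rt O ->
  wt rt O - D (E i) * ct O <= wt rt (X i) - D (E i) * ct (X i).
Proof.
move=> isz Dmin cO; set l := D (E i); pose val S := wt rt S - l * ct S.
have [M0 cM0 maxM0] : exists2 M, closed rt M & forall S, closed rt S -> val S <= val M.
  have [M cM maxM] := Order.TotalTheory.arg_maxP val (closed0 rt).
  by exists M => // S /maxM.
have [M [cM maxM cardM]] : exists M, [/\ closed rt M,
    forall S, closed rt S -> val S <= val M &
    forall S, closed rt S -> val M <= val S -> (#|S| <= #|M|)%N].
  pose P S := closed rt S && (val M0 <= val S).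
  have PM0 : P M0 by rewrite /P cM0 lexx.
  have [M /andP[cM geM] maxM] := arg_maxnP (fun S : {set edge I} => #|S|) PM0.
  exists M; split=> // S cS; first by apply: le_trans geM; apply: maxM0.
  by move=> le; apply: maxM; rewrite /P cS (le_trans geM le).
have sXM : X i \subset M.
  have: (i <= i)%N by []; elim: {1 3}i => [|j IH] ji.
    by apply/subsetP => x; rewrite inE take0.
  have jsz : (j < size pi)%N by apply: leq_trans (ltnW isz).
  have sXj := IH (ltnW ji); rewrite run_setS // subUset sXj andbT sub1set.
  apply: contraT => eM.
  have [T tT dT] := topdens_attained rt (E j).
  have [eT _ _] := toppedP _ _ _ tT.
  have dTM : [disjoint T & M] by apply: topped_disjoint eM tT.
  have cMT : closed rt (M :|: T).
    have -> : M :|: T = M :|: (X j :|: T) by rewrite setUA (setUidPl sXj).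
    apply: closedU => //; apply: topped_closedU (tT); first exact: run_closed.
    exact: run_frontier.
  have dMT : [disjoint M & T] by rewrite disjoint_sym.
  have le : val M <= val (M :|: T).
    rewrite /val wtU // ctU // dT.
    have := Dmin j ji; rewrite -/l -/(D (E j)) => lD.
    have := ler_wpM2r (ct_ge0 T) lD; lra.
  have := cardM _ cMT le; rewrite leqNgt => /negP[]; apply/proper_card/properP.
  by split; [apply: subsetUl | exists (E j); rewrite // inE eT orbT].
apply: le_trans (maxM _ cO) _; rewrite /val (wtID rt M (X i)) (ctID M (X i)).
rewrite (setIidPr sXM).
have : wt rt (M :\: X i) <= l * ct (M :\: X i).
  apply: frontier_wt_le (run_closed i) _ _ _.
  - have -> : X i :|: M :\: X i = M by rewrite setUC -{2}(setIidPr sXM) setUC setID.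
    exact: cM.
  - by rewrite -setI_eq0 setIDAC -setIDA setDv setI0.
  - by move=> f frf _; have [_] := run isz; apply.
lra.
Qed.

Lemma run_dominates k O : (k < size pi)%N -> closed rt O ->
  ct O <= ct (X k :\: L (E k)) -> wt rt O <= wt rt (X k).
Proof.
move=> ksz cO leO.
have [i _ mini] := Order.TotalTheory.arg_minP
  (fun j : 'I_k.+1 => D (E j)) (erefl true : xpredT ord0).
have ik : (i <= k)%N by rewrite -ltnS.
have isz : (i < size pi)%N by apply: leq_ltn_trans ksz.
have Dmin j : (j <= k)%N -> D (E i) <= D (E j).
  by rewrite -ltnS => jk; apply: (mini (Ordinal jk)).
have leOi : wt rt O - D (E i) * ct O <= wt rt (X i) - D (E i) * ct (X i).
  by apply: run_maximizer => // j ji; apply: Dmin; apply: leq_trans ik; apply: ltnW.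
have sXi := run_mono ik.
pose W := X k :\: X i :\: L (E k).
have leW : D (E i) * ct W <= wt rt W.
  apply: (run_up_wt ksz).
  - by apply: subset_trans (subsetDl _ _) (subsetDl _ _).
  - by rewrite -setI_eq0 setIDAC -setIDA setDv setI0.
  - move=> x y; rewrite 4!in_setD => /and3P[xL xi xk] yk xy; rewrite yk andbT.
    apply/andP; split; first by apply: contra xL => yL; apply: lineage_trans yL xy.
    by apply: contra xi => /(closedP _ _ (run_closed i)); apply.
  - move=> x; rewrite 2!in_setD => /and3P[_ _ /run_memP[j [jk _ ->]]].
    exact: Dmin (ltnW jk).
have ct_le : ct (X k :\: L (E k)) <= ct (X i) + ct W.
  rewrite (ctID _ (X i)) lerD //; apply: ctS; first exact: subsetIr.
  by rewrite /W setDDl setUC -setDDl.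
have wt_le : wt rt (X i) + wt rt W <= wt rt (X k).
  by rewrite (wtID rt (X k) (X i)) (setIidPr sXi) lerD2l; apply: wtS; apply: subsetDl.
have := ler_wpM2l (topdens_ge0 rt (E i)) (le_trans leO ct_le).
rewrite -/(D (E i)); lra.
Qed.

End Run.

(** * Walks, and rooting a tree *)

Section Walks.
Variables (R : realFieldType) (I : instance R).
Implicit Types (e f : edge I) (x y z v : vert I) (s t : seq (edge I * vert I)).

Lemma joins_sym e x y : joins e x y = joins e y x.
Proof. by rewrite /joins orbC. Qed.

Lemma joins_eq e x y z (t : vert I) : joins e x y -> joins e z t ->
  x = z /\ y = t \/ x = t /\ y = z.
Proof.
by rewrite /joins => /orP[] /andP[/eqP<- /eqP<-] /orP[] /andP[/eqP<- /eqP<-]; auto.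
Qed.

Lemma incident_joins e x y v : joins e x y -> incident e v = (v == x) || (v == y).
Proof.
by rewrite /joins /incident => /orP[] /andP[/eqP<- /eqP<-];
  rewrite ![_ == v]eq_sym // orbC.
Qed.

Lemma walk_cat x s t :
  walk x (s ++ t) = walk x s && walk (last x (unzip2 s)) t.
Proof. by elim: s x => [|[e y] s IH] x //=; rewrite IH andbA. Qed.

Lemma walk_from_to_cat x y z s t :
  walk_from_to x y s -> walk_from_to y z t -> walk_from_to x z (s ++ t).
Proof.
move=> /andP[ws /eqP ls] /andP[wt /eqP lt].
by rewrite /walk_from_to walk_cat ws /unzip2 map_cat last_cat -/(unzip2 _) ls wt lt eqxx.
Qed.

Lemma walk_rev x y s : walk_from_to x y s ->
  exists2 t, walk_from_to y x t & unzip1 t =i unzip1 s.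
Proof.
elim: s x => [|[e z] s IH] x; first by case/andP=> _ /eqP <-; exists [::]; rewrite ?/walk_from_to ?eqxx.
case/andP=> /= /andP[jxz ws] ls.
have /IH[t wt et] : walk_from_to z y s by rewrite /walk_from_to ws.
exists (rcons t (e, x)).
  by rewrite -cats1; apply: walk_from_to_cat wt _; rewrite /walk_from_to /= joins_sym jxz eqxx.
by move=> f; rewrite /unzip1 map_rcons mem_rcons !inE /= et.
Qed.

Lemma walk_exit (U : {set vert I}) x s :
  walk x s -> x \in U -> last x (unzip2 s) \notin U ->
  exists e y z, [/\ joins e y z, y \in U & z \notin U].
Proof.
elim: s x => [|[e y] s IH] x /=; first by move=> _ ->.
case/andP=> jxy ws xU lU; case: (boolP (y \in U)) => yU; first exact: IH ws yU lU.
by exists e, x, y.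
Qed.

Lemma walk_suffix x y t : walk y t -> uniq (y :: unzip2 t) -> x \in y :: unzip2 t ->
  exists s, [/\ walk x s, last x (unzip2 s) = last y (unzip2 t),
    uniq (x :: unzip2 s) & {subset unzip1 s <= unzip1 t}].
Proof.
elim: t y => [|[e z] t IH] y wt ut; rewrite in_cons => /orP[/eqP->|] //.
- by exists [::].
- by exists ((e, z) :: t); split.
move=> xt; case/andP: wt => _ wt; case/andP: ut => _ ut.
have [s [ws ls us ss]] := IH z wt ut xt; exists s; split=> //.
by move=> f /ss; rewrite /= inE orbC => ->.
Qed.

Lemma walk_simple x s : walk x s ->
  exists t, [/\ walk x t, last x (unzip2 t) = last x (unzip2 s),
    uniq (x :: unzip2 t) & {subset unzip1 t <= unzip1 s}].
Proof.
elim: s x => [|[e y] s IH] x; first by exists [::].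
case/andP=> jxy /IH[t [wt lt ut st]].
case: (boolP (x \in y :: unzip2 t)) => xt.
  have [u [wu lu uu su]] := walk_suffix wt ut xt; exists u; split=> //.
    by rewrite lu lt.
  by move=> f /su/st fs; rewrite /= inE fs orbT.
exists ((e, y) :: t); split=> //.
- by rewrite /= jxy.
- by rewrite [X in uniq X]/= cons_uniq xt.
- by move=> f; rewrite /= !inE => /orP[->//|/st ->]; rewrite orbT.
Qed.

Lemma walk_visits x s e y : walk x s -> (e, y) \in s ->
  exists2 z, joins e z y & z \in x :: unzip2 s.
Proof.
elim: s x => [//|[f z] s IH] x /= /andP[jxz ws]; rewrite inE => /orP[/eqP[-> ->]|eys].
  by exists x; rewrite // inE eqxx.
by have [t jt ts] := IH z ws eys; exists t; rewrite // inE ts orbT.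
Qed.

Lemma path_uniq_edges x s : walk x s -> uniq (x :: unzip2 s) -> uniq (unzip1 s).
Proof.
elim: s x => [//|[e y] s IH] x /andP[jxy ws] /andP[xs us].
rewrite /= (IH y) // andbT; apply/mapP => -[[f z] fzs /= ef].
have [t jt tys] := walk_visits ws fzs.
have zs : z \in y :: unzip2 s by rewrite inE (map_f snd fzs) orbT.
rewrite -ef in jt; case/negP: xs.
by case: (joins_eq jxy jt) => -[-> _].
Qed.

End Walks.

Section PartialRooting.
Variables (R : realFieldType) (I : instance R).

Record partial_rooting (A : {set edge I}) (U : {set vert I}) := PartialRooting {
  pup : edge I -> vert I;
  pdn : edge I -> vert I;
  panc : vert I -> {set edge I};
  proot : root I \in U;
  pjoins : forall e, e \in A -> joins e (pup e) (pdn e);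
  pup_in : forall e, e \in A -> pup e \in U;
  pdn_in : forall e, e \in A -> pdn e \in U;
  pdn_inj : {in A &, injective pdn};
  pdn_onto : forall v, v \in U -> v != root I -> exists2 e, e \in A & v = pdn e;
  panc_root : panc (root I) = set0;
  panc_dn : forall e, e \in A -> panc (pdn e) = e |: panc (pup e);
  panc_up : forall e, e \in A -> e \notin panc (pup e);
  panc_sub : forall v, v \in U -> panc v \subset A;
  pwalk : forall v, v \in U ->
    exists2 s, walk_from_to (root I) v s & {subset unzip1 s <= A}
}.

Lemma partial_rooting1 : partial_rooting set0 [set root I].
Proof.
apply: (@PartialRooting _ _ (fun=> root I) (fun=> root I) (fun=> set0)) => //;
  try by move=> e; rewrite inE.
- by rewrite inE.
- by move=> v; rewrite inE => /eqP->; rewrite eqxx.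
- by move=> v; rewrite inE => /eqP->; exists [::]; rewrite ?/walk_from_to ?eqxx.
Qed.

Lemma partial_rooting_step A U e x y : partial_rooting A U ->
  joins e x y -> x \in U -> y \notin U -> partial_rooting (e |: A) (y |: U).
Proof.
move=> rt jxy xU yU.
have eA : e \notin A.
  apply/negP => eA; case/negP: yU.
  by case: (joins_eq jxy (pjoins rt eA)) => -[_ ->]; rewrite ?pdn_in ?pup_in.
have neA f : f \in A -> (f == e) = false.
  by move=> fA; apply: contraNF eA => /eqP<-.
have neU v : v \in U -> (v == y) = false.
  by move=> vU; apply: contraNF yU => /eqP<-.
apply: (@PartialRooting _ _ (fun f => if f == e then x else pup rt f)
  (fun f => if f == e then y else pdn rt f)
  (fun v => if v == y then e |: panc rt x else panc rt v)).
- by rewrite inE (proot rt) orbT.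
- move=> f; rewrite !inE; case: eqP => [->|_] //=; exact: pjoins.
- move=> f; rewrite !inE; case: eqP => [_|_] //=; first by rewrite xU orbT.
  by move=> fA; rewrite pup_in ?orbT.
- move=> f; rewrite !inE; case: eqP => [_|_] //=; first by rewrite eqxx.
  by move=> fA; rewrite pdn_in ?orbT.
- move=> f g; rewrite !inE; case: eqP => [->|_] /= fA; case: eqP => [->|_] //= gA.
  + by move=> E; case/negP: yU; rewrite E pdn_in.
  + by move=> E; case/negP: yU; rewrite -E pdn_in.
  + exact: pdn_inj.
- move=> v; rewrite !inE => /orP[/eqP-> _|vU vr].
    by exists e; rewrite ?eqxx // !inE eqxx.
  have [f fA ->] := pdn_onto rt vU vr.
  by exists f; rewrite ?neA // !inE fA orbT.
- by rewrite neU ?(proot rt) ?(panc_root rt).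
- move=> f; rewrite !inE; case: eqP => [->|_] /=; first by rewrite eqxx neU.
  by move=> fA; rewrite !neU ?pdn_in ?pup_in // panc_dn.
- move=> f; rewrite !inE; case: eqP => [->|_] /=.
    by rewrite neU // => _; apply: contra eA; apply/subsetP; apply: panc_sub.
  by move=> fA; rewrite !neU ?pdn_in ?pup_in // panc_up.
- move=> v; rewrite !inE; case: eqP => [_ _|_ /=].
    by apply: setUS; apply: panc_sub.
  by move=> vU; apply: subset_trans (panc_sub rt vU) (subsetUr _ _).
- move=> v; rewrite !inE => /orP[/eqP->|vU].
    have [s ws sA] := pwalk rt xU; exists (s ++ [:: (e, y)]).
      by apply: walk_from_to_cat ws _; rewrite /walk_from_to /= jxy eqxx.
    move=> f; rewrite /unzip1 map_cat mem_cat !inE orbC => /orP[->//|/sA->].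
    by rewrite orbT.
  have [s ws sA] := pwalk rt vU; exists s => // f /sA fA.
  by rewrite !inE fA orbT.
Qed.

Lemma partial_rooting_full : is_tree I ->
  exists A, inhabited (partial_rooting A [set: vert I]).
Proof.
case=> _ conn _.
suff H k : forall A U, partial_rooting A U -> (#|~: U| < k)%N ->
    exists A, inhabited (partial_rooting A [set: vert I]).
  exact: H _ _ _ partial_rooting1 (ltnSn _).
elim: k => // k IH A U rt ltk.
case: (set_0Vmem (~: U)) => [U0|[v vU]].
  by exists A; rewrite -(setCK U) U0 setC0 in rt; constructor.
have [s [/andP[ws /eqP ls] _]] := conn (root I) v (in_setT _) (in_setT _).
have [||e [x [y [jxy xU yU]]]] := walk_exit (U := U) ws; first exact: proot rt.
  by rewrite ls -in_setC.
apply: IH (partial_rooting_step rt jxy xU yU) _.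
apply: leq_trans (_ : #|~: U| <= k)%N; last by rewrite -ltnS.
apply/proper_card/properP; split; first by rewrite setCS subsetUr.
by exists y; rewrite !inE ?eqxx.
Qed.

Lemma partial_rooting_edges A : is_tree I ->
  partial_rooting A [set: vert I] -> A = [set: edge I].
Proof.
case=> _ _ acy rt; apply/setP => e; rewrite in_setT.
apply: contraT => eA; set x := end1 e; set y := end2 e.
have [s ws sA] := pwalk rt (in_setT x).
have [t wt tA] := pwalk rt (in_setT y).
have [s' ws' es] := walk_rev ws.
have /andP[w /eqP l] := walk_from_to_cat ws' wt.
have [u [wu lu uu su]] := walk_simple w.
have uA f : f \in unzip1 u -> f \in A.
  move/su; rewrite /unzip1 map_cat mem_cat => /orP[|/tA//].
  by rewrite -/(unzip1 s') es => /sA.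
have /negP[] := acy y ((e, x) :: u) (fun _ _ => in_setT _).
apply/and4P; split=> //.
- by rewrite /walk_from_to /= wu lu l /joins !eqxx orbT.
- rewrite /= (path_uniq_edges wu uu) andbT.
  by apply: contra eA => /uA.
Qed.

Lemma tree_rooting : is_tree I -> inhabited (rooting I).
Proof.
move=> tI; have [A [rt]] := partial_rooting_full tI.
have AT := partial_rooting_edges tI rt; rewrite AT in rt.
constructor; apply: (@Rooting _ _ (pup rt) (pdn rt) (panc rt)).
- by move=> e; apply: pjoins.
- by move=> e f; apply: pdn_inj.
- by move=> v vr; have [|e _ ->] := pdn_onto rt _ vr => //; exists e.
- exact: panc_root.
- by move=> e; apply: panc_dn.
- by move=> e; apply: panc_up.
Qed.

End PartialRooting.

(** * Rooted subtrees as closed edge sets *)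

Section RootedSubtrees.
Variables (R : realFieldType) (I : instance R) (rt : rooting I).
Implicit Types (e f : edge I) (x y v : vert I) (s : seq (edge I * vert I)).
Implicit Types (F X : {set edge I}) (T : subgraph I).

Lemma joins_anc e f x y : joins f x y -> e != f -> (e \in anc rt x) = (e \in anc rt y).
Proof.
move=> jxy nef; case: (joins_eq jxy (joins_up_dn rt f)) => -[-> ->].
  by rewrite anc_dn !inE (negPf nef).
by rewrite anc_dn !inE (negPf nef).
Qed.

Lemma walk_anc x s : walk x s ->
  {subset anc rt (last x (unzip2 s)) <= anc rt x :|: [set e in unzip1 s]}.
Proof.
elim: s x => [|[f y] s IH] x /=; first by move=> _ e; rewrite inE => ->.
case/andP=> jxy /IH{}IH e /IH; rewrite !inE => /orP[ey|->]; last by rewrite !orbT.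
case: (eqVneq e f) => [_|nef]; first by rewrite orbT.
by rewrite (joins_anc jxy nef) ey.
Qed.

Lemma walk_from_root_anc v s : walk_from_to (root I) v s ->
  {subset anc rt v <= unzip1 s}.
Proof.
case/andP=> ws /eqP<- e /(walk_anc ws).
by rewrite anc_root set0U inE.
Qed.

Lemma walk_avoid e x s : walk x s -> e \notin unzip1 s ->
  (e \in anc rt x) = (e \in anc rt (last x (unzip2 s))).
Proof.
elim: s x => [//|[f y] s IH] x /= /andP[jxy ws].
by rewrite inE negb_or => /andP[nef es]; rewrite (joins_anc jxy nef) IH.
Qed.

(* The first edge of a cycle would separate its two ends. *)
Lemma rooting_acyclic T : acyclic T.
Proof.
move=> x [//|[e y] s] _; apply/negP => /and4P[_ /andP[/= /andP[jxy ws] /eqP ls] /andP[es _] _].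
have := walk_avoid ws es; rewrite ls.
have eu : e \in anc rt (dn rt e) by rewrite anc_dn setU11.
case: (joins_eq jxy (joins_up_dn rt e)) => -[-> ->].
  by rewrite eu (negPf (anc_up rt e)).
by rewrite eu (negPf (anc_up rt e)).
Qed.

Lemma incident_up_dn e v : incident e v = (v == up rt e) || (v == dn rt e).
Proof. exact: incident_joins (joins_up_dn rt e). Qed.

Lemma mem_formed_by F v : closed rt F ->
  (v \in (formed_by F).1) = (anc rt v \subset F).
Proof.
move=> cF; rewrite inE.
apply/orP/idP => [[/eqP->|/exists_inP[e eF]]|vF]; first by rewrite anc_root sub0set.
  have eL : lineage rt e \subset F by apply/subsetP => f; apply: closedP eF.
  rewrite incident_up_dn => /orP[]/eqP->//.
  by apply: subset_trans eL; rewrite /lineage anc_dn subsetUr.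
case: (eqVneq v (root I)) => [|nvr]; [by left | right].
have [e ve] := dn_onto rt nvr; apply/exists_inP; exists e.
  by apply: (subsetP vF); rewrite ve; apply: mem_lineage.
by rewrite incident_up_dn ve eqxx orbT.
Qed.

Lemma mem_formed_dn F e : closed rt F -> (dn rt e \in (formed_by F).1) = (e \in F).
Proof.
move=> cF; rewrite mem_formed_by //; apply/subsetP/idP => [|eF f]; first by apply; apply: mem_lineage.
exact: closedP eF.
Qed.

Lemma walk_root v : exists2 s, walk_from_to (root I) v s & {subset unzip1 s <= anc rt v}.
Proof.
elim/(@rooting_ind _ _ rt): v => [|e [s ws ss]]; first by exists [::]; rewrite // /walk_from_to eqxx.
exists (s ++ [:: (e, dn rt e)]).
  by apply: walk_from_to_cat ws _; rewrite /walk_from_to /= joins_up_dn eqxx.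
move=> f; rewrite /unzip1 map_cat mem_cat anc_dn !inE /= orbC.
by case/orP=> [->//|/ss->]; rewrite orbT.
Qed.

Lemma rooted_subtreeP T :
  rooted_subtree T <-> T = formed_by T.2 /\ closed rt T.2.
Proof.
split=> [[[sub conn _] rT]|[-> cF]]; last first.
  split; last by rewrite inE eqxx.
  split; last exact: rooting_acyclic.
    move=> e eF; rewrite !mem_formed_by //; have := joins_up_dn rt e.
    have eL : lineage rt e \subset T.2 by apply/subsetP => f; apply: closedP eF.
    have uL : anc rt (up rt e) \subset T.2.
      by apply: subset_trans eL; rewrite /lineage anc_dn subsetUr.
    by case/orP=> /andP[/eqP-> /eqP->]; rewrite uL -/(lineage rt e) eL.
  move=> x y; rewrite !mem_formed_by // => xF yF.
  have [s ws ss] := walk_root x; have [t wt st] := walk_root y.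
  have [s' ws' es] := walk_rev ws; exists (s' ++ t).
  split; first exact: walk_from_to_cat ws' wt.
  move=> e; rewrite /unzip1 map_cat mem_cat => /orP[|/st]; last exact: subsetP.
  by rewrite -/(unzip1 s') es => /ss; apply: (subsetP xF).
have ancT v : v \in T.1 -> anc rt v \subset T.2.
  move=> vT; have [s [ws ss]] := conn _ _ rT vT.
  by apply/subsetP => e /(walk_from_root_anc ws) /ss.
have cT : closed rt T.2.
  apply/closedP => e f eT; apply/subsetP: f; apply: ancT.
  have /andP[] := sub _ eT; have := joins_up_dn rt e.
  by case/orP=> /andP[/eqP-> /eqP->].
split=> //; rewrite [LHS]surjective_pairing; congr pair; apply/setP => v.
apply/idP/idP => [vT|]; first by rewrite mem_formed_by // ancT.
rewrite inE => /orP[/eqP->//|/exists_inP[e /sub /andP[]]].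
by rewrite /incident => ? ? /orP[] /eqP <-.
Qed.

Lemma formed_rooted F : closed rt F -> rooted_subtree (formed_by F).
Proof. by move=> cF; apply/rooted_subtreeP. Qed.

Lemma formed_byT : (formed_by [set: edge I]) = ([set: vert I], [set: edge I]).
Proof.
congr pair; apply/setP => v; rewrite mem_formed_by ?subsetT ?inE //.
by apply/closedP => e f; rewrite !inE.
Qed.

Lemma rooting_tree : is_tree I.
Proof.
have [] : rooted_subtree (formed_by [set: edge I]); last by rewrite formed_byT.
by apply: formed_rooted; apply/closedP => e f; rewrite !inE.
Qed.

Lemma formed_by_vertices F : closed rt F -> (formed_by F).1 = root I |: dn rt @: F.
Proof.
move=> cF; apply/setP => v; rewrite in_setU1.
case: (eqVneq v (root I)) => [->|nvr] /=; first by rewrite inE eqxx.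
have [e ->] := dn_onto rt nvr; rewrite mem_formed_dn //.
by rewrite (mem_imset _ _ (@dn_inj _ _ rt)).
Qed.

Lemma prize_formed F : closed rt F ->
  prize_of (formed_by F) = prize (root I) + wt rt F.
Proof.
move=> cF; rewrite /prize_of formed_by_vertices // big_setU1 /=; last first.
  by apply/imsetP => -[e _ E]; have := dn_neq_root rt e; rewrite -E eqxx.
by rewrite big_imset //= => e f _ _; apply: dn_inj.
Qed.

End RootedSubtrees.

(** * Contraction *)

Section Quotient.
Variables (R : realFieldType) (I : instance R) (rt : rooting I).
Variable X : {set edge I}.
Hypothesis cX : closed rt X.

Local Notation J := (contract (formed_by X)).

Implicit Types (S : {set edge I}) (T : subgraph J).

Let proj v : vert J := contract_proj (formed_by X) v.
Let qanc (v : vert J) : {set edge J} := [set e' | val e' \in anc rt (val v)].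

Lemma qproj_out v : (v \notin (formed_by X).1) || (v == root I) -> val (proj v) = v.
Proof. by move=> H; rewrite /proj /contract_proj val_insubd H. Qed.

Lemma qproj_in v : v \in (formed_by X).1 -> proj v = root J.
Proof.
move=> vX; apply: val_inj; rewrite /= /contract_proj val_insubd vX /=.
by case: eqP.
Qed.

Lemma qproj_dn (e' : edge J) : val (proj (dn rt (val e'))) = dn rt (val e').
Proof. by rewrite qproj_out // mem_formed_dn // (valP e'). Qed.

Lemma qanc_up (e' : edge J) :
  qanc (proj (up rt (val e'))) = [set f' | val f' \in anc rt (up rt (val e'))].
Proof.
set v := up rt _; case: (boolP (v \in (formed_by X).1)) => vX; last first.
  by rewrite /qanc qproj_out ?vX.
rewrite qproj_in //; apply/setP => f'; rewrite !inE [val (root J)]/= anc_root inE.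
apply/esym; apply: contraNF (valP f'); move: vX; rewrite (mem_formed_by _ cX).
by move/subsetP; apply.
Qed.

Lemma quotient_rooting_spec : exists qrt : rooting J,
  [/\ forall e', up qrt e' = proj (up rt (val e')),
      forall e', dn qrt e' = proj (dn rt (val e')) &
      forall v, anc qrt v = qanc v].
Proof.
unshelve refine (let q := @Rooting R J (fun e' => proj (up rt (val e')))
  (fun e' => proj (dn rt (val e'))) qanc _ _ _ _ _ _ in _).
- move=> e'; have := joins_up_dn rt (val e'); rewrite /joins /=.
  by case/orP=> /andP[/eqP-> /eqP->]; rewrite !eqxx ?orbT.
- move=> e' f' /(congr1 val); rewrite !qproj_dn => /(@dn_inj _ _ rt).
  exact: val_inj.
- move=> v nvr; have nvr' : val v != root I.
    by apply: contra nvr => /eqP E; apply/eqP/val_inj.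
  have [e ve] := dn_onto rt nvr'.
  have eX : e \notin X.
    rewrite -(mem_formed_dn _ cX) -ve.
    by have := valP v; rewrite (negPf nvr') orbF.
  exists (Sub e eX : edge J); apply: val_inj; rewrite qproj_out SubK ?ve //.
  by rewrite mem_formed_dn ?eX.
- by apply/setP => e'; rewrite !inE [val (root J)]/= anc_root inE.
- move=> e'; rewrite qanc_up; apply/setP => f'.
  by rewrite !inE qproj_dn anc_dn !inE (inj_eq val_inj).
- by move=> e'; rewrite qanc_up inE anc_up.
- by exists q.
Qed.

Definition lift S : {set edge J} := [set e' | val e' \in S].
Definition flat (S' : {set edge J}) : {set edge I} := [set val e' | e' in S'].

Lemma mem_flat (S' : {set edge J}) (e' : edge J) : (val e' \in flat S') = (e' \in S').
Proof. exact: mem_imset val_inj. Qed.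

Lemma flat_disjoint (S' : {set edge J}) : [disjoint flat S' & X].
Proof.
apply/pred0P => e /=; apply/negP => /andP[/imsetP[e' _ ->]].
by rewrite (negPf (valP e')).
Qed.

Lemma liftK S : [disjoint S & X] -> flat (lift S) = S.
Proof.
move=> dS; apply/setP => e; apply/imsetP/idP => [[e']|eS].
  by rewrite inE => ? ->.
have eX : e \notin X by rewrite (disjointFr dS).
by exists (Sub e eX : edge J); rewrite ?inE SubK.
Qed.

Lemma flatK (S' : {set edge J}) : lift (flat S') = S'.
Proof. by apply/setP => e'; rewrite inE mem_flat. Qed.

Lemma flat_mono (S1 S2 : {set edge J}) : (flat S1 \subset flat S2) = (S1 \subset S2).
Proof.
apply/idP/idP => [/subsetP H|]; last exact: imsetS.
by apply/subsetP => e' eS; rewrite -mem_flat H // mem_flat.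
Qed.

Lemma cost_flat (S' : {set edge J}) : cost_of (formed_by S') = ct (flat S').
Proof. by rewrite /cost_of /ct big_imset //= => e f _ _; apply: val_inj. Qed.

Lemma quotient_subtreeP T :
  rooted_subtree T <-> T = formed_by T.2 /\ closed rt (X :|: flat T.2).
Proof.
have [q [_ qd qa]] := quotient_rooting_spec.
have lq e' f' : (f' \in lineage q e') = (val f' \in lineage rt (val e')).
  by rewrite /lineage qd qa inE qproj_dn.
have cP : closed q T.2 <-> closed rt (X :|: flat T.2).
  split=> /closedP H; apply/closedP; [move=> e f | move=> e' f' eT].
    rewrite !inE => /orP[eX fe|/imsetP[e' eT ->] fe].
      by rewrite (closedP _ _ cX _ _ eX).
    case: (boolP (f \in X)) => //= fX; have := H e' (Sub f fX) eT.
    by rewrite lq -[_ \in T.2]mem_flat !SubK; apply.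
  rewrite lq => fe; have := H (val e') (val f').
  by rewrite !inE !mem_flat eT orbT (negPf (valP f')); apply.
by rewrite (rooted_subtreeP q); split=> -[-> /cP].
Qed.

Lemma prize_flat (S' : {set edge J}) : closed rt (X :|: flat S') ->
  prize_of (formed_by S' : subgraph J) = wt rt (flat S').
Proof.
have [q [_ qd _]] := quotient_rooting_spec => cS.
have : rooted_subtree (formed_by S' : subgraph J) by apply/quotient_subtreeP.
case/(rooted_subtreeP q) => _ cq; rewrite (prize_formed cq).
rewrite [prize (root J)]/= /contract_prize eqxx add0r /wt big_imset /=; last first.
  by move=> e f _ _; apply: val_inj.
apply: eq_bigr => e' _; rewrite /gain [prize _]/= /contract_prize.
by rewrite (negPf (dn_neq_root q e')) qd qproj_dn.
Qed.

Lemma quotient_total : total_prize J = wt rt (~: X).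
Proof.
have [q _] := quotient_rooting_spec.
have cT : closed rt (X :|: flat [set: edge J]).
  apply/closedP => e f _ _; rewrite inE; case: (boolP (f \in X)) => //= fX.
  by apply/imsetP; exists (Sub f fX : edge J).
have <- : flat [set: edge J] = ~: X.
  apply/setP => e; rewrite inE; apply/imsetP/idP => [[e' _ ->]|eX].
    exact: (valP e').
  by exists (Sub e eX : edge J).
by rewrite -prize_flat // (formed_byT q) /prize_of; apply: eq_bigl => v; rewrite inE.
Qed.

Lemma quotient_density (S' : {set edge J}) : closed rt (X :|: flat S') ->
  density (formed_by S' : subgraph J) =
  if S' == set0 then 0 else wt rt (flat S') / ct (flat S').
Proof. by move=> cS; rewrite /density prize_flat // cost_flat. Qed.

Lemma frontier_incident (e' : edge J) :
  incident e' (root J) <-> frontier rt X (val e').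
Proof.
have [q [qu _ qa]] := quotient_rooting_spec.
rewrite (incident_up_dn q) [root J == dn q e']eq_sym (negPf (dn_neq_root q e')) orbF.
have -> : frontier rt X (val e') = (anc rt (up rt (val e')) \subset X).
  rewrite /frontier (valP e') /= /lineage anc_dn setU1K //; exact: anc_up.
rewrite qu; split=> [/eqP E|H].
  apply/subsetP => f fe; apply: contraT => fX.
  have := qanc_up e'; rewrite -E => /setP/(_ (Sub f fX)).
  by rewrite !inE SubK fe [val (root J)]/= anc_root inE.
by rewrite qproj_in ?(mem_formed_by _ cX) ?eqxx.
Qed.

Lemma max_density_wt T S : max_density T -> T.2 != set0 ->
  [disjoint S & X] -> closed rt (X :|: S) -> wt rt S <= density T * ct S.
Proof.
move=> [rT maxT] T0 dS cS; have [ET cT] := (quotient_subtreeP T).1 rT.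
case: (eqVneq S set0) => [->|S0]; first by rewrite /wt /ct !big_set0 mulr0.
have [e eS] := set0Pn _ S0.
rewrite -ler_pdivrMr ?(ct_gt0 eS) // -{1 2}(liftK dS).
have c' : closed rt (X :|: flat (lift S)) by rewrite liftK.
have := maxT (formed_by (lift S)); rewrite quotient_density //.
rewrite ifF; first by apply; apply/quotient_subtreeP.
by apply: contraNF S0 => /eqP E; rewrite -(liftK dS) E /flat imset0.
Qed.

Lemma greedy_choice_max_density T (e' : edge J) : max_density T -> e' \in T.2 ->
  incident e' (root J) -> greedy_choice rt X (val e').
Proof.
move=> mT eT /frontier_incident fre; split=> // f frf.
have T0 : T.2 != set0 by apply/set0Pn; exists e'.
have [/quotient_subtreeP[ET cT] _] := mT.
set d := density T; set F := flat T.2.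
have eF : val e' \in F by rewrite mem_flat.
have dE : d = wt rt F / ct F by rewrite /d ET quotient_density // (negPf T0).
have wF : wt rt F = d * ct F by rewrite dE divfK // gt_eqF ?(ct_gt0 eF).
have d0 : 0 <= d by rewrite dE divr_ge0 ?wt_ge0 ?ct_ge0.
have dF : [disjoint F & X] by apply: flat_disjoint.
pose C := [set g in F | val e' \in lineage rt g].
have tC : topped rt (val e') C by apply: below_topped cT cX eF fre.
have sCF : C \subset F by apply/subsetP => g; rewrite inE => /andP[].
have leD : wt rt (F :\: C) <= d * ct (F :\: C).
  apply: (max_density_wt mT T0); first by apply: disjointWl dF; apply: subsetDl.
  apply/closedP => h h'; rewrite !inE => /orP[hX|/andP[hC hF]] hh'.
    by rewrite (closedP _ _ cX _ _ hX).
  have := closedP _ _ cT h h'; rewrite !inE hF orbT => /(_ isT hh') /orP[->//|h'F].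
  rewrite h'F andbT; apply/orP; right.
  by apply: contra hC => /= fh'; rewrite hF (lineage_trans hh').
have leC : d * ct C <= wt rt C.
  by move: wF; rewrite (wtID rt F C) (ctID F C) (setIidPr sCF); lra.
have dD : d <= topdens rt (val e').
  have [eC _ _] := toppedP _ _ _ tC.
  by rewrite -(ler_pM2r (ct_gt0 eC)) (le_trans leC) ?topdens_ub.
apply: le_trans dD; apply: topdens_le => // S tS.
have /frontierP[fX _] := frf.
apply: (max_density_wt mT T0); first exact: topped_disjoint fX tS.
exact: topped_closedU tS.
Qed.

Lemma total_frontier : total_prize J != 0 ->
  exists2 f, frontier rt X f & 0 < topdens rt f.
Proof.
rewrite quotient_total => tot.
case: (boolP [exists f, frontier rt X f && (0 < topdens rt f)]).
  by case/existsP => f /andP[]; exists f.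
rewrite negb_exists => /forallP H; case/eqP: tot; apply/le_anti.
rewrite wt_ge0 andbT.
have := @frontier_wt_le _ _ rt X (~: X) 0 cX; rewrite mul0r; apply.
- by rewrite setUCr; apply/closedP => e f; rewrite !inE.
- by rewrite disjoints_subset.
- by move=> f frf _; have := H f; rewrite frf -leNgt.
Qed.

Lemma greedy_choice_subtree e : total_prize J != 0 -> greedy_choice rt X e ->
  exists (T : subgraph J) (e' : edge J),
    [/\ min_max_subtree T, e' \in T.2, incident e' (root J) & e = val e'].
Proof.
move=> tot [fre maxe]; have /frontierP[eX _] := fre.
have De : 0 < topdens rt e.
  by have [f frf Df] := total_frontier tot; apply: lt_le_trans Df (maxe _ frf).
have [S [tS dS minS]] := min_densest_exists rt e.
have [eS S1 S2] := toppedP _ _ _ tS.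
have dSX : [disjoint S & X] by apply: topped_disjoint eX tS.
have cS : closed rt (X :|: flat (lift S)).
  by rewrite liftK //; apply: topped_closedU tS.
have S0 : (lift S == set0) = false.
  apply/negP => /eqP E; have := imset0 (val : edge J -> edge I).
  by rewrite -E -/(flat _) liftK // => S0; rewrite S0 inE in eS.
have dT : density (formed_by (lift S) : subgraph J) = topdens rt e.
  by rewrite quotient_density // S0 liftK // dS mulfK // gt_eqF ?(ct_gt0 eS).
have maxT : max_density (formed_by (lift S) : subgraph J).
  split; first exact/quotient_subtreeP.
  move=> T' /quotient_subtreeP[-> cT']; rewrite dT quotient_density //.
  case: eqP => [_|/eqP /set0Pn[g gT]]; first exact: ltW.
  rewrite ler_pdivrMr ?(@ct_gt0 _ _ _ (val g)) ?mem_flat //.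
  apply: (frontier_wt_le cX cT') => [|f frf _]; first exact: flat_disjoint.
  exact: maxe.
exists (formed_by (lift S)), (Sub e eX : edge J); split; last by rewrite SubK.
- split=> // T' [rT' maxT'] _ sT'.
  have [ET' cT'] := (quotient_subtreeP T').1 rT'.
  have dT' : density T' = topdens rt e.
    apply/le_anti; rewrite -{2}dT maxT' ?andbT; last exact: maxT.1.
    by rewrite -dT; apply: maxT.2.
  have [S'0 T'E] : T'.2 != set0 /\ wt rt (flat T'.2) = topdens rt e * ct (flat T'.2).
    move: dT'; rewrite {1}ET' quotient_density //; case: eqP => [_ E|/eqP T'0 <-].
      by move: De; rewrite -E ltxx.
    split=> //; have /set0Pn[g gT'] := T'0.
    by rewrite divfK // gt_eqF // (@ct_gt0 _ _ _ (val g)) ?mem_flat.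
  have sS : flat T'.2 \subset S by rewrite -(liftK dSX) flat_mono.
  have eT' : e \in flat T'.2.
    have /set0Pn[g gT'] := S'0; have gS : val g \in S by apply: (subsetP sS); rewrite mem_flat.
    have := closedP _ _ cT' (val g) e; rewrite !inE mem_flat gT' orbT (negPf eX).
    by apply=> //; apply: S1.
  have tT' : topped rt e (flat T'.2).
    apply/toppedP; split=> // [g /(subsetP sS)/S1 //|g h gT hg eh].
    have := closedP _ _ cT' g h; rewrite !inE gT orbT => /(_ isT hg) /orP[|//].
    by move=> /(closedP _ _ cX)/(_ eh); rewrite (negPf eX).
  have ES : flat T'.2 = S by apply/eqP; rewrite eqEcard sS minS.
  by rewrite ET' -(flatK T'.2) ES.
- by rewrite inE SubK.
- by apply/frontier_incident; rewrite SubK.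
Qed.

End Quotient.

(** * Competitiveness of the greedy output *)

Section GreedyRuns.
Variables (R : realFieldType) (I : instance R) (rt : rooting I).
Implicit Types (e : edge I) (v : vert I) (pi : seq (edge I)) (T : subgraph I).

Lemma greedy_stepP pi e : closed rt [set f in pi] ->
  greedy_step pi e <->
  total_prize (greedy_quotient pi) != 0 /\ greedy_choice rt [set f in pi] e.
Proof.
move=> cpi; split=> [] [tot].
  move=> [T [e' [[mT _] eT inc ->]]]; split=> //.
  exact: greedy_choice_max_density mT eT inc.
by move=> ch; split=> //; apply: greedy_choice_subtree ch.
Qed.

Lemma greedy_reachable_run pi e0 : greedy_reachable pi ->
  forall k, (k < size pi)%N -> greedy_choice rt [set e in take k pi] (nth e0 pi k).
Proof.
elim=> [//|{}pi e _ IH st] k; rewrite size_rcons ltnS leq_eqVlt => /orP[/eqP->|lt].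
  rewrite nth_rcons ltnn eqxx -cats1 take_size_cat //.
  have cpi : closed rt [set f in pi].
    by have := run_closed IH (size pi); rewrite take_size.
  by case/(greedy_stepP _ cpi): st.
by rewrite nth_rcons lt -cats1 takel_cat; [apply: IH | apply: ltnW].
Qed.

Lemma greedy_reachable_closed pi : greedy_reachable pi ->
  forall k, closed rt [set e in take k pi].
Proof.
case: pi => [|e0 pi] rpi k; last exact: run_closed (greedy_reachable_run e0 rpi) k.
by apply/closedP => e f; rewrite inE.
Qed.

Lemma greedy_reachable_closed_set pi : greedy_reachable pi -> closed rt [set e in pi].
Proof.
by move=> rpi; have := greedy_reachable_closed rpi (size pi); rewrite take_size.
Qed.

Lemma greedy_reachable_uniq pi : greedy_reachable pi -> uniq pi.
Proof.
elim=> [//|{}pi e rpi IH st]; rewrite rcons_uniq IH andbT.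
have [_ [/frontierP[]]] := (greedy_stepP e (greedy_reachable_closed_set rpi)).1 st.
by rewrite inE.
Qed.

Lemma greedy_output_exists : exists pi : seq (edge I), greedy_output pi.
Proof.
suff H n : forall pi, greedy_reachable pi -> (#|~: [set e in pi]| < n)%N ->
    exists pi', @greedy_output _ I pi'.
  exact: H _ _ (greedy_start I) (ltnSn _).
elim: n => // n IH pi rpi ltn.
case: (eqVneq (total_prize (greedy_quotient pi)) 0) => [tot|tot]; first by exists pi.
have cpi := greedy_reachable_closed_set rpi.
have [f frf _] := total_frontier cpi tot.
have [e fre maxe] := Order.TotalTheory.arg_maxP (topdens rt) frf.
have st : greedy_step pi e by apply/(greedy_stepP _ cpi); split=> //; split=> // g /maxe.
apply: IH (greedy_next rpi st) _.
apply: leq_trans (_ : #|~: [set e in pi]| <= n)%N; last by rewrite -ltnS.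
have /frontierP[epi _] := fre.
apply/proper_card/properP; split.
  by apply/subsetP => g; rewrite !inE mem_rcons inE negb_or => /andP[].
by exists e; rewrite !inE ?mem_rcons ?inE ?eqxx //; rewrite inE in epi.
Qed.

Lemma greedy_output_incremental pi : greedy_output pi -> incremental_solution pi.
Proof.
case=> rpi tot; split.
- exact: greedy_reachable_uniq.
- by move=> j _; apply: (formed_rooted (rt := rt)); apply: greedy_reachable_closed.
have cpi := greedy_reachable_closed_set rpi.
move=> v v0; case: (eqVneq v (root I)) => [->|/(dn_onto rt)[e ve]]; first by rewrite inE eqxx.
rewrite ve mem_formed_dn //; apply: contraTT v0 => epi; rewrite ve -leNgt.
rewrite (quotient_total cpi) in tot; rewrite -tot /wt (bigD1 e) ?inE //=; last first.
  by rewrite inE in epi.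
by rewrite lerDl sumr_ge0 // => f _; apply: prize_ge0.
Qed.

Lemma ct_seq pi : uniq pi -> ct [set e in pi] = \sum_(e <- pi) cost e.
Proof.
by move=> upi; rewrite /ct (big_uniq _ upi) /=; apply: eq_bigl => e; rewrite inE.
Qed.

Lemma path_cost_ge v s : is_path (root I) v s ->
  ct (anc rt v) <= \sum_(st <- s) cost st.1.
Proof.
case/andP=> ws us; have := path_uniq_edges (andP ws).1 us => ue.
rewrite -(big_map fst xpredT (fun e => cost e)) -/(unzip1 s) -ct_seq //.
by apply: ctS; apply/subsetP => e /(walk_from_root_anc ws); rewrite inE.
Qed.

Lemma dist_anc v : is_dist v (ct (anc rt v)).
Proof.
split; last by move=> s; apply: path_cost_ge.
have [s /andP[ws /eqP ls] ss] := walk_root rt v.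
have [t [wt lt ut st]] := walk_simple ws.
have pt : is_path (root I) v t.
  by rewrite /is_path ut andbT /walk_from_to wt lt ls eqxx.
exists t; split=> //; apply/le_anti; rewrite path_cost_ge // andbT.
rewrite -(big_map fst xpredT (fun e => cost e)) -/(unzip1 t).
rewrite -ct_seq ?(path_uniq_edges wt ut) //.
by apply: ctS; apply/subsetP => e; rewrite inE => /st/ss.
Qed.

Lemma lineage_cost_le chi e : is_eccentricity I chi -> ct (lineage rt e) <= chi.
Proof.
case=> _ /(_ (dn rt e))[l [[[s [ps <-]] _] le]]; apply: le_trans le.
exact: path_cost_ge.
Qed.

Lemma alg_prefix pi B : uniq pi -> exists k,
  alg pi B = formed_by [set e in take k pi] /\
  (k = size pi \/ (k < size pi)%N /\ B < \sum_(f <- take k.+1 pi) cost f).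
Proof.
move=> upi; pose c k := \sum_(f <- take k pi) cost f.
have c_mono i j : (i <= j)%N -> c i <= c j.
  move=> ij; rewrite /c -(cat_take_drop i (take j pi)) take_takel // big_cat lerDl.
  by apply: sumr_ge0 => e _; rewrite ltW ?cost_gt0.
have algE k : (forall i, (i < size pi)%N -> (c i.+1 <= B) = (i < k)%N) ->
    alg pi B = formed_by [set e in take k pi].
  move=> H; rewrite /alg; congr formed_by; apply/setP => e; rewrite !inE.
  case: (boolP (e \in pi)) => epi; last first.
    by apply/esym; apply: contraNF epi; apply: mem_take.
  by rewrite /= in_take // -H ?index_mem.
case: (boolP [exists k : 'I_(size pi), B < c k.+1]) => [/existsP[k0 Bk0]|].
  have ex : exists k, (k < size pi)%N && (B < c k.+1) by exists k0; rewrite ltn_ord.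
  case: (ex_minnP ex) => k /andP[ksz Bk] mink; exists k; split; last by right.
  apply: algE => i isz; case: (ltnP i k) => ik.
    by rewrite leNgt; apply/negP => Bi; have := mink i; rewrite isz Bi leqNgt ik; case/(_ isT)/negP.
  by apply: lt_geF; apply: lt_le_trans Bk _; apply: c_mono.
rewrite negb_exists => /forallP H; exists (size pi); split; last by left.
by apply: algE => i isz; rewrite isz leNgt; apply: H (Ordinal isz).
Qed.

Lemma greedy_output_dominates pi chi B T : greedy_output pi -> is_eccentricity I chi ->
  rooted_subtree T -> cost_of T <= B -> prize_of T <= prize_of (alg pi (B + chi)).
Proof.
move=> [rpi tot] ecc /(rooted_subtreeP rt)[-> cT] leB.
have upi := greedy_reachable_uniq rpi.
have [k [-> kP]] := alg_prefix (B + chi) upi.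
have ck := greedy_reachable_closed rpi k.
rewrite !(prize_formed cT) (prize_formed ck) lerD2l.
case: kP => [->|[ksz Bk]].
  rewrite take_size (wtID rt T.2 [set e in pi]).
  rewrite -[leRHS]addr0 lerD ?wtS ?subsetIr //.
  rewrite (quotient_total (greedy_reachable_closed_set rpi)) in tot.
  by rewrite -tot wtS // setDE subsetIr.
case: pi => [//|e0 pi] in rpi tot upi ck ksz Bk *.
have run := greedy_reachable_run e0 rpi.
apply: (run_dominates run) => //; apply: le_trans leB _.
have := lineage_cost_le (nth e0 (e0 :: pi) k) ecc.
set P := lineage rt _; set Y := [set e in take k (e0 :: pi)] => leP.
rewrite -ct_seq ?take_uniq // (run_setS e0 ksz) (ctID _ P) -/Y in Bk.
have leI : ct ((nth e0 (e0 :: pi) k |: Y) :&: P) <= ct P by apply: ctS; apply: subsetIr.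
have DE : (nth e0 (e0 :: pi) k |: Y) :\: P = Y :\: P.
  apply/setP => e; rewrite !in_setD in_setU1; case: eqP => //= ->.
  by rewrite mem_lineage.
by rewrite DE in Bk; lra.
Qed.

End GreedyRuns.

Section LowerBound.
Variables (R : realFieldType) (chi alpha : R).
Hypotheses (chi0 : 0 < chi) (alpha0 : 0 <= alpha) (alpha_chi : alpha < chi).

(* The expensive branch has density 2 and is taken first; the cheap one, of
   density 1, is all that a small budget can reach. *)
Let eps : R := (chi - alpha) / 2.

Lemma eps_gt0 : 0 < eps. Proof. by rewrite divr_gt0 ?subr_gt0. Qed.

Let bcost (b : bool) : R := if b then chi else eps.
Let bprize (v : option bool) : R :=
  if v is Some b then (if b then 2 * chi else eps) else 0.

Lemma bcost_gt0 b : 0 < bcost b.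
Proof. by case: b => //=; apply: eps_gt0. Qed.

Lemma bprize_ge0 v : 0 <= bprize v.
Proof. by case: v => [[]|] //=; [rewrite mulr_ge0 // ltW | apply/ltW/eps_gt0]. Qed.

Definition two_leaves : instance R :=
  @Instance R (option bool) bool (fun=> None) (fun b => Some b) bcost bprize None
    bcost_gt0 bprize_ge0.

Lemma two_leaves_rooting_spec : exists rt : rooting two_leaves,
  (forall b, dn rt b = Some b) /\ forall b, anc rt (Some b) = [set b].
Proof.
unshelve refine (let q := @Rooting R two_leaves (fun=> None) (fun b => Some b)
  (fun v => if v is Some b then [set b] else set0) _ _ _ _ _ _ in _).
- by move=> e; rewrite /joins /= !eqxx.
- by move=> b b' [].
- by case=> [b|] // _; exists b.
- by [].
- by move=> b; rewrite setU0.
- by move=> b; rewrite inE.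
- by exists q.
Qed.

Lemma two_leaves_bad : exists I : instance R,
  [/\ is_tree I, is_eccentricity I chi &
      forall mu : R, 1 <= mu -> forall pi : seq (edge I), greedy_output pi ->
      exists (B : R) (T : subgraph I),
        [/\ 0 <= B, is_opt B T & mu * prize_of (alg pi (B + alpha)) < prize_of T]].
Proof.
have [rt [dnE ancE]] := two_leaves_rooting_spec; have e0 := eps_gt0.
have ctE (b : edge two_leaves) : ct [set b] = bcost b by rewrite /ct big_set1.
have wtE b : wt rt [set b] = bprize (Some b) by rewrite /wt big_set1 /gain dnE.
have cl (S : {set edge two_leaves}) : closed rt S.
  by apply/closedP => e f eS; rewrite /lineage dnE ancE inE => /eqP->.
have ltchi : eps < chi.
  by rewrite ltr_pdivrMr //; have := chi0; have := alpha0; lra.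
exists two_leaves; split; first exact: rooting_tree rt.
  split; first by exists (Some true); have := dist_anc rt (Some true); rewrite ancE ctE.
  move=> v; exists (ct (anc rt v)); split; first exact: dist_anc.
  case: v => [b|]; first by rewrite ancE ctE; case: b => //=; apply: ltW.
  by rewrite (anc_root rt) /ct big_set0 ltW.
move=> mu mu1 pi opi; have [rpi tot] := opi.
have fr b : frontier rt set0 b.
  apply/frontierP; split; first by rewrite inE.
  by move=> f; rewrite /lineage dnE ancE inE => ->.
have D2 : 2 <= topdens rt true.
  have := topdens_ub (topped1 rt true); rewrite wtE ctE /= => le2.
  by rewrite -(ler_pM2r chi0).
have D1 : topdens rt false <= 1.
  apply: topdens_le => // S /toppedP[fS S1 _]; have -> : S = [set false].
    apply/setP => b; rewrite inE; apply/idP/eqP => [/S1|->//].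
    by rewrite /lineage dnE ancE inE => /eqP.
  by rewrite wtE ctE mul1r.
have [pi' pE] : exists pi', pi = true :: pi'.
  case: pi => [|b pi'] in opi rpi tot *.
    have c0 := greedy_reachable_closed_set rt rpi.
    rewrite (quotient_total c0) in tot; have := wt_ge0 rt [set false].
    have := @wtS _ _ rt [set true] (~: [set e in [::]]).
    rewrite tot wtE /= => H _; suff : 2 * chi <= 0 by rewrite leNgt mulr_gt0.
    by apply: H; apply/subsetP => b; rewrite !inE.
  exists pi'; have [_] := greedy_reachable_run rt true rpi (k := 0) isT.
  rewrite /= => /(_ true); case: b {opi rpi tot} => // H; exfalso.
  have := H _; rewrite (_ : [set e in [::]] = set0); last by apply/setP => b; rewrite !inE.
  by move=> /(_ (fr true)) le21; lra.
exists eps, (formed_by ([set false] : {set edge two_leaves})); split; first exact: ltW.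
  split; first exact: (formed_rooted (cl _)).
    by rewrite /cost_of big_set1.
  move=> T' /(rooted_subtreeP rt)[-> _]; rewrite /cost_of /= -/(ct _) => leT.
  rewrite !(prize_formed (cl _)) lerD2l; apply: wtS; apply/subsetP => -[] bT; last by rewrite inE.
  have : ct ([set true] : {set edge two_leaves}) <= ct T'.2 by apply: ctS; rewrite sub1set.
  by rewrite ctE /= => le; have := lt_le_trans ltchi (le_trans le leT); rewrite ltxx.
have -> : alg pi (eps + alpha) = formed_by (set0 : {set edge two_leaves}).
  rewrite /alg; congr formed_by; apply/setP => b; rewrite !inE; apply/negbTE.
  rewrite negb_and -ltNge pE /=; apply/orP; right.
  rewrite big_cons; apply: lt_le_trans (_ : chi <= _).
    by rewrite /eps -ltrBrDr ltr_pdivrMr //; have := alpha_chi; lra.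
  by rewrite lerDl sumr_ge0 // => f _; rewrite ltW ?bcost_gt0.
by rewrite !(prize_formed (cl _)) wtE /wt big_set0 /= !add0r mulr0.
Qed.

End LowerBound.

(** * Merging groups of edges *)

Section Merging.
Variables (R : realFieldType) (I : instance R) (rt : rooting I).
Implicit Types (e f g h u v : edge I) (M S Q : {set edge I}) (x : vert I).

Let L := lineage rt.
Let D := topdens rt.

(* [u] is the last edge on the path to [x] that is not merged into the one
   above it, so [x] belongs to the group of [u]. *)
Definition leader M x u : bool :=
  [&& u \in anc rt x, u \notin M &
      [forall h in anc rt x, (u \in L h) ==> (h == u) || (h \in M)]].

Lemma leaderP M x u : reflect
  [/\ u \in anc rt x, u \notin M &
      forall h, h \in anc rt x -> u \in L h -> h = u \/ h \in M]
  (leader M x u).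
Proof.
apply: (iffP and3P) => -[ux uM H]; split=> //.
  move=> h hx uh; have /orP[/eqP|] := implyP (forall_inP H h hx) uh; by [left | right].
apply/forall_inP => h hx; apply/implyP => uh.
by have [->|->] := H h hx uh; rewrite ?eqxx ?orbT.
Qed.

Lemma leader_inj M x u v : leader M x u -> leader M x v -> u = v.
Proof.
move=> /leaderP[ux uM Hu] /leaderP[vx vM Hv].
have /orP[uv|vu] := anc_total ux vx.
  by have [//|] := Hu v vx uv; rewrite (negPf vM).
by have [//|] := Hv u ux vu; rewrite (negPf uM).
Qed.

Lemma leader_exists M x : (exists u, leader M x u) \/ anc rt x \subset M.
Proof.
case: (boolP (anc rt x \subset M)) => [|/subsetPn[u0 ux0 uM0]]; [by right | left].
pose P u := (u \in anc rt x) && (u \notin M).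
have P0 : P u0 by rewrite /P ux0.
case: (arg_maxnP (fun u => #|L u|) P0) => u /andP[ux uM] umax.
exists u; apply/leaderP; split=> // h hx uh.
case: (eqVneq h u) => [|nhu]; [by left | right].
apply: contraT => hM.
have le : (#|L h| <= #|L u|)%N by apply: umax; rewrite /P hx hM.
by have := lineage_card uh; rewrite eq_sym nhu ltnNge le => /(_ isT).
Qed.

Lemma leader_notin M x u : leader M x u -> ~ anc rt x \subset M.
Proof. by move=> /leaderP[ux uM _] /subsetP/(_ u ux); rewrite (negPf uM). Qed.

Lemma leader_self M v : v \notin M -> leader M (dn rt v) v.
Proof.
move=> vM; apply/leaderP; split=> //; first exact: mem_lineage.
by move=> h hv vh; left; apply: lineage_anti vh hv.
Qed.

Lemma mem_lineage_up h v : h \in L v -> h = v \/ h \in anc rt (up rt v).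
Proof. by rewrite /L /lineage anc_dn in_setU1 => /orP[/eqP|]; [left | right]. Qed.

Lemma lineage_up v : anc rt (up rt v) \subset L v.
Proof. by rewrite /L /lineage anc_dn subsetUr. Qed.

Lemma leader_merge M x v u : v \notin M -> leader M x v -> leader M (up rt v) u ->
  leader (v |: M) x u.
Proof.
move=> vM /leaderP[vx _ Hv] /leaderP[uv uM Hu].
have sx := subsetP (anc_lineage vx); apply/leaderP; split.
- exact/sx/(subsetP (lineage_up v)).
- rewrite !inE negb_or uM andbT; apply: contraTneq uv => ->; exact: anc_up.
move=> h hx uh; rewrite in_setU1; have /orP[hv|vh] := anc_total hx vx.
  case: (mem_lineage_up hv) => [->|/Hu/(_ uh)[->|->]]; first by rewrite eqxx; right.
    by left.
  by right; rewrite orbT.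
by have [->|->] := Hv h hx vh; right; rewrite ?eqxx ?orbT.
Qed.

Lemma leader_merge_root M x v : leader M x v -> anc rt (up rt v) \subset M ->
  anc rt x \subset v |: M.
Proof.
move=> /leaderP[vx _ Hv] /subsetP uM; apply/subsetP => h hx; rewrite in_setU1.
have /orP[hv|vh] := anc_total hx vx.
  by case: (mem_lineage_up hv) => [->|/uM->]; rewrite ?eqxx ?orbT.
by have [->|->] := Hv h hx vh; rewrite ?eqxx ?orbT.
Qed.

Lemma leader_other M x v u : u != v -> leader M x u -> leader (v |: M) x u.
Proof.
move=> nuv /leaderP[ux uM Hu]; apply/leaderP; split=> //.
  by rewrite in_setU1 negb_or nuv.
by move=> h hx /(Hu h hx)[->|hM]; [left | right; rewrite in_setU1 hM orbT].
Qed.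

Definition group M u : {set edge I} := [set e | leader M (dn rt e) u].

Lemma mem_group M u : u \notin M -> u \in group M u.
Proof. by move=> uM; rewrite inE leader_self. Qed.

Lemma group_disjoint M u v : u != v -> [disjoint group M u & group M v].
Proof.
move=> nuv; apply/pred0P => e /=; rewrite !inE.
by apply: contraNF nuv => /andP[lu lv]; rewrite (leader_inj lu lv).
Qed.

Lemma group_merge M u v : v \notin M -> leader M (up rt v) u ->
  group (v |: M) u = group M u :|: group M v.
Proof.
move=> vM lu; have /leaderP[uv _ _] := lu.
have nuv : u != v by apply: contraTneq uv => ->; apply: anc_up.
apply/setP => e; rewrite !inE; apply/idP/orP => [l'|[l'|l']]; first last.
- exact: leader_merge l' lu.
- exact: leader_other l'.
case: (leader_exists M (dn rt e)) => [[w lw]|sM].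
  case: (eqVneq w v) => [<-|nwv]; first by right.
  by left; rewrite (leader_inj l' (leader_other nwv lw)).
by case: (leader_notin l'); apply: subset_trans sM (subsetUr _ _).
Qed.

Lemma group_other M u v : v \notin M -> u != v -> ~~ leader M (up rt v) u ->
  group (v |: M) u = group M u.
Proof.
move=> vM nuv nl; apply/setP => e; rewrite !inE.
apply/idP/idP => [l'|]; last exact: leader_other.
case: (leader_exists M (dn rt e)) => [[w lw]|sM]; last first.
  by case: (leader_notin l'); apply: subset_trans sM (subsetUr _ _).
case: (eqVneq w v) => [E|nwv]; last by rewrite (leader_inj l' (leader_other nwv lw)).
rewrite {w}E in lw; case: (leader_exists M (up rt v)) => [[w lw']|sM].
  by case/negP: nl; rewrite (leader_inj l' (leader_merge vM lw lw')).
by case: (leader_notin l'); apply: leader_merge_root lw sM.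
Qed.

Lemma group_capE M e S u : e \notin M -> topped rt e S -> forall g, g \in S ->
  leader M (dn rt g) u -> topped rt u [set h in S | leader M (dn rt h) u].
Proof.
move=> eM /toppedP[eS S1 S2] g gS lg; have /leaderP[ug uM Hg] := lg.
have eu : e \in L u.
  have /orP[//|ue] := anc_total (S1 _ gS) ug.
  have [->|] := Hg e (S1 _ gS) ue; first exact: mem_lineage.
  by rewrite (negPf eM).
apply/toppedP; split.
- by rewrite inE (S2 _ _ gS ug eu) leader_self.
- by move=> h; rewrite inE => /andP[_ /leaderP[]].
- move=> h k; rewrite !inE => /andP[hS /leaderP[uh _ Hh]] kh uk.
  rewrite (S2 _ _ hS kh (lineage_trans uk eu)) /=; apply/leaderP; split=> // l lk ul.
  by apply: Hh => //; apply: lineage_trans lk.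
Qed.

Lemma wt_le_groups M e S l : e \notin M -> topped rt e S ->
  (forall u Q, u \notin M -> topped rt u Q -> Q \subset group M u -> wt rt Q <= l * ct Q) ->
  wt rt S <= l * ct S.
Proof.
move=> eM tS H; have [eS S1 _] := toppedP _ _ _ tS.
pose top g := odflt e [pick u | leader M (dn rt g) u].
have topE g : g \in S -> leader M (dn rt g) (top g).
  move=> gS; rewrite /top; case: pickP => //= none.
  case: (leader_exists M (dn rt g)) => [[u lu]|/subsetP/(_ e (S1 _ gS))].
    by have := none u; rewrite lu.
  by rewrite (negPf eM).
rewrite /wt /ct (partition_big top predT) //= [X in _ * X](partition_big top predT) //=.
rewrite mulr_sumr; apply: ler_sum => u _.
have E : [set h in S | leader M (dn rt h) u] = [set h in S | top h == u].
  apply/setP => h; rewrite !inE; case: (boolP (h \in S)) => //= hS.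
  apply/idP/eqP => [lu|<-]; last exact: topE.
  exact: leader_inj (topE _ hS) lu.
have sumE F : \sum_(h in S | top h == u) F h = \sum_(h in [set h in S | leader M (dn rt h) u]) F h :> R.
  by rewrite E; apply: eq_bigl => h; rewrite inE.
rewrite !sumE -/(ct _) -/(wt rt _).
case: (set_0Vmem [set h in S | leader M (dn rt h) u]) => [->|[g]].
  by rewrite /wt /ct !big_set0 mulr0.
rewrite inE => /andP[gS lg]; apply: (H u).
- by case/leaderP: lg.
- exact: group_capE eM tS g gS lg.
- by apply/subsetP => h; rewrite !inE => /andP[].
Qed.

(* [l] is the density of the group that was merged last. *)
Definition merge_inv M l : Prop :=
  (forall u, u \notin M -> wt rt (group M u) <= l * ct (group M u)) /\
  (forall u Q, u \notin M -> topped rt u Q -> Q \subset group M u ->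
     l * ct (group M u :\: Q) <= wt rt (group M u :\: Q)).

Lemma group0 u : group set0 u = [set u].
Proof.
apply/setP => e; rewrite !inE; apply/idP/eqP => [/leaderP[ue _ H]|->].
  by have [//|] := H e (mem_lineage rt e) ue; rewrite inE.
by apply: leader_self; rewrite inE.
Qed.

Lemma merge_inv0 : exists l, merge_inv set0 l.
Proof.
exists (\sum_e gain rt e / cost e); split=> [u _|u Q _ /toppedP[uQ _ _] _].
  rewrite group0 /wt /ct !big_set1 -ler_pdivrMr ?cost_gt0 // (bigD1 u) //= lerDl.
  by apply: sumr_ge0 => e _; rewrite divr_ge0 ?prize_ge0 ?ltW ?cost_gt0.
rewrite group0; have -> : [set u] :\: Q = set0 by apply/eqP; rewrite setD_eq0 sub1set.
by rewrite /wt /ct !big_set0 mulr0.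
Qed.

Definition densest_group M v : Prop := v \notin M /\ forall u, u \notin M ->
  wt rt (group M u) * ct (group M v) <= wt rt (group M v) * ct (group M u).

Lemma merge_step M l v : merge_inv M l -> densest_group M v ->
  (exists l', merge_inv (v |: M) l') /\ forall e, e \notin M -> D e <= D v.
Proof.
move=> [H1 H2] [vM vmax]; set l' := wt rt (group M v) / ct (group M v).
have ctv : 0 < ct (group M v) by apply: ct_gt0 (mem_group vM).
have wtv : wt rt (group M v) = l' * ct (group M v) by rewrite divfK ?gt_eqF.
have l'l : l' <= l by rewrite ler_pdivrMr // H1.
have l'0 : 0 <= l' by rewrite divr_ge0 ?wt_ge0 ?ct_ge0.
have H1' u : u \notin M -> wt rt (group M u) <= l' * ct (group M u).
  by move=> uM; rewrite mulrAC ler_pdivlMr // vmax.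
have H2' u Q : u \notin M -> topped rt u Q -> Q \subset group M u ->
    l' * ct (group M u :\: Q) <= wt rt (group M u :\: Q).
  by move=> uM tQ sQ; apply: le_trans (H2 u Q uM tQ sQ); rewrite ler_wpM2r ?ct_ge0.
have H3 u Q : u \notin M -> topped rt u Q -> Q \subset group M u -> wt rt Q <= l' * ct Q.
  move=> uM tQ sQ; have := H2' u Q uM tQ sQ; have := H1' u uM.
  by rewrite (wtID rt (group M u) Q) (ctID (group M u) Q) (setIidPr sQ); lra.
have vtop : topped rt v (group M v).
  have -> : group M v = [set h in [set: edge I] | leader M (dn rt h) v].
    by apply/setP => h; rewrite !inE.
  apply/toppedP; split.
  - by rewrite !inE leader_self.
  - by move=> h; rewrite !inE => /leaderP[].
  - move=> h k; rewrite !inE => /leaderP[vh _ Hh] kh vk.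
    apply/leaderP; split=> // j jk vj; apply: Hh => //; exact: lineage_trans jk.
have Dv : l' <= D v by rewrite -(ler_pM2r ctv) -wtv topdens_ub.
split; last first.
  move=> e eM; apply: le_trans Dv; apply: topdens_le => // S tS.
  exact: wt_le_groups eM tS H3.
exists l'; split=> [u|u Q]; rewrite in_setU1 negb_or => /andP[nuv uM].
  case: (boolP (leader M (up rt v) u)) => lu; last by rewrite group_other ?H1'.
  by rewrite group_merge // wtU ?ctU ?group_disjoint // wtv mulrDr lerD2r H1'.
move=> tQ; case: (boolP (leader M (up rt v) u)) => lu; last first.
  by rewrite group_other // => sQ; apply: H2'.
rewrite group_merge // => sQ; have [uQ Q1 Q2] := toppedP _ _ _ tQ.
have dg : [disjoint group M u & group M v] by apply: group_disjoint.
have -> : (group M u :|: group M v) :\: Q =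
    (group M u :\: (Q :&: group M u)) :|: (group M v :\: (Q :&: group M v)).
  apply/setP => h; rewrite !(in_setU, in_setD, in_setI).
  by case: (h \in Q); case: (h \in group M u); case: (h \in group M v).
have dd : [disjoint group M u :\: (Q :&: group M u) & group M v :\: (Q :&: group M v)].
  by apply: disjointWl (subsetDl _ _) _; apply: disjointWr (subsetDl _ _) dg.
rewrite wtU // ctU // mulrDr lerD //.
  apply: H2' => //; last exact: subsetIr.
  apply/toppedP; split; first by rewrite in_setI uQ mem_group.
    by move=> h; rewrite in_setI => /andP[/Q1].
  move=> h k; rewrite !in_setI !inE => /andP[hQ /leaderP[uh _ Hh]] kh uk.
  rewrite (Q2 _ _ hQ kh uk) /=; apply/leaderP; split=> // j jk uj.
  by apply: Hh => //; apply: lineage_trans jk.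
case: (set_0Vmem (Q :&: group M v)) => [->|[h]]; first by rewrite setD0 wtv.
have /leaderP[uup _ _] := lu; have uv : u \in L v by apply: (subsetP (lineage_up v)).
rewrite in_setI inE => /andP[hQ lh]; have /leaderP[vh _ _] := lh.
have vQ : v \in Q by apply: Q2 hQ vh uv.
apply: H2' => //; last exact: subsetIr.
apply/toppedP; split; first by rewrite in_setI vQ mem_group.
  by move=> k; rewrite in_setI inE => /andP[_ /leaderP[]].
move=> j k; rewrite !in_setI !inE => /andP[jQ /leaderP[vj _ Hj]] kj vk.
rewrite (Q2 _ _ jQ kj (lineage_trans vk uv)) /=; apply/leaderP; split=> // i ik vi.
by apply: Hj => //; apply: lineage_trans ik.
Qed.

End Merging.

Local Open Scope nat_scope.

(** * Array programs and their running time *)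

Lemma bitsize_ltn n : n < 2 ^ bitsize n.
Proof. exact: trunc_log_ltn. Qed.

Lemma bitsize_le n k : 0 < k -> n < 2 ^ k -> bitsize n <= k.
Proof.
case: n => [|n] k0 lt; first by rewrite /bitsize trunc_log0.
rewrite /bitsize -(ltn_exp2l _ _ (erefl (1 < 2))).
by apply: leq_ltn_trans lt; apply: trunc_logP.
Qed.

Lemma bitsize_mono m n : m <= n -> bitsize m <= bitsize n.
Proof. by move=> le; rewrite ltnS leq_trunc_log. Qed.

Lemma bitsizeM m n : bitsize (m * n) <= bitsize m + bitsize n.
Proof.
apply: bitsize_le => //; rewrite expnD.
by apply: ltn_mul; apply: bitsize_ltn.
Qed.

Lemma bitsizeD m n : bitsize (m + n) <= bitsize m + bitsize n.
Proof.
apply: bitsize_le => //; rewrite expnD.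
have := bitsize_ltn m; have := bitsize_ltn n.
have := ltn_expl (bitsize m).-1 (erefl (1 < 2)); rewrite /bitsize /= !expnS.
by set x := 2 ^ _; set y := 2 ^ _; nia.
Qed.

Fixpoint eval_bits (a : expr) : nat :=
  match a with
  | Const n => bitsize n
  | Read _ => 1
  | Add a b | Mul a b => eval_bits a + eval_bits b
  | Monus a _ => eval_bits a
  end.

Fixpoint eval_weight (a : expr) : nat :=
  eval_bits a +
  match a with
  | Const _ => 0
  | Read b => eval_weight b
  | Add a b | Mul a b | Monus a b => eval_weight a + eval_weight b
  end.

Lemma eval_bitsP V M a : (forall j, M j <= V) ->
  bitsize (eval M a) <= eval_bits a * bitsize V.
Proof.
move=> MV; elim: a => [n|a _|a IHa b IHb|a IHa b IHb|a IHa b IHb] /=.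
- exact: leq_pmulr.
- by rewrite mul1n bitsize_mono.
- by rewrite mulnDl (leq_trans (bitsizeD _ _)) // leq_add.
- by apply: leq_trans IHa; apply: bitsize_mono; apply: leq_subr.
- by rewrite mulnDl (leq_trans (bitsizeM _ _)) // leq_add.
Qed.

Lemma eval_costP V M a : (forall j, M j <= V) ->
  eval_cost M a <= eval_weight a * bitsize V.
Proof.
move=> MV; elim: a => [n|a IH|a IHa b IHb|a IHa b IHb|a IHa b IHb];
  rewrite [eval_weight _]/= mulnDl; apply: leq_add => //;
  try exact: (eval_bitsP (Const _)); try exact: (eval_bitsP (Read _));
  try exact: (eval_bitsP (Add _ _)); try exact: (eval_bitsP (Monus _ _));
  try exact: (eval_bitsP (Mul _ _)); by rewrite mulnDl leq_add.
Qed.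

(* A language of array programs whose loops are bounded by [m] or a constant
   more, where [m] is the content of cell 1. Array 0 is the memory below
   address [6 * m + 5], which holds the input and receives the output; the
   arrays [1 .. narr] are interleaved above it. *)
Definition narr := 25.

Inductive aexpr :=
| ANum of nat
| ASize
| ARead of nat & aexpr
| AAdd of aexpr & aexpr
| ASub of aexpr & aexpr
| AMul of aexpr & aexpr.

Inductive prog :=
| PSet of nat & aexpr & aexpr
| PLoad of nat & aexpr & aexpr
| POut of aexpr & aexpr
| PSeq of prog & prog
| PIf of aexpr & prog & prog
| PFor of nat & nat & prog.

Definition state := nat -> nat -> nat.

Definition upd (s : state) (a i v : nat) : state :=
  fun a' i' => if Nat.eqb a' a then (if i' == i then v else s a' i') else s a' i'.

Fixpoint aeval (m : nat) (s : state) (e : aexpr) : nat :=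
  match e with
  | ANum n => n
  | ASize => m
  | ARead a i => s a (aeval m s i)
  | AAdd e f => aeval m s e + aeval m s f
  | ASub e f => aeval m s e - aeval m s f
  | AMul e f => aeval m s e * aeval m s f
  end.

Fixpoint prun (m : nat) (p : prog) (s : state) : state :=
  match p with
  | PSet a i e => upd s a (aeval m s i) (aeval m s e)
  | PLoad a i j => upd s a (aeval m s i) (s 0 (aeval m s j))
  | POut j e => upd s 0 (aeval m s j) (aeval m s e)
  | PSeq p q => prun m q (prun m p s)
  | PIf e p q => if aeval m s e != 0 then prun m p s else prun m q s
  | PFor a c p =>
      iter (m + c) (fun s => upd (prun m p s) a 0 (prun m p s a 0).+1) (upd s a 0 0)
  end.

Definition for_state m a p i (s : state) : state :=
  iter i (fun s => upd (prun m p s) a 0 (prun m p s a 0).+1) (upd s a 0 0).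

Fixpoint safe (m V : nat) (p : prog) (s : state) : Prop :=
  match p with
  | PSet _ _ e => aeval m s e <= V
  | PLoad _ _ j => aeval m s j < 6 * m + 5
  | POut j e => [/\ aeval m s e <= V, aeval m s j < 6 * m + 5 & aeval m s j != 1]
  | PSeq p q => safe m V p s /\ safe m V q (prun m p s)
  | PIf e p q => if aeval m s e != 0 then safe m V p s else safe m V q s
  | PFor a c p => m + c <= V /\ forall i, i < m + c -> safe m V p (for_state m a p i s)
  end.

Definition arr_ok a := 0 < a <= narr.

Fixpoint awf (e : aexpr) : bool :=
  match e with
  | ANum _ | ASize => true
  | ARead a i => arr_ok a && awf i
  | AAdd e f | ASub e f | AMul e f => awf e && awf f
  end.

Fixpoint writes (p : prog) : seq nat :=
  match p with
  | PSet a _ _ | PLoad a _ _ => [:: a]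
  | POut _ _ => [:: 0]
  | PSeq p q | PIf _ p q => writes p ++ writes q
  | PFor a _ p => a :: writes p
  end.

Fixpoint wf (p : prog) : bool :=
  match p with
  | PSet a i e | PLoad a i e => [&& arr_ok a, awf i & awf e]
  | POut j e => awf j && awf e
  | PSeq p q => wf p && wf q
  | PIf e p q => [&& awf e, wf p & wf q]
  | PFor a _ p => [&& arr_ok a, a \notin writes p & wf p]
  end.

Definition caddr (a : nat) (i : expr) : expr :=
  Add (Add (Mul (Const 6) (Read (Const 1))) (Const (4 + a))) (Mul (Const narr) i).

Fixpoint ccomp (e : aexpr) : expr :=
  match e with
  | ANum n => Const n
  | ASize => Read (Const 1)
  | ARead a i => Read (caddr a (ccomp i))
  | AAdd e f => Add (ccomp e) (ccomp f)
  | ASub e f => Monus (ccomp e) (ccomp f)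
  | AMul e f => Mul (ccomp e) (ccomp f)
  end.

Definition cbound (a c : nat) : expr :=
  Monus (Add (Read (Const 1)) (Const c)) (Read (caddr a (Const 0))).
Definition cinit (a : nat) : cmd := Store (caddr a (Const 0)) (Const 0).
Definition cincr (a : nat) : cmd :=
  Store (caddr a (Const 0)) (Add (Read (caddr a (Const 0))) (Const 1)).

Fixpoint pcomp (p : prog) : cmd :=
  match p with
  | PSet a i e => Store (caddr a (ccomp i)) (ccomp e)
  | PLoad a i j => Store (caddr a (ccomp i)) (Read (ccomp j))
  | POut j e => Store (ccomp j) (ccomp e)
  | PSeq p q => Seq (pcomp p) (pcomp q)
  | PIf e p q => If (ccomp e) (pcomp p) (pcomp q)
  | PFor a c p => Seq (cinit a) (While (cbound a c) (Seq (pcomp p) (cincr a)))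
  end.

Definition store_time (a b : expr) x := 1 + eval_weight a * x + eval_weight b * x.

(* [x] stands for the length of the largest number in the memory. *)
Fixpoint ptime (p : prog) (m x : nat) : nat :=
  match p with
  | PSet a i e => store_time (caddr a (ccomp i)) (ccomp e) x
  | PLoad a i j => store_time (caddr a (ccomp i)) (Read (ccomp j)) x
  | POut j e => store_time (ccomp j) (ccomp e) x
  | PSeq p q => 1 + ptime p m x + ptime q m x
  | PIf e p q => 1 + eval_weight (ccomp e) * x + (ptime p m x + ptime q m x)
  | PFor a c p =>
      1 + store_time (caddr a (Const 0)) (Const 0) x +
      ((m + c) * (1 + eval_weight (cbound a c) * x + (1 + ptime p m x +
          store_time (caddr a (Const 0)) (Add (Read (caddr a (Const 0))) (Const 1)) x)) +
       (1 + eval_weight (cbound a c) * x))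
  end.

Lemma eqbE a b : Nat.eqb a b = (a == b).
Proof. by elim: a b => [|a IH] [|b] //=; rewrite IH. Qed.

Section Exec.
Variables m V : nat.

Definition rep (M : memory) (s : state) : Prop :=
  [/\ M 1 = m, s 0 1 = m, forall j, j < 6 * m + 5 -> M j = s 0 j &
      forall a i, a < narr -> M (6 * m + 5 + a + narr * i) = s a.+1 i].

Definition bounded (s : state) : Prop := forall a i, s a i <= V.

Lemma rep_bounded M s : rep M s -> bounded s -> forall j, M j <= V.
Proof.
move=> [_ _ low arr] bs j; case: (ltnP j (6 * m + 5)) => [/low->//|le].
have ltr : (j - (6 * m + 5)) %% narr < narr by rewrite ltn_mod.
have := divn_eq (j - (6 * m + 5)) narr.
move: (_ %/ _) (_ %% _) ltr => q r ltr E.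
have -> : j = 6 * m + 5 + r + narr * q by lia.
by rewrite arr.
Qed.

Lemma eval_caddr M s a i : rep M s -> eval M (caddr a i) = 6 * m + (4 + a) + narr * eval M i.
Proof. by case=> M1 _ _ _ /=; rewrite M1. Qed.

Lemma rep_read M s a i : rep M s -> arr_ok a ->
  M (6 * m + (4 + a) + narr * i) = s a i.
Proof.
move=> [_ _ _ arr] /andP[]; case: a => // a _ lta.
by rewrite -(arr a i) // -addnA; congr (M _); lia.
Qed.

Lemma eval_ccomp M s e : rep M s -> awf e -> eval M (ccomp e) = aeval m s e.
Proof.
move=> rM; elim: e => [//||a i IH /andP[oka /IH ii]|e IHe f IHf /andP[/IHe + /IHf +]|
  e IHe f IHf /andP[/IHe + /IHf +]|e IHe f IHf /andP[/IHe + /IHf +]];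
  try by move=> /= -> ->.
- by case: rM.
- transitivity (M (eval M (caddr a (ccomp i)))) => //.
  by rewrite (eval_caddr _ _ rM) ii (rep_read _ rM).
Qed.

Lemma rep_update M s a i v : rep M s -> arr_ok a ->
  rep (update M (6 * m + (4 + a) + narr * i) v) (upd s a i v).
Proof.
move=> [M1 s1 low arr] /andP[]; case: a => // a _ lta.
split=> //=.
- by rewrite /update ifF //; lia.
- by move=> j ltj; rewrite /update ifF ?low //; lia.
- move=> b k ltb; rewrite /update /upd arr //=.
  rewrite eqbE.
  have -> : (6 * m + 5 + b + narr * k == 6 * m + (4 + a.+1) + narr * i) = (b == a) && (k == i).
    rewrite /narr in lta ltb *.
    apply/eqP/andP; first by move=> E; split; apply/eqP; lia.
    by case=> /eqP-> /eqP->; lia.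
  by case: (b == a).
Qed.

Lemma bounded_upd s a i v : bounded s -> v <= V -> bounded (upd s a i v).
Proof. by move=> bs le b j; rewrite /upd; case: (Nat.eqb _ _) => //; case: (_ == _). Qed.

Lemma prun_frame p s a i : a \notin writes p -> prun m p s a i = s a i.
Proof.
elim: p s => [b j e|b j e|j e|p IHp q IHq|e p IHp q IHq|b c p IHp] s /=.
1-3: by rewrite inE /upd => nab; rewrite eqbE (negPf nab).
- by rewrite mem_cat negb_or => /andP[np nq]; rewrite IHq ?IHp.
- by rewrite mem_cat negb_or => /andP[np nq]; case: ifP => _; rewrite ?IHq ?IHp.
- rewrite inE negb_or => /andP[nab np].
  have nupd s' v : upd s' b 0 v a i = s' a i.
    by rewrite /upd eqbE (negPf nab).
  by elim: (m + c) => [|n IH] /=; rewrite nupd ?IHp.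
Qed.

Lemma for_counter a p i s : a \notin writes p -> for_state m a p i s a 0 = i.
Proof.
move=> nw; elim: i => [|i IH] /=; first by rewrite /upd eqbE !eqxx.
rewrite {1}/upd eqbE !eqxx -/(for_state m a p i s).
by rewrite prun_frame // IH.
Qed.

Lemma exec_store_time M s a b : rep M s -> bounded s ->
  1 + eval_cost M a + eval_cost M b <= store_time a b (bitsize V).
Proof.
move=> rM bs; have MV := rep_bounded rM bs.
by rewrite /store_time -!addnA ltnS leq_add ?(eval_costP _ MV).
Qed.

Lemma exec_prog p M s : wf p -> rep M s -> bounded s -> safe m V p s ->
  exists M' t, [/\ exec (pcomp p) M M' t, t <= ptime p m (bitsize V),
    rep M' (prun m p s) & bounded (prun m p s)].
Proof.
elim: p M s => [a i e|a i j|j e|p IHp q IHq|e p IHp q IHq|a c p IHp] M s.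
- move=> /and3P[oka wi we] rM bs sf.
  exists (update M (eval M (caddr a (ccomp i))) (eval M (ccomp e))).
  eexists; split; [exact: exec_store | exact: exec_store_time rM bs | | exact: bounded_upd].
  rewrite (eval_caddr _ _ rM) !(eval_ccomp rM) //; exact: rep_update.
- move=> /and3P[oka wi wj] rM bs sf.
  exists (update M (eval M (caddr a (ccomp i))) (eval M (Read (ccomp j)))).
  eexists; split; [exact: exec_store | exact: exec_store_time rM bs | | exact: bounded_upd].
  rewrite (eval_caddr _ _ rM) /= !(eval_ccomp rM) //.
  by have [_ _ -> // _] := rM; apply: rep_update.
- move=> /andP[wj we] rM bs /= [ev jlow j1].
  exists (update M (eval M (ccomp j)) (eval M (ccomp e))).
  eexists; split; [exact: exec_store | exact: exec_store_time rM bs | | exact: bounded_upd].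
  rewrite !(eval_ccomp rM) //; have [M1 s1 low arr] := rM.
  split.
  + by rewrite /update ifF // eq_sym (negPf j1).
  + by rewrite /upd /= ifF // eq_sym (negPf j1).
  + by move=> k ltk; rewrite /update /upd /=; case: eqP => // _; apply: low.
  + move=> b k ltb; rewrite /update /upd /= ifF ?arr //.
    by apply/eqP => E; move: jlow; rewrite -E; lia.
- move=> /andP[wp wq] rM bs [sp sq].
  have [M1 [t1 [e1 le1 r1 b1]]] := IHp _ _ wp rM bs sp.
  have [M2 [t2 [e2 le2 r2 b2]]] := IHq _ _ wq r1 b1 sq.
  exists M2, (1 + t1 + t2); split=> //; first exact: exec_seq e1 e2.
  by rewrite /= !leq_add.
- move=> /and3P[we wp wq] rM bs /=; have Ee := eval_ccomp rM we.
  have MV := rep_bounded rM bs; have ce := eval_costP (ccomp e) MV.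
  case: ifP => c0 sf.
    have [M1 [t1 [e1 le1 r1 b1]]] := IHp _ _ wp rM bs sf.
    exists M1, (1 + eval_cost M (ccomp e) + t1); split=> //.
      by apply: exec_if; rewrite Ee c0.
    by rewrite -!addnA ltnS leq_add // (leq_trans le1) ?leq_addr.
  have [M1 [t1 [e1 le1 r1 b1]]] := IHq _ _ wq rM bs sf.
  exists M1, (1 + eval_cost M (ccomp e) + t1); split=> //.
    by apply: exec_if; rewrite Ee c0.
  by rewrite -!addnA ltnS leq_add // (leq_trans le1) ?leq_addl.
move=> /and3P[oka nw wp] rM bs [NV sf].
set N := m + c in NV sf; set x := bitsize V.
pose st i := for_state m a p i s.
have addr0 M' s' : rep M' s' -> eval M' (caddr a (Const 0)) = 6 * m + (4 + a) + narr * 0.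
  by move=> rM'; rewrite (eval_caddr _ _ rM').
pose body := 1 + eval_weight (cbound a c) * x + (1 + ptime p m x +
  store_time (caddr a (Const 0)) (Add (Read (caddr a (Const 0))) (Const 1)) x).
pose stop := 1 + eval_weight (cbound a c) * x.
have loop k : k <= N -> forall M0, rep M0 (st (N - k)) -> bounded (st (N - k)) ->
    exists M' t, [/\ exec (While (cbound a c) (Seq (pcomp p) (cincr a))) M0 M' t,
      t <= k * body + stop, rep M' (st N) & bounded (st N)].
  elim: k => [_ M0|k IHk ltk M0 r0 b0].
    rewrite subn0 => r0 b0; exists M0, (1 + eval_cost M0 (cbound a c)); split=> //.
      apply: exec_while_stop.
      have -> : eval M0 (cbound a c) = M0 1 + c - M0 (eval M0 (caddr a (Const 0))) by [].
      by rewrite (addr0 _ _ r0) (rep_read _ r0) // [st _ _ _]for_counter //; have [-> _ _ _] := r0; rewrite subnn.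
    by rewrite mul0n ltnS (eval_costP _ (rep_bounded r0 b0)).
  have ltN : N - k.+1 < N by lia.
  have [M1 [t1 [e1 le1 r1 b1]]] := IHp _ _ wp r0 b0 (sf _ ltN).
  have c1 : prun m p (st (N - k.+1)) a 0 = N - k.+1.
    by rewrite prun_frame // [LHS]for_counter.
  have Est : st (N - k) = upd (prun m p (st (N - k.+1))) a 0 (N - k.+1).+1.
    have -> : N - k = (N - k.+1).+1 by lia.
    by rewrite /st /for_state iterS -/(for_state m a p _ s) -/(st _) c1.
  have ev1 : eval M1 (Add (Read (caddr a (Const 0))) (Const 1)) = (N - k.+1).+1.
    transitivity (M1 (eval M1 (caddr a (Const 0))) + 1) => //.
    by rewrite (addr0 _ _ r1) (rep_read _ r1) // c1 addn1.
  pose M2 := update M1 (eval M1 (caddr a (Const 0))) (eval M1 (Add (Read (caddr a (Const 0))) (Const 1))).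
  have r2 : rep M2 (st (N - k)).
    by rewrite Est /M2 ev1 (addr0 _ _ r1); apply: rep_update.
  have b2 : bounded (st (N - k)).
    by rewrite Est; apply: bounded_upd => //; apply: leq_trans NV; lia.
  have [M' [t [e2 le2 r' b']]] := IHk (ltnW ltk) _ r2 b2.
  have le3 := exec_store_time (caddr a (Const 0)) (Add (Read (caddr a (Const 0))) (Const 1)) r1 b1.
  have le4 := eval_costP (cbound a c) (rep_bounded r0 b0).
  eexists; eexists; split; [|  |exact: r'|exact: b'].
    apply: exec_while_loop (exec_seq e1 (exec_store _ _ M1)) e2.
    have -> : eval M0 (cbound a c) = M0 1 + c - M0 (eval M0 (caddr a (Const 0))) by [].
    rewrite (addr0 _ _ r0) (rep_read _ r0) // [st _ _ _]for_counter //.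
    by have [-> _ _ _] := r0; rewrite -/N; lia.
  rewrite mulSn -[body + _ + _]addnA leq_add //.
  apply: leq_add; first by rewrite leq_add2l.
  by apply: leq_add; first by rewrite leq_add2l.
have r0 : rep (update M (eval M (caddr a (Const 0))) (eval M (Const 0))) (st 0).
  by rewrite (addr0 _ _ rM); apply: rep_update.
have b0 : bounded (st 0) by apply: bounded_upd.
have := loop N (leqnn N); rewrite subnn => /(_ _ r0 b0) [M' [t [e1 le1 r' b']]].
exists M'; eexists; split; [exact: exec_seq (exec_store _ _ M) e1 | | exact: r' | exact: b'].
have le2 := exec_store_time (caddr a (Const 0)) (Const 0) rM bs.
exact: leq_add (leq_add (leqnn 1) le2) le1.
Qed.

End Exec.

Section Rules.
Variables m V : nat.

Definition ok (p : prog) (s : state) (Q : state -> Prop) : Prop :=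
  safe m V p s /\ Q (prun m p s).

Lemma ok_set a i e s (Q : state -> Prop) : aeval m s e <= V ->
  Q (upd s a (aeval m s i) (aeval m s e)) -> ok (PSet a i e) s Q.
Proof. by []. Qed.

Lemma ok_load a i j s (Q : state -> Prop) : aeval m s j < 6 * m + 5 ->
  Q (upd s a (aeval m s i) (s 0 (aeval m s j))) -> ok (PLoad a i j) s Q.
Proof. by []. Qed.

Lemma ok_out j e s (Q : state -> Prop) : aeval m s e <= V ->
  aeval m s j < 6 * m + 5 -> aeval m s j != 1 ->
  Q (upd s 0 (aeval m s j) (aeval m s e)) -> ok (POut j e) s Q.
Proof. by []. Qed.

Lemma ok_seq p q s (Q : state -> Prop) :
  ok p s (fun s' => ok q s' Q) -> ok (PSeq p q) s Q.
Proof. by move=> [sp [sq HQ]]. Qed.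

Lemma ok_if e p q s (Q : state -> Prop) :
  (aeval m s e != 0 -> ok p s Q) -> (aeval m s e = 0 -> ok q s Q) ->
  ok (PIf e p q) s Q.
Proof.
rewrite /ok /=; case: ifP => [c0 H _|/negbFE/eqP c0 _ H]; first exact: H.
exact: H.
Qed.

Lemma ok_conseq p s (Q Q' : state -> Prop) :
  ok p s Q -> (forall s', (forall a i, a \notin writes p -> s' a i = s a i) -> Q s' -> Q' s') ->
  ok p s Q'.
Proof. by move=> [sp HQ] H; split=> //; apply: H HQ => a i; apply: prun_frame. Qed.

Lemma ok_for (Inv : nat -> state -> Prop) a c p s (Q : state -> Prop) :
  a \notin writes p -> m + c <= V ->
  Inv 0 (upd s a 0 0) ->
  (forall i s', i < m + c -> s' a 0 = i ->
     (forall b j, b \notin a :: writes p -> s' b j = s b j) -> Inv i s' ->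
     ok p s' (fun s'' => Inv i.+1 (upd s'' a 0 i.+1))) ->
  (forall s', (forall b j, b \notin a :: writes p -> s' b j = s b j) ->
     Inv (m + c) s' -> Q s') ->
  ok (PFor a c p) s Q.
Proof.
move=> nw NV I0 step fin; pose st i := for_state m a p i s.
have stS i : st i.+1 = upd (prun m p (st i)) a 0 i.+1.
  by rewrite /st /for_state iterS -/(for_state m a p i s) prun_frame // for_counter.
have frame i b j : b \notin a :: writes p -> st i b j = s b j.
  rewrite inE negb_or => /andP[nb nbw]; elim: i => [|i IH].
    by rewrite /st /for_state /= /upd eqbE (negPf nb).
  by rewrite stS /upd eqbE (negPf nb) prun_frame.
have H i : i <= m + c -> Inv i (st i).
  elim: i => [//|i IH] lti; have [] := step i (st i) lti (for_counter _ _ _ nw) (frame i) (IH (ltnW lti)).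
  by rewrite stS.
split; last exact: fin (frame _) (H _ (leqnn _)).
split=> // i lti.
by have [] := step i (st i) lti (for_counter _ _ _ nw) (frame i) (H i (ltnW lti)).
Qed.

End Rules.

Lemma ptime_poly p : exists a d, forall m b x, m <= x -> b <= x ->
  ptime p m b <= a * x.+1 ^ d.
Proof.
have store a b m c x : m <= x -> c <= x -> store_time a b c <= (1 + eval_weight a + eval_weight b) * x.+1 ^ 1.
  by move=> _ le; rewrite /store_time; nia.
elim: p => [a i e|a i j|j e|p [a [d H]] q [a' [d' H']]|e p [a [d H]] q [a' [d' H']]|k c p [a [d H]]].
- by eexists; exists 1 => m b x; apply: store.
- by eexists; exists 1 => m b x; apply: store.
- by eexists; exists 1 => m b x; apply: store.
- exists (1 + a + a'), (d + d') => m b x lm lb /=.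
  have := H m b x lm lb; have := H' m b x lm lb; rewrite expnD.
  have := expn_gt0 x.+1 d; have := expn_gt0 x.+1 d'.
  by set X := _ ^ d; set Y := _ ^ d'; nia.
- exists (1 + eval_weight (ccomp e) + a + a'), (d + d' + 1) => m b x lm lb /=.
  have := H m b x lm lb; have := H' m b x lm lb; rewrite !expnD expn1.
  have := expn_gt0 x.+1 d; have := expn_gt0 x.+1 d'.
  set X := _ ^ d; set Y := _ ^ d'; set w := eval_weight _ => /= Y0 X0 le1 le2.
  have : b <= X * Y * x.+1 by nia.
  have : 1 <= X * Y * x.+1 by nia.
  have : X <= X * Y * x.+1 by nia.
  have : Y <= X * Y * x.+1 by nia.
  by set Z := X * Y * x.+1; nia.
have [a0 H0] : exists a0, forall m b x, m <= x -> b <= x -> 1 + store_time (caddr k (Const 0)) (Const 0) b <= a0 * x.+1.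
  by eexists => m b x lm lb; rewrite -addn1 /store_time; instantiate (1 := 2 + eval_weight (caddr k (Const 0)) + eval_weight (Const 0)); nia.
pose w := eval_weight (cbound k c).
pose w' := 1 + eval_weight (caddr k (Const 0)) + eval_weight (Add (Read (caddr k (Const 0))) (Const 1)).
exists (a0 + (c + 1) * (2 + w + a + w') + 1 + w), (d + 2) => m b x lm lb.
have h0 := H0 m b x lm lb; have h1 := H m b x lm lb.
have h2 := store (caddr k (Const 0)) (Add (Read (caddr k (Const 0))) (Const 1)) m b x lm lb.
have -> : ptime (PFor k c p) m b = 1 + store_time (caddr k (Const 0)) (Const 0) b +
  ((m + c) * (1 + w * b + (1 + ptime p m b +
    store_time (caddr k (Const 0)) (Add (Read (caddr k (Const 0))) (Const 1)) b)) +
   (1 + w * b)) by [].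
move: h0 h1 h2; rewrite -/w' expn1 expnD.
set S0 := 1 + store_time _ _ b; set P := ptime p m b; set S1 := store_time _ _ b.
move: S0 P S1 w w' => S0 P S1 w w'.
have := expn_gt0 x.+1 d; set X := x.+1 ^ d => /= X0 h0 h1 h2.
have yX : x.+1 <= X * x.+1 by apply: leq_pmull.
have XX : X <= X * x.+1 by apply: leq_pmulr.
have h3 : 1 + w * b + (1 + P + S1) <= (2 + w + a + w') * (X * x.+1).
  have : w * b <= w * (X * x.+1) by rewrite leq_mul2l (leq_trans lb) ?orbT // ltnW.
  have : a * X <= a * (X * x.+1) by rewrite leq_mul2l XX orbT.
  have : w' * x.+1 <= w' * (X * x.+1) by rewrite leq_mul2l yX orbT.
  by move: (X * x.+1) yX => Y; lia.
have h4 : m + c <= (c + 1) * x.+1 by nia.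
have h5 := leq_mul h4 h3.
have -> : x.+1 ^ 2 = x.+1 * x.+1 by [].
have h6 : X * x.+1 <= X * (x.+1 * x.+1) by rewrite leq_mul2l leq_pmulr ?orbT.
have h7 : w * b <= w * (X * (x.+1 * x.+1)).
  by rewrite leq_mul2l; apply/orP; right; lia.
have h8 : a0 * x.+1 <= a0 * (X * (x.+1 * x.+1)) by rewrite leq_mul2l (leq_trans yX h6) orbT.
have h9 : (c + 1) * x.+1 * ((2 + w + a + w') * (X * x.+1)) =
  (c + 1) * (2 + w + a + w') * (X * (x.+1 * x.+1)) by ring.
rewrite h9 in h5; rewrite !mulnDl -!mulnDl.
move: (X * (x.+1 * x.+1)) h5 h6 h7 h8 => Z h5 h6 h7 h8.
rewrite [(a0 + _ + _ + w) * Z]mulnDl [(a0 + _ + _) * Z]mulnDl [(a0 + _) * Z]mulnDl mul1n.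
by move: ((c + 1) * _ * Z) ((m + c) * _) h5 => ? ? ?; lia.
Qed.

(** * The greedy program *)

Arguments upd s a i v a' i' /.

Notation aI := 1 (only parsing).
Notation aJ := 2 (only parsing).
Notation aROOT := 3 (only parsing).
Notation aE1 := 4 (only parsing).
Notation aE2 := 5 (only parsing).
Notation aEN := 6 (only parsing).
Notation aED := 7 (only parsing).
Notation aPZ := 8 (only parsing).
Notation aPN := 9 (only parsing).
Notation aPD := 10 (only parsing).
Notation aCN := 11 (only parsing).
Notation aCD := 12 (only parsing).
Notation aVIS := 13 (only parsing).
Notation aPE := 14 (only parsing).
Notation aPV := 15 (only parsing).
Notation aREP := 16 (only parsing).
Notation aMRG := 17 (only parsing).
Notation aRK := 18 (only parsing).
Notation aCHO := 19 (only parsing).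
Notation aOUT := 20 (only parsing).
Notation aLEN := 21 (only parsing).
Notation aSEL := 22 (only parsing).
Notation aTMP := 23 (only parsing).
Notation aU := 24 (only parsing).
Notation aSKIP := 25 (only parsing).

Definition reg (a : nat) : aexpr := ARead a (ANum 0).
Definition setr (a : nat) (e : aexpr) : prog := PSet a (ANum 0) e.
Definition pskip : prog := setr aSKIP (ANum 0).
Definition anot (e : aexpr) : aexpr := ASub (ANum 1) e.
Arguments reg a /.
Arguments setr a e /.
Arguments anot e /.

Definition load_edges : prog :=
  PFor aI 0
    (PSeq (PLoad aE1 (reg aI) (AAdd (ANum 3) (AMul (ANum 4) (reg aI))))
    (PSeq (PLoad aE2 (reg aI) (AAdd (ANum 4) (AMul (ANum 4) (reg aI))))
    (PSeq (PLoad aEN (reg aI) (AAdd (ANum 5) (AMul (ANum 4) (reg aI))))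
          (PLoad aED (reg aI) (AAdd (ANum 6) (AMul (ANum 4) (reg aI))))))).

Definition load_prizes : prog :=
  PFor aI 1
    (PSeq (PLoad aPZ (reg aI) (AAdd (AAdd (ANum 3) (AMul (ANum 4) ASize)) (AMul (ANum 2) (reg aI))))
    (PSeq (PLoad aPD (reg aI) (AAdd (AAdd (ANum 4) (AMul (ANum 4) ASize)) (AMul (ANum 2) (reg aI))))
          (PSet aPN (reg aI) (ARead aPZ (reg aI))))).

Definition load_prog : prog :=
  PSeq (PLoad aROOT (ANum 0) (ANum 2)) (PSeq load_edges load_prizes).

Definition visit (a b : aexpr) : prog :=
  PIf (AMul (ARead aVIS a) (anot (ARead aVIS b)))
    (PSeq (PSet aVIS b (ANum 1))
    (PSeq (PSet aPE b (reg aJ))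
    (PSeq (PSet aPV b a)
    (PSeq (PSet aCN b (ARead aEN (reg aJ)))
          (PSet aCD b (ARead aED (reg aJ)))))))
    pskip.

Definition orient_prog : prog :=
  PSeq (PSet aVIS (reg aROOT) (ANum 1))
  (PFor aI 0 (PFor aJ 0
    (PSeq (visit (ARead aE1 (reg aJ)) (ARead aE2 (reg aJ)))
          (visit (ARead aE2 (reg aJ)) (ARead aE1 (reg aJ)))))).

(* [aSEL] holds one more than the selected vertex, or 0 if there is none. *)
Definition select_densest : prog :=
  let b := ASub (reg aSEL) (ANum 1) in
  PFor aJ 1
    (PIf (AMul (anot (ARead aMRG (reg aJ))) (AAdd (anot (reg aSEL))
       (ASub (AMul (AMul (ARead aPN (reg aJ)) (ARead aCD (reg aJ)))
                   (AMul (ARead aCN b) (ARead aPD b)))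
             (AMul (AMul (ARead aPN b) (ARead aCD b))
                   (AMul (ARead aCN (reg aJ)) (ARead aPD (reg aJ)))))))
      (setr aSEL (AAdd (reg aJ) (ANum 1))) pskip).

Definition combine : prog :=
  let u := reg aU in let v := reg aTMP in
  PSeq (PSet aPN u (AAdd (AMul (ARead aPN u) (ARead aPD v)) (AMul (ARead aPN v) (ARead aPD u))))
  (PSeq (PSet aPD u (AMul (ARead aPD u) (ARead aPD v)))
  (PSeq (PSet aCN u (AAdd (AMul (ARead aCN u) (ARead aCD v)) (AMul (ARead aCN v) (ARead aCD u))))
        (PSet aCD u (AMul (ARead aCD u) (ARead aCD v))))).

Definition relabel : prog :=
  PFor aJ 1
    (PIf (anot (AAdd (ASub (ARead aREP (reg aJ)) (reg aTMP))
                     (ASub (reg aTMP) (ARead aREP (reg aJ)))))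
      (PSet aREP (reg aJ) (reg aU)) pskip).

Definition merge_body : prog :=
  PSeq (setr aSEL (ANum 0))
  (PSeq select_densest
  (PSeq (setr aTMP (ASub (reg aSEL) (ANum 1)))
  (PSeq (setr aU (ARead aREP (ARead aPV (reg aTMP))))
  (PSeq (PSet aRK (reg aI) (reg aTMP))
  (PSeq (PSet aMRG (reg aTMP) (ANum 1))
  (PSeq combine relabel)))))).

Definition merge_init : prog :=
  PSeq (PSet aMRG (reg aROOT) (ANum 1))
  (PSeq (PSet aPN (reg aROOT) (ANum 0))
  (PSeq (PSet aPD (reg aROOT) (ANum 0))
        (PFor aJ 1 (PSet aREP (reg aJ) (reg aJ))))).

Definition merge_prog : prog := PSeq merge_init (PFor aI 0 merge_body).

Definition select_first : prog :=
  PFor aJ 0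
    (PIf (AMul (anot (reg aSEL))
            (AMul (anot (ARead aCHO (ARead aRK (reg aJ))))
                  (ARead aCHO (ARead aPV (ARead aRK (reg aJ))))))
      (setr aSEL (AAdd (ARead aRK (reg aJ)) (ANum 1))) pskip).

Definition order_body : prog :=
  PSeq (setr aSEL (ANum 0))
  (PSeq select_first
  (PSeq (setr aTMP (ASub (reg aSEL) (ANum 1)))
  (PSeq (PSet aCHO (reg aTMP) (ANum 1))
  (PSeq (PSet aOUT (reg aI) (ARead aPE (reg aTMP)))
        (PIf (ARead aPZ (reg aTMP)) (setr aLEN (AAdd (reg aI) (ANum 1))) pskip))))).

Definition order_prog : prog :=
  PSeq (PSet aCHO (reg aROOT) (ANum 1)) (PFor aI 0 order_body).

(* Cell 1 holds the base of the arrays, so it can only be overwritten last. *)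
Definition out_prog : prog :=
  PSeq (PFor aI 0
    (PIf (ASub (ASub ASize (reg aI)) (ANum 1))
      (POut (ASub ASize (reg aI)) (ARead aOUT (ASub (ASub ASize (reg aI)) (ANum 1))))
      pskip))
  (POut (ANum 0) (reg aLEN)).

Definition main_prog : prog :=
  PSeq load_prog (PSeq orient_prog (PSeq merge_prog (PSeq order_prog out_prog))).

Lemma main_wf : wf main_prog.
Proof. by []. Qed.

Section Encoding.
Variable I : instance rat.

Definition vid (v : vert I) : nat := enum_rank v.
Definition eid (e : edge I) : nat := enum_rank e.
Definition en (e : edge I) : nat := `|numq (cost e)|%N.
Definition ed (e : edge I) : nat := `|denq (cost e)|%N.
Definition pz (v : vert I) : nat := `|numq (prize v)|%N.
Definition pd (v : vert I) : nat := `|denq (prize v)|%N.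

Lemma vid_inj : injective vid.
Proof. by move=> x y /val_inj /enum_rank_inj. Qed.

Lemma eid_inj : injective eid.
Proof. by move=> x y /val_inj /enum_rank_inj. Qed.

Lemma vid_ltn v : vid v < #|vert I|.
Proof. exact: ltn_ord. Qed.

Lemma eid_ltn e : eid e < #|edge I|.
Proof. exact: ltn_ord. Qed.

Lemma vid_onto j : j < #|vert I| -> exists v, vid v = j.
Proof.
by move=> ltj; exists (enum_val (Ordinal ltj)); rewrite /vid enum_valK.
Qed.

Lemma eid_onto j : j < #|edge I| -> exists e, eid e = j.
Proof.
by move=> ltj; exists (enum_val (Ordinal ltj)); rewrite /eid enum_valK.
Qed.

Lemma size_flatten_blocks (T : Type) (f : T -> seq nat) k s :
  (forall x, size (f x) = k) -> size (flatten (map f s)) = k * size s.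
Proof. by move=> fk; elim: s => [|x s IH] /=; rewrite ?muln0 // size_cat fk IH mulnS. Qed.

Lemma nth_flatten_blocks (T : Type) (f : T -> seq nat) k s x0 i j :
  (forall x, size (f x) = k) -> i < size s -> j < k ->
  nth 0 (flatten (map f s)) (k * i + j) = nth 0 (f (nth x0 s i)) j.
Proof.
move=> fk; elim: s i => [//|x s IH] [|i] /= lti ltj; rewrite nth_cat fk.
  by rewrite muln0 ltj.
by rewrite mulnS -addnA ltnNge leq_addr /= addKn IH.
Qed.

Let enc := encode_instance I.

Lemma enc_edge e : [/\ nth 0 enc (3 + 4 * eid e) = vid (end1 e),
  nth 0 enc (4 + 4 * eid e) = vid (end2 e),
  nth 0 enc (5 + 4 * eid e) = en e & nth 0 enc (6 + 4 * eid e) = ed e].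
Proof.
pose f (e : edge I) := [:: nat_of_ord (enum_rank (end1 e)),
  nat_of_ord (enum_rank (end2 e)) & encode_rat (cost e)].
have H j : j < 4 -> nth 0 enc (3 + (4 * eid e + j)) = nth 0 (f e) j.
  move=> ltj; rewrite /enc /encode_instance nth_cat ltnNge leq_addr /= addKn nth_cat.
  rewrite (@size_flatten_blocks _ f 4) // -cardE.
  have lt : 4 * eid e + j < 4 * #|edge I| by have := eid_ltn e; lia.
  rewrite lt (@nth_flatten_blocks _ f 4 _ e) //; last by rewrite -cardE eid_ltn.
  by rewrite nth_enum_rank.
by split; [rewrite -[RHS]/(nth 0 (f e) 0) | rewrite -[RHS]/(nth 0 (f e) 1)
  | rewrite -[RHS]/(nth 0 (f e) 2) | rewrite -[RHS]/(nth 0 (f e) 3)];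
  rewrite -H //; congr nth; lia.
Qed.

Lemma enc_vert v :
  nth 0 enc (3 + 4 * #|edge I| + 2 * vid v) = pz v /\
  nth 0 enc (4 + 4 * #|edge I| + 2 * vid v) = pd v.
Proof.
pose f (e : edge I) := [:: nat_of_ord (enum_rank (end1 e)),
  nat_of_ord (enum_rank (end2 e)) & encode_rat (cost e)].
pose g (v : vert I) := encode_rat (prize v).
have H j : j < 2 -> nth 0 enc (3 + (4 * #|edge I| + (2 * vid v + j))) = nth 0 (g v) j.
  move=> ltj; rewrite /enc /encode_instance nth_cat ltnNge leq_addr /= addKn nth_cat.
  rewrite (@size_flatten_blocks _ f 4) // -cardE ltnNge leq_addr /= addKn.
  rewrite (@nth_flatten_blocks _ g 2 _ v) //; last by rewrite -cardE vid_ltn.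
  by rewrite nth_enum_rank.
by split; [rewrite -[RHS]/(nth 0 (g v) 0) | rewrite -[RHS]/(nth 0 (g v) 1)];
  rewrite -H //; congr nth; lia.
Qed.

Definition bits_bound : nat := 2 ^ instance_size I.

Lemma enc_bounded j : nth 0 enc j < bits_bound.
Proof.
case: (ltnP j (size enc)) => [ltj|le]; last by rewrite nth_default // expn_gt0.
apply: leq_trans (bitsize_ltn _) _; rewrite leq_exp2l // /instance_size -/enc.
rewrite (big_nth 0) (big_mkord xpredT (fun i => bitsize (nth 0 enc i))).
by rewrite (bigD1 (Ordinal ltj)) //= leq_addr.
Qed.

Lemma instance_sizeE : instance_size I =
  bitsize #|vert I| + (bitsize #|edge I| + bitsize (vid (root I))) +
  (\sum_(e : edge I) (bitsize (vid (end1 e)) + (bitsize (vid (end2 e)) +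
     (bitsize (en e) + bitsize (ed e)))) +
   \sum_(v : vert I) (bitsize (pz v) + bitsize (pd v))).
Proof.
rewrite /instance_size /encode_instance !big_cat /= !big_cons big_nil addn0.
congr (_ + (_ + _)); rewrite big_flatten big_map big_enum; apply: eq_bigr => x _.
  by rewrite /encode_rat !big_cons big_nil /= addn0.
by rewrite /encode_rat !big_cons big_nil /= addn0.
Qed.

Lemma card_bound : #|edge I| + #|vert I| <= instance_size I.
Proof.
rewrite instance_sizeE -!sum1_card; apply: leq_trans (leq_addl _ _).
by apply: leq_add; apply: leq_sum => x _; rewrite ltnS.
Qed.

Lemma add_lt_exp a b : a + b <= 2 ^ (bitsize a + bitsize b).
Proof.
rewrite expnD; have := bitsize_ltn a; have := bitsize_ltn b.
by move: (2 ^ _) (2 ^ _) => x y; nia.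
Qed.

Lemma prod_prizes_bound : \prod_(v : vert I) (pz v + pd v) <= bits_bound.
Proof.
apply: leq_trans (_ : 2 ^ (\sum_(v : vert I) (bitsize (pz v) + bitsize (pd v))) <= _).
  by rewrite expn_sum; apply: leq_prod => v _; apply: add_lt_exp.
by rewrite leq_exp2l // instance_sizeE addnA leq_addl.
Qed.

Lemma prod_costs_bound : \prod_(e : edge I) (en e + ed e) <= bits_bound.
Proof.
apply: leq_trans (_ : 2 ^ (\sum_(e : edge I) (bitsize (en e) + bitsize (ed e))) <= _).
  by rewrite expn_sum; apply: leq_prod => e _; apply: add_lt_exp.
rewrite leq_exp2l // instance_sizeE.
apply: leq_trans (leq_addl _ _); apply: leq_trans (leq_addr _ _).
by apply: leq_sum => e _; lia.
Qed.

Lemma card_bits_bound : #|edge I| + #|vert I| < bits_bound.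
Proof. exact: leq_ltn_trans card_bound (ltn_expl _ _). Qed.

End Encoding.

(** * Reading the input and orienting the tree *)

Section LoadOrient.
Variables (I : instance rat) (rt : rooting I).

Variables m V : nat.
Hypothesis mE : #|edge I| = m.
Hypothesis VE : bits_bound I = V.
Local Notation enc := (encode_instance I).
Implicit Types (e f : edge I) (v : vert I) (s : state).

Lemma card_vert : #|vert I| = m.+1.
Proof.
have cT : closed rt [set: edge I] by apply/closedP => e f; rewrite !inE.
have := formed_by_vertices cT; rewrite (formed_byT rt) /= => E.
rewrite -cardsT E cardsU1 card_imset; last exact: dn_inj.
rewrite cardsT mE; case: imsetP => // -[e _ Ee].
by have := dn_neq_root rt e; rewrite -Ee eqxx.
Qed.

Lemma size_bound : 2 * m + 1 < V.
Proof. by have := card_bits_bound I; rewrite card_vert mE VE; lia. Qed.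

Lemma vid_leq v : vid v <= m.
Proof. by have := vid_ltn v; rewrite card_vert. Qed.

Lemma eid_ltm e : eid e < m.
Proof. by have := eid_ltn e; rewrite mE. Qed.

Lemma vid_onto' j : j < m + 1 -> exists v, vid v = j.
Proof. by move=> ltj; apply: vid_onto; rewrite card_vert; lia. Qed.

Lemma eid_onto' j : j < m -> exists e, eid e = j.
Proof. by move=> ltj; apply: eid_onto; rewrite mE. Qed.

Lemma enc_le j : nth 0 enc j <= V.
Proof. by rewrite -VE ltnW ?enc_bounded. Qed.

Lemma vid_eq v v' : (vid v == vid v') = (v == v').
Proof. exact: inj_eq (@vid_inj I) _ _. Qed.

Definition input_state s : Prop := forall j, s 0 j = nth 0 enc j.

Definition edges_loaded s : Prop := forall e,
  [/\ s aE1 (eid e) = vid (end1 e), s aE2 (eid e) = vid (end2 e),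
      s aEN (eid e) = en e & s aED (eid e) = ed e].

Definition prizes_loaded s : Prop := forall v,
  [/\ s aPZ (vid v) = pz v, s aPN (vid v) = pz v & s aPD (vid v) = pd v].

Lemma load_edges_ok s : input_state s -> ok m V load_edges s edges_loaded.
Proof.
move=> ins; have mV := size_bound.
apply: (@ok_for _ _ (fun i s' => forall e, eid e < i ->
  [/\ s' aE1 (eid e) = vid (end1 e), s' aE2 (eid e) = vid (end2 e),
      s' aEN (eid e) = en e & s' aED (eid e) = ed e])) => //.
- by lia.
- move=> i s' lti Ei fr Hi; rewrite addn0 in lti; have [e Ee] := eid_onto' lti.
  have in' j : s' 0 j = nth 0 enc j by rewrite fr.
  have [h1 h2 h3 h4] := enc_edge e.
  apply: ok_seq; apply: ok_load => /=; first by rewrite Ei; lia.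
  apply: ok_seq; apply: ok_load => /=; first by rewrite Ei; lia.
  apply: ok_seq; apply: ok_load => /=; first by rewrite Ei; lia.
  apply: ok_load => /=; first by rewrite Ei; lia.
  move=> f ltf; rewrite /= Ei !in' -Ee h1 h2 h3 h4.
  case: eqP => [/eid_inj->//|nfe]; apply: Hi; lia.
- by move=> s' _ H e; apply: H; rewrite addn0 eid_ltm.
Qed.

Lemma load_prizes_ok s : input_state s -> ok m V load_prizes s prizes_loaded.
Proof.
move=> ins; have mV := size_bound.
apply: (@ok_for _ _ (fun i s' => forall v, vid v < i ->
  [/\ s' aPZ (vid v) = pz v, s' aPN (vid v) = pz v & s' aPD (vid v) = pd v])) => //.
- by lia.
- move=> i s' lti Ei fr Hi; have [v Ev] := vid_onto' lti.
  have in' j : s' 0 j = nth 0 enc j by rewrite fr.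
  have [h1 h2] := enc_vert v; rewrite mE in h1 h2.
  apply: ok_seq; apply: ok_load => /=; first by rewrite Ei; lia.
  apply: ok_seq; apply: ok_load => /=; first by rewrite Ei; lia.
  apply: ok_set => /=; first by rewrite eqxx in' enc_le.
  move=> w ltw; rewrite /= Ei !in' -Ev h1 h2 eqxx.
  case: eqP => [/vid_inj->//|nwv]; apply: Hi; lia.
- by move=> s' _ H v; apply: H; have := vid_leq v; lia.
Qed.

Record loaded s : Prop := Loaded {
  ld_root : s aROOT 0 = vid (root I);
  ld_edges : edges_loaded s;
  ld_prizes : prizes_loaded s;
  ld_zero : forall a i, aCN <= a -> s a i = 0
}.

Lemma load_ok s : input_state s -> (forall a i, 0 < a -> s a i = 0) ->
  ok m V load_prog s loaded.
Proof.
move=> ins s0; apply: ok_seq; apply: ok_load => /=; first by lia.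
apply: ok_seq; apply: ok_conseq (load_edges_ok _) _; first by move=> j /=; apply: ins.
move=> s1 fr1 he; apply: ok_conseq (load_prizes_ok _) _.
  by move=> j; rewrite fr1 //= ins.
move=> s2 fr2 hp; split=> //.
- by rewrite fr2 // fr1 //= ?eqxx ins.
- by move=> e; rewrite !fr2 //; apply: he.
- move=> a i lea; rewrite fr2 ?fr1 /=; last 2 first.
  + by rewrite !inE; lia.
  + by rewrite !inE; lia.
  by case: a lea => [|[|[|[|a]]]] //= _; apply: s0.
Qed.

Definition visited s v : bool := s aVIS (vid v) != 0.

Record oriented s : Prop := Oriented {
  or_root : visited s (root I);
  or_up : forall e, visited s (dn rt e) -> visited s (up rt e);
  or_pe : forall e, visited s (dn rt e) -> s aPE (vid (dn rt e)) = eid e;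
  or_pv : forall e, visited s (dn rt e) -> s aPV (vid (dn rt e)) = vid (up rt e);
  or_cn : forall e, visited s (dn rt e) -> s aCN (vid (dn rt e)) = en e;
  or_cd : forall e, visited s (dn rt e) -> s aCD (vid (dn rt e)) = ed e;
  or_cn0 : s aCN (vid (root I)) = 0;
  or_cd0 : s aCD (vid (root I)) = 0
}.

Lemma visit_ok s e (a b : vert I) (xa xb : aexpr) :
  edges_loaded s -> oriented s -> s aJ 0 = eid e ->
  (forall s', (forall c i, c \in [:: aJ; aE1; aE2] -> s' c i = s c i) ->
     aeval m s' xa = vid a /\ aeval m s' xb = vid b) ->
  a = up rt e /\ b = dn rt e \/ a = dn rt e /\ b = up rt e ->
  ok m V (visit xa xb) s (fun s' => oriented s' /\
    (forall v, visited s v -> visited s' v) /\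
    (a = up rt e -> visited s a -> visited s' (dn rt e))).
Proof.
move=> ld os Ej Ex ends; have mV := size_bound.
have ex s' : (forall c i, c \in [:: aJ; aE1; aE2] -> s' c i = s c i) -> aeval m s' xa = vid a.
  by case/Ex.
have ex' s' : (forall c i, c \in [:: aJ; aE1; aE2] -> s' c i = s c i) -> aeval m s' xb = vid b.
  by case/Ex.
apply: ok_if => /=; rewrite (ex s) // (ex' s) // => cond; last first.
  apply: ok_set => //=; split; last split.
  - by case: os => *; split.
  - by [].
  - move=> Ea va; have Eb : b = dn rt e.
      case: ends => -[// Ea' Eb]; have := dn_neq_root rt e => _.
      have := anc_up rt e; rewrite -Ea Ea' -/(lineage rt e) mem_lineage //.
    by move: cond va; rewrite /visited /= Eb; case: (s aVIS (vid a)); case: (s aVIS (vid (dn rt e))) => //; lia.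
have [va vb] : visited s a /\ ~~ visited s b.
  by move: cond; rewrite /visited; case: (s aVIS (vid a)); case: (s aVIS (vid b)) => //; lia.
have [Ea Eb] : a = up rt e /\ b = dn rt e.
  case: ends => -[Ea Eb] //; case/negP: vb; rewrite Eb; apply: (or_up os).
  by rewrite -Ea.
have nb v : visited s v -> (vid v == vid b) = false.
  by rewrite vid_eq => vv; apply: contraNF vb => /eqP <-.
have nroot : (vid (root I) == vid b) = false by apply: nb (or_root os).
have [_ _ l3 l4] := ld e.
have [h1 h2 h3 h4] := enc_edge e.
apply: ok_seq; apply: ok_set => /=; first by lia.
rewrite (ex' s) //; apply: ok_seq; apply: ok_set => /=; first by rewrite Ej; have := eid_ltm e; lia.
rewrite ex'; last by move=> c i; rewrite !inE => /or3P[] /eqP->.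
apply: ok_seq; apply: ok_set => /=.
  rewrite ex; last by move=> c i; rewrite !inE => /or3P[] /eqP->.
  by have := vid_leq a; lia.
rewrite ex' ?ex; try by move=> c i; rewrite !inE => /or3P[] /eqP->.
apply: ok_seq; apply: ok_set => /=.
  by rewrite Ej l3 -h3 enc_le.
rewrite ex'; last by move=> c i; rewrite !inE => /or3P[] /eqP->.
apply: ok_set => /=.
  by rewrite Ej l4 -h4 enc_le.
rewrite ex'; last by move=> c i; rewrite !inE => /or3P[] /eqP->.
set s' := upd _ aCD _ _.
have vE v : visited s' v = (v == b) || visited s v.
  by rewrite /visited /s' /= vid_eq; case: (v == b).
have dnE f : (vid (dn rt f) == vid b) = (f == e).
  by rewrite Eb vid_eq (inj_eq (@dn_inj _ _ rt)).
split; last split.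
- split.
  + by rewrite vE (or_root os) orbT.
  + move=> f; rewrite !vE Eb (inj_eq (@dn_inj _ _ rt)) => /orP[/eqP->|/(or_up os)->].
      by rewrite -Ea va orbT.
    by rewrite orbT.
  + move=> f; rewrite vE -vid_eq dnE /s' /= dnE; case: eqP => [-> _|_]; first exact: Ej.
    exact: or_pe os f.
  + move=> f; rewrite vE -vid_eq dnE /s' /= dnE; case: eqP => [-> _|_]; first by rewrite Ea.
    exact: or_pv os f.
  + move=> f; rewrite vE -vid_eq dnE /s' /= dnE; case: eqP => [-> _|_]; first by rewrite Ej l3.
    exact: or_cn os f.
  + move=> f; rewrite vE -vid_eq dnE /s' /= dnE; case: eqP => [-> _|_]; first by rewrite Ej l4.
    exact: or_cd os f.
  + by rewrite /s' /= nroot (or_cn0 os).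
  + by rewrite /s' /= nroot (or_cd0 os).
- by move=> v vv; rewrite vE vv orbT.
- by move=> _ _; rewrite vE Eb eqxx.
Qed.

Definition oriented_all s : Prop := forall e,
  [/\ s aPE (vid (dn rt e)) = eid e, s aPV (vid (dn rt e)) = vid (up rt e),
      s aCN (vid (dn rt e)) = en e & s aCD (vid (dn rt e)) = ed e].

Lemma orient_ok s : loaded s ->
  ok m V orient_prog s (fun s' =>
    [/\ oriented_all s', s' aCN (vid (root I)) = 0 & s' aCD (vid (root I)) = 0]).
Proof.
move=> ld; have mV := size_bound.
have ends e : end1 e = up rt e /\ end2 e = dn rt e \/ end1 e = dn rt e /\ end2 e = up rt e.
  by have := joins_up_dn rt e; case/orP=> /andP[/eqP-> /eqP->]; [left | right].
apply: ok_seq; apply: ok_set => /=; first by lia.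
rewrite (ld_root ld).
have os0 : oriented (upd s aVIS (vid (root I)) 1).
  have nv e : visited (upd s aVIS (vid (root I)) 1) (dn rt e) = false.
    by rewrite /visited /= vid_eq (negPf (dn_neq_root rt e)) (ld_zero ld).
  split; try (by move=> e; rewrite nv); rewrite /visited /= ?eqxx ?(ld_zero ld) //.
apply: (@ok_for _ _ (fun r s' => oriented s' /\
  (forall v, #|anc rt v| <= r -> visited s' v))) => //.
- by lia.
- split; first by case: os0; split.
  move=> v; rewrite leqn0 cards_eq0 => /eqP v0.
  case: (eqVneq v (root I)) => [->|/(dn_onto rt)[e Ee]]; first by rewrite /visited /= eqxx.
  by have := mem_lineage rt e; rewrite /lineage -Ee v0 inE.
- move=> r s1 ltr Er fr1 [os1 dep1].
  have ld1 : edges_loaded s1.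
    by move=> e; rewrite !fr1 //=; apply: (ld_edges ld).
  apply: (@ok_for _ _ (fun j s' => [/\ oriented s',
    forall v, #|anc rt v| <= r -> visited s' v &
    forall e, eid e < j -> #|lineage rt e| <= r.+1 -> visited s' (dn rt e)])) => //.
  + by lia.
  + by split=> //; case: os1; split.
  + move=> j s2 ltj Ej fr2 [os2 dep2 vis2].
    rewrite addn0 in ltj; have [e Ee] := eid_onto' ltj.
    have ld2 : edges_loaded s2 by move=> f; rewrite !fr2 //; apply: ld1.
    have [l1 l2 _ _] := ld2 e.
    have Ej2 : s2 aJ 0 = eid e by rewrite Ej Ee.
    apply: ok_seq.
    apply: ok_conseq (@visit_ok s2 e (end1 e) (end2 e) _ _ ld2 os2 Ej2 _ _) _.
    * move=> s' H; rewrite /= !(H aJ) ?(H aE1) ?(H aE2) ?inE //.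
      by rewrite Ej2 l1 l2.
    * by have [[]|[]] := ends e; [left | right].
    move=> s3 fr3 [os3 [mono3 new3]].
    have ld3 : edges_loaded s3 by move=> f; rewrite !fr3 //; apply: ld2.
    have Ej3 : s3 aJ 0 = eid e by rewrite fr3.
    apply: ok_conseq (@visit_ok s3 e (end2 e) (end1 e) _ _ ld3 os3 Ej3 _ _) _.
    * move=> s' H; rewrite /= !(H aJ) ?(H aE1) ?(H aE2) ?inE //.
      by have [l31 l32 _ _] := ld3 e; rewrite Ej3 l31 l32.
    * by have [[]|[]] := ends e; [right | left].
    move=> s4 fr4 [os4 [mono4 new4]]; split.
    * by case: os4; split.
    * by move=> v /dep2 /mono3 /mono4.
    move=> f; rewrite ltnS leq_eqVlt => /orP[/eqP Ef le|ltf le]; last first.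
      by apply: mono4; apply: mono3; apply: vis2.
    have {}Ef : f = e by apply: (@eid_inj I); rewrite Ef Ee.
    have vup : visited s2 (up rt e).
      by apply: dep2; move: le; rewrite Ef /lineage anc_dn cardsU1 anc_up.
    rewrite Ef /=; have [[E1 E2]|[E1 E2]] := ends e.
      by apply: mono4; apply: new3; rewrite E1.
    by apply: new4; rewrite E2 //; apply: mono3.
  move=> s2 fr2 [os2 dep2 vis2]; split; first by case: os2; split.
  move=> v; rewrite leq_eqVlt => /orP[/eqP Ev|]; last by rewrite ltnS => /dep2.
  case: (eqVneq v (root I)) => [->|/(dn_onto rt)[e Ee]]; first exact: or_root os2.
  rewrite Ee; apply: vis2; first by rewrite addn0 eid_ltm.
  by rewrite /lineage -Ee Ev.
move=> s1 _ [os1 dep1].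
have all v : visited s1 v by apply: dep1; rewrite addn0 -mE max_card.
split; [|exact: or_cn0 os1|exact: or_cd0 os1].
by move=> e; case: os1 => _ _ h1 h2 h3 h4 _ _; split; auto.
Qed.

End LoadOrient.

(** * Computing the merge order *)

Lemma absz_numq (x : rat) : (0 <= x)%R -> (`|numq x|%N%:R = x * `|denq x|%N%:R :> rat)%R.
Proof.
move=> x0; rewrite !natr_absz !ger0_norm ?numq_ge0 ?denq_ge0 //.
exact: numqE.
Qed.

Lemma leq_prod_sub (T : finType) (P Q : pred T) (F : T -> nat) :
  (forall x, P x -> Q x) -> (forall x, 0 < F x) ->
  \prod_(x | P x) F x <= \prod_(x | Q x) F x.
Proof.
move=> PQ F0; rewrite [leqRHS](bigID P) /= -[leqLHS]muln1.
rewrite (eq_bigl P) => [|x]; last by rewrite andbC; case: (boolP (P x)) => // /PQ.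
by rewrite leq_mul2l prodn_gt0 ?orbT // => x.
Qed.

Section MergePhase.
Variables (I : instance rat) (rt : rooting I).
Variables m V : nat.
Hypothesis mE : #|edge I| = m.
Hypothesis VE : bits_bound I = V.
Implicit Types (e f u v : edge I) (x : vert I) (s : state) (M : {set edge I}).

Local Notation vd e := (vid (dn rt e)).
Local Notation grp M u := (group rt M u).

Let mV : 2 * m + 1 < V := size_bound rt mE VE.

Lemma vd_eq e f : (vd e == vd f) = (e == f).
Proof. by rewrite (inj_eq (@vid_inj I)) (inj_eq (@dn_inj _ _ rt)). Qed.

Lemma vd_root e : (vd e == vid (root I)) = false.
Proof. by rewrite (inj_eq (@vid_inj I)) (negPf (dn_neq_root rt e)). Qed.

Lemma root_vd e : (vid (root I) == vd e) = false.
Proof. by rewrite eq_sym vd_root. Qed.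

Definition prize_prod (S : {set edge I}) : nat :=
  \prod_(e in S) (pz (dn rt e) + pd (dn rt e)).
Definition cost_prod (S : {set edge I}) : nat := \prod_(e in S) (en e + ed e).

Lemma pd_gt0 (v : vert I) : 0 < pd v.
Proof. by rewrite absz_gt0 denq_neq0. Qed.

Lemma ed_gt0 e : 0 < ed e.
Proof. by rewrite absz_gt0 denq_neq0. Qed.

Lemma prize_prod_le (S : {set edge I}) : prize_prod S <= V.
Proof.
rewrite -VE; apply: leq_trans (prod_prizes_bound I).
rewrite /prize_prod -(big_imset (fun x => pz x + pd x) (h := dn rt)) /=; last first.
  by move=> e f _ _; apply: dn_inj.
by apply: leq_prod_sub => // x; rewrite addn_gt0 pd_gt0 orbT.
Qed.

Lemma cost_prod_le (S : {set edge I}) : cost_prod S <= V.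
Proof.
rewrite -VE; apply: leq_trans (prod_costs_bound I).
by apply: leq_prod_sub => // e; rewrite addn_gt0 ed_gt0 orbT.
Qed.

Lemma prize_prodU (S T : {set edge I}) : [disjoint S & T] ->
  prize_prod (S :|: T) = prize_prod S * prize_prod T.
Proof.
by move=> dST; rewrite /prize_prod -bigU //; apply: eq_bigl => e; rewrite !inE.
Qed.

Lemma cost_prodU (S T : {set edge I}) : [disjoint S & T] ->
  cost_prod (S :|: T) = cost_prod S * cost_prod T.
Proof.
by move=> dST; rewrite /cost_prod -bigU //; apply: eq_bigl => e; rewrite !inE.
Qed.

Record group_data (s : state) (i : nat) (S : {set edge I}) : Prop := GroupData {
  gd_pd : 0 < s aPD i;
  gd_cd : 0 < s aCD i;
  gd_pn : ((s aPN i)%:R = wt rt S * (s aPD i)%:R)%R;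
  gd_cn : ((s aCN i)%:R = ct S * (s aCD i)%:R)%R;
  gd_pb : s aPN i + s aPD i <= prize_prod S;
  gd_cb : s aCN i + s aCD i <= cost_prod S
}.

Record merged M s : Prop := Merged {
  mg_root : s aMRG (vid (root I)) != 0;
  mg_in : forall e, (s aMRG (vd e) != 0) = (e \in M);
  mg_rep : forall x u, leader rt M x u -> s aREP (vid x) = vd u;
  mg_rep0 : forall x, anc rt x \subset M -> s aREP (vid x) = vid (root I);
  mg_data : forall u, u \notin M -> group_data s (vd u) (grp M u);
  mg_zero : [/\ s aPN (vid (root I)) = 0, s aPD (vid (root I)) = 0,
                s aCN (vid (root I)) = 0 & s aCD (vid (root I)) = 0]
}.

Definition dens M u : rat := (wt rt (grp M u) / ct (grp M u))%R.

Lemma group_ct_gt0 M u : u \notin M -> (0 < ct (grp M u))%R.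
Proof. by move=> uM; apply: (@ct_gt0 _ _ _ u); apply: mem_group. Qed.

Lemma dens_le M u v : u \notin M -> v \notin M ->
  (dens M u <= dens M v)%R = (wt rt (grp M u) * ct (grp M v) <= wt rt (grp M v) * ct (grp M u))%R.
Proof.
move=> uM vM; rewrite ler_pdivrMr ?group_ct_gt0 // mulrAC ler_pdivlMr ?group_ct_gt0 //.
Qed.

Lemma dens_cmp M s u v : u \notin M -> v \notin M ->
  group_data s (vd u) (grp M u) -> group_data s (vd v) (grp M v) ->
  (s aPN (vd u) * s aCD (vd u) * (s aCN (vd v) * s aPD (vd v)) <=
   s aPN (vd v) * s aCD (vd v) * (s aCN (vd u) * s aPD (vd u))) = (dens M u <= dens M v)%R.
Proof.
move=> uM vM [pu cu pnu cnu _ _] [pv cv pnv cnv _ _].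
rewrite dens_le // -(ler_nat rat) !natrM pnu pnv cnu cnv.
set a := wt rt _; set b := wt rt _; set c := ct _; set d := ct _.
set x := (s aPD (vd u))%:R%R; set y := (s aCD (vd u))%:R%R.
set z := (s aPD (vd v))%:R%R; set w := (s aCD (vd v))%:R%R.
have K0 : (0 < x * y * z * w)%R by rewrite !mulr_gt0 ?ltr0n.
rewrite -[RHS](ler_pM2r K0).
by congr (_ <= _)%R; ring.
Qed.

Lemma select_densest_ok M s : merged M s -> s aSEL 0 = 0 -> (exists e, e \notin M) ->
  ok m V select_densest s (fun s' => exists2 v, densest_group rt M v & s' aSEL 0 = (vd v).+1).
Proof.
move=> ms sel0 [e0 e0M]; have [mr mi _ _ md _] := ms.
apply: (@ok_for _ _ (fun j s' =>
  (s' aSEL 0 = 0 /\ forall e, vd e < j -> e \in M) \/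
  exists b, [/\ b \notin M, s' aSEL 0 = (vd b).+1 &
    forall e, e \notin M -> vd e < j -> (dens M e <= dens M b)%R])) => //.
- by lia.
- by left.
- move=> j s' ltj Ej fr Hj; have [x Ex] := vid_onto' rt mE VE ltj.
  have frE i := (fr aMRG i isT, fr aPN i isT, fr aPD i isT, fr aCN i isT, fr aCD i isT).
  case: (eqVneq x (root I)) => [xr|/(dn_onto rt)[e xe]].
    apply: ok_if => /=; rewrite Ej !frE -Ex xr.
      by case: (s aMRG _) mr => // k _; rewrite subn_eq0.
    move=> _; apply: ok_set => //=.
    case: Hj => [[E H]|[b [bM E H]]]; [left | right; exists b]; split=> //.
      by move=> f; rewrite ltnS leq_eqVlt vd_root -xr Ex => /H.
    by move=> f fM; rewrite ltnS leq_eqVlt vd_root -xr Ex => /(H f fM).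
  have Ee : vd e = j by rewrite -xe.
  have nlt f : vd f < (vd e).+1 -> f = e \/ vd f < j.
    by rewrite ltnS leq_eqVlt vd_eq Ee => /orP[/eqP|]; [left | right].
  apply: ok_if => /=; rewrite Ej !frE -Ee => cond.
    have eM : e \notin M.
      by rewrite -mi; move: cond; case: (s aMRG _).
    apply: ok_set; first by rewrite /= Ej; lia.
    right; exists e; split=> //=; first by rewrite ?eqxx Ej -Ee addn1.
    move=> f fM /nlt[->//|ltf].
    case: Hj => [[E H]|[b [bM E H]]]; first by rewrite (H f ltf) in fM.
    apply: le_trans (H f fM ltf) _.
    move: cond; rewrite E subn1 /= => cond.
    apply: ltW; rewrite ltNge -(dens_cmp eM bM (md _ eM) (md _ bM)); apply/negP.
    by rewrite -subn_eq0 => /eqP E0; move: cond; rewrite E0 muln0.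
  apply: ok_set => //=.
  case: (boolP (e \in M)) => eM.
    case: Hj => [[E H]|[b [bM E H]]]; [left | right; exists b]; split=> //.
      by move=> f /nlt[->|/H].
    by move=> f fM /nlt[E'|/(H f fM)//]; rewrite E' eM in fM.
  have sM : s aMRG (vd e) = 0.
    by apply/eqP; rewrite -[_ == 0]negbK mi eM.
  case: Hj => [[E _]|[b [bM E H]]].
    by move: cond; rewrite sM E.
  right; exists b; split=> // f fM /nlt[->|/(H f fM)//].
  move: cond; rewrite sM E subn1 /= mul1n => /eqP.
  rewrite -(dens_cmp eM bM (md _ eM) (md _ bM)) -subn_eq0.
  by rewrite addn_eq0 => /andP[].
move=> s' fr [[_ H]|[b [bM E H]]].
  by rewrite (H e0) in e0M; last by have := vid_leq rt mE (dn rt e0); lia.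
exists b => //; split=> // u uM; rewrite -dens_le // H //.
by have := vid_leq rt mE (dn rt u); lia.
Qed.

Lemma combine_ok s (t u : nat) : s aTMP 0 = t -> s aU 0 = u ->
  (s aPN u + s aPD u) * (s aPN t + s aPD t) <= V ->
  (s aCN u + s aCD u) * (s aCN t + s aCD t) <= V -> t != u ->
  ok m V combine s (fun s' =>
    [/\ s' aPN u = s aPN u * s aPD t + s aPN t * s aPD u,
        s' aPD u = s aPD u * s aPD t,
        s' aCN u = s aCN u * s aCD t + s aCN t * s aCD u,
        s' aCD u = s aCD u * s aCD t &
        forall a i, i != u -> s' a i = s a i]).
Proof.
move=> Et Eu bp bc ntu; have nut := negPf ntu.
apply: ok_seq; apply: ok_set => /=; rewrite Et Eu; first by nia.
apply: ok_seq; apply: ok_set => /=; rewrite Et Eu; first by nia.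
apply: ok_seq; apply: ok_set => /=; rewrite Et Eu; first by nia.
apply: ok_set => /=; rewrite Et Eu; first by nia.
rewrite !eqxx; split=> //= a i niu; rewrite (negPf niu).
by do 4 (case: (Nat.eqb a _) => //).
Qed.

Lemma relabel_ok s (t u : nat) : s aTMP 0 = t -> s aU 0 = u -> u <= m ->
  ok m V relabel s (fun s' => forall x,
    s' aREP (vid x) = if s aREP (vid x) == t then u else s aREP (vid x)).
Proof.
move=> Et Eu um.
apply: (@ok_for _ _ (fun j s' => forall x, s' aREP (vid x) =
  if (vid x < j) && (s aREP (vid x) == t) then u else s aREP (vid x))) => //.
- by lia.
- move=> j s' ltj Ej fr Hj; have [x Ex] := vid_onto' rt mE VE ltj.
  have Et' : s' aU 0 = u by rewrite fr.
  have ltx y : vid y < j.+1 = (vid y == j) || (vid y < j) by rewrite ltnS leq_eqVlt.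
  have Hx : s' aREP j = s aREP j by rewrite -Ex Hj Ex ltnn.
  have testE : (1 - (s aREP j - t + (t - s aREP j)) != 0) = (s aREP j == t) by lia.
  apply: ok_if => /=; rewrite Ej Hx (fr aTMP 0 isT) Et.
    rewrite testE => /eqP E; apply: ok_set => /=; rewrite Et' //.
      by lia.
    move=> y; rewrite /= Ej ltx; case: (eqVneq (vid y) j) => [Ey|_] /=; last exact: Hj.
    by rewrite Ey E eqxx.
  move=> cond; apply: ok_set => //= y; rewrite ltx.
  have nE : (s aREP j == t) = false by rewrite -testE cond.
  by rewrite Hj; case: (eqVneq (vid y) j) => [->|//]; rewrite nE !andbF.
move=> s' _ H x; rewrite H; case: ltnP => // le.
by have := vid_leq rt mE x; lia.
Qed.

Lemma group_data_congr s s' i i' (S S' : {set edge I}) :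
  (forall a, a \in [:: aPN; aPD; aCN; aCD] -> s' a i' = s a i) -> S = S' ->
  group_data s i S -> group_data s' i' S'.
Proof.
move=> H <- [h1 h2 h3 h4 h5 h6].
by split; rewrite ?(H aPN) ?(H aPD) ?(H aCN) ?(H aCD).
Qed.

Lemma merged_congr M s s' :
  (forall a i, a \in [:: aMRG; aREP; aPN; aPD; aCN; aCD] -> s' a i = s a i) ->
  merged M s -> merged M s'.
Proof.
move=> H [h1 h2 h3 h4 h5 [z1 z2 z3 z4]].
split; rewrite ?H //.
- by move=> e; rewrite H.
- by move=> x u lu; rewrite H //; apply: h3.
- by move=> x sx; rewrite H // h4.
- move=> u uM; apply: group_data_congr (h5 u uM) => // a.
  by rewrite !inE => /or4P[] /eqP->; rewrite H.
Qed.

Definition parents s : Prop := forall e,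
  s aPE (vd e) = eid e /\ s aPV (vd e) = vid (up rt e).

Lemma merge_body_ok M s i : merged M s -> parents s -> s aI 0 = i -> i < m ->
  (exists e, e \notin M) ->
  ok m V merge_body s (fun s' => exists2 v, densest_group rt M v &
    [/\ merged (v |: M) s', s' aRK i = vd v & forall k, k != i -> s' aRK k = s aRK k]).
Proof.
move=> ms os Ei lti exM.
apply: ok_seq; apply: ok_set => //=.
apply: ok_seq; apply: ok_conseq (@select_densest_ok M _ _ _ exM) _.
- apply: merged_congr ms => a k; rewrite !inE; do 5 (case/orP; first by move/eqP->).
  by move/eqP->.
- by [].
move=> s1 fr1 [v dv sel1]; have [vM _] := dv.
have fr a k : a \notin [:: aSEL; aSKIP; aJ] -> s1 a k = s a k.
  rewrite !inE !negb_or => /and3P[n1 n2 n3]; rewrite fr1 /=.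
    by rewrite eqbE (negPf n1).
  by rewrite !inE !negb_or n1 n2 n3.
have [_ hpv] := os v.
have [mr mi mrep mrep0 md mz] := ms.
apply: ok_seq; apply: ok_set => /=; rewrite sel1 subn1 /=.
  by have := vid_leq rt mE (dn rt v); lia.
have [u [uE um uv]] : exists u : nat, [/\ s aREP (vid (up rt v)) = u, u <= m & vd v != u].
  exists (s aREP (vid (up rt v))); split=> //.
    case: (leader_exists rt M (up rt v)) => [[w lw]|sM].
      by rewrite (mrep _ _ lw) (vid_leq rt mE).
    by rewrite mrep0 // (vid_leq rt mE).
  case: (leader_exists rt M (up rt v)) => [[w lw]|sM]; last by rewrite mrep0 // vd_root.
  rewrite (mrep _ _ lw) vd_eq; have /leaderP[wv _ _] := lw.
  by apply: contraTneq wv => <-; apply: anc_up.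
apply: ok_seq; apply: ok_set => /=; rewrite fr // fr // hpv uE; first by lia.
apply: ok_seq; apply: ok_set => /=.
  by have := vid_leq rt mE (dn rt v); lia.
rewrite fr // Ei.
apply: ok_seq; apply: ok_set => /=; first by lia.
set s2 := upd _ aMRG _ _.
have fr2 a k : a \notin [:: aSEL; aSKIP; aJ; aTMP; aU; aRK; aMRG] -> s2 a k = s a k.
  rewrite !inE !negb_or => /and5P[n1 n2 n3 n4 /and3P[n5 n6 n7]].
  rewrite /s2 /= !eqbE (negPf n4) (negPf n5) (negPf n6) (negPf n7) fr //.
  by rewrite !inE !negb_or n1 n2 n3.
have dv' := md v vM.
have data_u w : leader rt M (up rt v) w -> group_data s u (grp M w) /\ w \notin M.
  move=> lw; have /leaderP[_ wM _] := lw.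
  by split=> //; have := md w wM; rewrite -uE (mrep _ _ lw).
have u_cases : (exists w, leader rt M (up rt v) w /\ u = vd w) \/
    (anc rt (up rt v) \subset M /\ u = vid (root I)).
  case: (leader_exists rt M (up rt v)) => [[w lw]|sM]; [left|right].
    by exists w; split=> //; rewrite -uE (mrep _ _ lw).
  by split=> //; rewrite -uE mrep0.
have dis w : leader rt M (up rt v) w -> [disjoint grp M w & grp M v].
  move=> lw; apply: group_disjoint; have /leaderP[wv _ _] := lw.
  by apply: contraTneq wv => ->; apply: anc_up.
have bp : (s aPN u + s aPD u) * (s aPN (vd v) + s aPD (vd v)) <= V.
  case: u_cases => [[w [lw _]]|[_ ->]]; last by have [-> -> _ _] := mz.
  have [dw _] := data_u w lw; apply: leq_trans (leq_mul (gd_pb dw) (gd_pb dv')) _.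
  by rewrite -prize_prodU ?prize_prod_le // dis.
have bc : (s aCN u + s aCD u) * (s aCN (vd v) + s aCD (vd v)) <= V.
  case: u_cases => [[w [lw _]]|[_ ->]]; last by have [_ _ -> ->] := mz.
  have [dw _] := data_u w lw; apply: leq_trans (leq_mul (gd_cb dw) (gd_cb dv')) _.
  by rewrite -cost_prodU ?cost_prod_le // dis.
have t2 : s2 aTMP 0 = vd v by [].
have u2 : s2 aU 0 = u by [].
have bp2 : (s2 aPN u + s2 aPD u) * (s2 aPN (vd v) + s2 aPD (vd v)) <= V by rewrite !fr2.
have bc2 : (s2 aCN u + s2 aCD u) * (s2 aCN (vd v) + s2 aCD (vd v)) <= V by rewrite !fr2.
apply: ok_seq; apply: ok_conseq (combine_ok t2 u2 bp2 bc2 uv) _.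
move=> s3 fr3 [pn3 pd3 cn3 cd3 oth3].
have t3 : s3 aTMP 0 = vd v by rewrite fr3.
have u3 : s3 aU 0 = u by rewrite fr3.
apply: ok_conseq (relabel_ok t3 u3 um) _.
move=> s4 fr4 rep4; exists v => //.
have mrg4 k : s4 aMRG k = if k == vd v then 1 else s aMRG k.
  by rewrite fr4 // fr3 // /s2 /= fr.
have arr4 a k : a \in [:: aPN; aPD; aCN; aCD] -> k != u -> s4 a k = s a k.
  move=> ina nku; rewrite fr4; last by move: ina; rewrite !inE => /or4P[] /eqP->.
  by rewrite oth3 // fr2 //; move: ina; rewrite !inE => /or4P[] /eqP->.
have rep4' x : s4 aREP (vid x) = if s aREP (vid x) == vd v then u else s aREP (vid x).
  by rewrite rep4 fr3 // fr2.
have rk4 k : s4 aRK k = if k == i then vd v else s aRK k.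
  by rewrite fr4 // fr3 // /s2 /= fr.
split; [split | by rewrite rk4 eqxx | by move=> k /negPf nk; rewrite rk4 nk].
- by rewrite mrg4 root_vd.
- by move=> e; rewrite mrg4 vd_eq in_setU1; case: (e == v) => //=; apply: mi.
- move=> x w lw; rewrite rep4'.
  case: (leader_exists rt M x) => [[w0 lw0]|sM]; last first.
    by case: (leader_notin lw); apply: subset_trans sM (subsetUr _ _).
  rewrite (mrep _ _ lw0) vd_eq; case: eqP => [E|/eqP nE]; last first.
    by rewrite (leader_inj lw (leader_other nE lw0)).
  rewrite E in lw0; case: u_cases => [[w1 [lw1 ->]]|[sM _]].
    by rewrite (leader_inj lw (leader_merge vM lw0 lw1)).
  by case: (leader_notin lw); apply: leader_merge_root lw0 sM.
- move=> x sx; rewrite rep4'.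
  case: (leader_exists rt M x) => [[w0 lw0]|sM]; last by rewrite mrep0 // root_vd.
  rewrite (mrep _ _ lw0) vd_eq; case: eqP => [E|/eqP nE]; last first.
    by case: (leader_notin (leader_other nE lw0)).
  rewrite E in lw0; case: u_cases => [[w1 [lw1 _]]|[_ ->] //].
  by case: (leader_notin (leader_merge vM lw0 lw1)).
- move=> w; rewrite in_setU1 negb_or => /andP[nwv wM].
  case: (boolP (leader rt M (up rt v) w)) => lw.
    have uw : u = vd w by rewrite -uE (mrep _ _ lw).
    have [dw _] := data_u w lw; rewrite group_merge // -uw.
    have [a1 a2 a3 a4 a5 a6] := dw; have [b1 b2 b3 b4 b5 b6] := dv'.
    split; rewrite !fr4 // ?pn3 ?pd3 ?cn3 ?cd3 !fr2 //.
    + by rewrite muln_gt0 a1.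
    + by rewrite muln_gt0 a2.
    + by rewrite wtU ?dis // natrD !natrM a3 b3; ring.
    + by rewrite ctU ?dis // natrD !natrM a4 b4; ring.
    + by rewrite prize_prodU ?dis //; apply: leq_trans (leq_mul a5 b5); nia.
    + by rewrite cost_prodU ?dis //; apply: leq_trans (leq_mul a6 b6); nia.
  have nwu : vd w != u.
    case: u_cases => [[w1 [lw1 ->]]|[_ ->]]; last by rewrite vd_root.
    by rewrite vd_eq; apply: contraNneq lw => ->.
  apply: group_data_congr (md w wM); last by rewrite group_other.
  by move=> a ina; apply: arr4.
- have [z1 z2 z3 z4] := mz.
  case: (eqVneq (vid (root I)) u) => [E|nE]; last by rewrite !arr4 // z1 z2 z3 z4.
  rewrite E in z1 z2 z3 z4 *; rewrite !fr4 // pn3 pd3 cn3 cd3 !fr2 //.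
  by rewrite z1 z2 z3 z4 !muln0.
Qed.

End MergePhase.

(** * Computing the greedy order *)

Section Phases.
Variables (I : instance rat) (rt : rooting I).
Variables m V : nat.
Hypothesis mE : #|edge I| = m.
Hypothesis VE : bits_bound I = V.
Implicit Types (e f u v : edge I) (x : vert I) (s : state) (M : {set edge I}).

Local Notation vd e := (vid (dn rt e)).
Local Notation D := (topdens rt).

Let mV : 2 * m + 1 < V := size_bound rt mE VE.

Record prepared s : Prop := Prepared {
  pr_root : s aROOT 0 = vid (root I);
  pr_oriented : oriented_all rt s;
  pr_prizes : prizes_loaded I s;
  pr_cn0 : s aCN (vid (root I)) = 0;
  pr_cd0 : s aCD (vid (root I)) = 0;
  pr_mrg : forall i, s aMRG i = 0;
  pr_cho : forall i, s aCHO i = 0;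
  pr_len : s aLEN 0 = 0
}.

Lemma full_seq (sg : seq (edge I)) : uniq sg -> size sg = m -> forall e, e \in sg.
Proof.
move=> un sz e; apply: contraT => esg.
have /card_uniqP E : uniq (e :: sg) by rewrite /= esg un.
by have := max_card [in e :: sg]; rewrite E /= sz mE ltnn.
Qed.

Lemma leader0 x u : leader rt set0 x u -> x = dn rt u.
Proof.
move=> /leaderP[ux _ H].
case: (eqVneq x (root I)) => [xr|/(dn_onto rt)[e xe]].
  by move: ux; rewrite xr anc_root inE.
have [||<-//|] := H e; last by rewrite inE.
  by rewrite xe; apply: mem_lineage.
by move: ux; rewrite xe.
Qed.

Lemma anc_sub0 x : anc rt x \subset set0 -> x = root I.
Proof.
move=> /subsetP sx; case: (eqVneq x (root I)) => [//|/(dn_onto rt)[e xe]].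
by have := sx e; rewrite inE xe => /(_ (mem_lineage rt e)).
Qed.

Lemma merge_init_ok s : prepared s -> ok m V merge_init s (merged rt set0).
Proof.
move=> ps; have [pr po pp pcn pcd pm _ _] := ps.
apply: ok_seq; apply: ok_set => /=; first by lia.
rewrite pr; apply: ok_seq; apply: ok_set => //=; rewrite pr.
apply: ok_seq; apply: ok_set => //=; rewrite pr.
set s1 := upd _ aPD _ _.
apply: (@ok_for _ _ (fun j s' => forall i, i < j -> s' aREP i = i)) => //.
- by lia.
- move=> j s' ltj Ej fr Hj; apply: ok_set => /=; first by rewrite Ej; lia.
  move=> i /=; rewrite ltnS leq_eqVlt Ej.
  by case: (eqVneq i j) => [->|_] //=; apply: Hj.
move=> s' fr rep.
have repx x : s' aREP (vid x) = vid x.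
  by apply: rep; have := vid_leq rt mE x; lia.
have fr' a i : a \notin [:: aJ; aREP] -> s' a i = s1 a i.
  by rewrite !inE negb_or => /andP[n1 n2]; rewrite fr // !inE negb_or n1.
split.
- by rewrite fr' // /s1 /= ?eqxx.
- by move=> e; rewrite fr' // /s1 /= vd_root pm inE.
- by move=> x u lu; rewrite repx (leader0 lu).
- by move=> x /anc_sub0->; rewrite repx.
- move=> u _; have [_ _ hcn hcd] := po u; have [_ hpn hpd] := pp (dn rt u).
  rewrite group0; split; rewrite ?fr' // /s1 /= ?vd_root ?hpn ?hpd ?hcn ?hcd.
  + exact: pd_gt0.
  + exact: ed_gt0.
  + by rewrite /wt big_set1 absz_numq ?prize_ge0.
  + by rewrite /ct big_set1 absz_numq ?ltW ?cost_gt0.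
  + by rewrite /prize_prod big_set1.
  + by rewrite /cost_prod big_set1.
- by rewrite !fr' // /s1 /= ?eqxx pcn pcd.
Qed.

Definition ranked (sg : seq (edge I)) s : Prop :=
  [/\ size sg = m, uniq sg,
      forall e0 j, j < m -> s aRK j = vd (nth e0 sg j) &
      forall e0 j k, j <= k -> k < m -> (D (nth e0 sg k) <= D (nth e0 sg j))%R].

Lemma merge_ok s : prepared s ->
  ok m V merge_prog s (fun s' => exists sg, ranked sg s').
Proof.
move=> ps; apply: ok_seq; apply: ok_conseq (merge_init_ok ps) _ => s1 fr1 m1.
have os1 : parents rt s1 by move=> e; rewrite !fr1 //; case: (pr_oriented ps e).
apply: (@ok_for _ _ (fun i s' => exists sg : seq (edge I),
  [/\ size sg = i, uniq sg, merged rt [set e in sg] s',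
      exists l, merge_inv rt [set e in sg] l &
      [/\ forall e0 j, j < i -> s' aRK j = vd (nth e0 sg j),
          forall e0 j k, j <= k -> k < i -> (D (nth e0 sg k) <= D (nth e0 sg j))%R &
          forall e f, e \in sg -> f \notin sg -> (D f <= D e)%R]])) => //.
- by lia.
- exists [::]; split=> //.
  + apply: merged_congr (_ : merged rt _ s1); last first.
      by rewrite (_ : [set e in [::]] = set0) //; apply/setP => e; rewrite !inE.
    by move=> a i; rewrite !inE; do 5 (case/orP; first by move/eqP->); move/eqP->.
  + rewrite (_ : [set e in [::]] = set0); first exact: merge_inv0.
    by apply/setP => e; rewrite !inE.
- move=> i s2 lti Ei fr2 [sg [sz un mg [l ml] [rk srt low]]]; rewrite addn0 in lti.
  have os2 : parents rt s2 by move=> e; rewrite !fr2 //; apply: os1.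
  have ex : exists e, e \notin [set f in sg].
    apply/existsP; apply: contraT; rewrite negb_exists => /forallP H.
    have : #|edge I| <= size sg.
      rewrite -(card_uniqP un) -cardsT subset_leq_card //; apply/subsetP => e _.
      by have := H e; rewrite negbK inE.
    by rewrite mE sz leqNgt lti.
  apply: ok_conseq (merge_body_ok mE VE mg os2 Ei lti ex) _.
  move=> s3 fr3 [v dv [mg3 rkv rk3]].
  have [vM _] := dv; have vsg : v \notin sg by move: vM; rewrite inE.
  have [inv' top] := merge_step ml dv.
  exists (rcons sg v).
  have Eset : [set e in rcons sg v] = v |: [set e in sg].
    by apply/setP => e; rewrite !inE mem_rcons inE.
  rewrite size_rcons rcons_uniq vsg un sz Eset; split=> //.
    apply: merged_congr mg3 => a k.
    by rewrite !inE; do 5 (case/orP; first by move/eqP->); move/eqP->.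
  split.
  + move=> e0 j; rewrite ltnS leq_eqVlt nth_rcons sz /=.
    case: (eqVneq j i) => [->|nji] /=; first by rewrite ltnn.
    by move=> ltj; rewrite ltj rk3 //; apply: rk.
  + move=> e0 j k jk; rewrite ltnS leq_eqVlt !nth_rcons sz.
    case: (eqVneq k i) jk => [->|nki] jk /=; last first.
      by move=> ltk; rewrite ltk (leq_ltn_trans jk ltk); apply: srt.
    move=> _; rewrite ltnn; case: (ltnP j i) => [ltj|le]; last first.
      have -> : j = i by lia.
      by rewrite eqxx.
    by apply: low => //; rewrite mem_nth ?sz.
  + move=> e f; rewrite !mem_rcons !inE negb_or => /orP[/eqP->|esg] /andP[nfv fsg].
      by apply: top; rewrite inE.
    exact: low.
move=> s' _ [sg [sz un _ _ [rk srt _]]]; exists sg.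
by rewrite addn0 in sz rk srt; split.
Qed.

(* [len] is one more than the position of the last vertex of positive prize, or
   0 if there is none. *)
Definition ordered (pi : seq (edge I)) (len : nat) : Prop :=
  [/\ uniq pi, len <= size pi,
      forall e0 k, k < size pi ->
        greedy_choice rt [set e in take k pi] (nth e0 pi k),
      forall e0 k, len <= k -> k < size pi -> prize (dn rt (nth e0 pi k)) = 0%R &
      forall e0, 0 < len -> prize (dn rt (nth e0 pi len.-1)) != 0%R].

Lemma select_first_ok sg (X : {set edge I}) s : ranked sg s -> closed rt X ->
  parents rt s -> s aSEL 0 = 0 -> (exists e, e \notin X) ->
  s aCHO (vid (root I)) != 0 -> (forall e, (s aCHO (vd e) != 0) = (e \in X)) ->
  ok m V select_first s (fun s' => exists2 v, greedy_choice rt X v & s' aSEL 0 = (vd v).+1).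
Proof.
move=> [sz un rk srt] cX os sel0 [x0 x0X] chr chi.
have cho x : (s aCHO (vid x) != 0) = (anc rt x \subset X).
  case: (eqVneq x (root I)) => [->|/(dn_onto rt)[e ->]]; first by rewrite chr anc_root sub0set.
  rewrite chi; apply/idP/subsetP => [eX f|]; last by apply; apply: mem_lineage.
  exact: closedP eX.
have frE e : frontier rt X e = (s aCHO (vd e) == 0) && (s aCHO (vid (up rt e)) != 0).
  by rewrite -[_ == 0]negbK chi cho /frontier /lineage anc_dn setU1K ?anc_up.
apply: (@ok_for _ _ (fun j s' =>
  (s' aSEL 0 = 0 /\ forall k, k < j -> ~~ frontier rt X (nth x0 sg k)) \/
  exists k, [/\ k < m, s' aSEL 0 = (vd (nth x0 sg k)).+1,
    frontier rt X (nth x0 sg k) &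
    forall k', k' < k -> ~~ frontier rt X (nth x0 sg k')])) => //.
- by lia.
- by left.
- move=> j s' ltj Ej fr Hj; rewrite addn0 in ltj.
  have Erk : s aRK j = vd (nth x0 sg j) by apply: rk.
  have [_ Epv] := os (nth x0 sg j).
  have E k := (fr aRK k isT, fr aCHO k isT, fr aPV k isT).
  have bV : vd (nth x0 sg j) + 1 <= V by have := vid_leq rt mE (dn rt (nth x0 sg j)); lia.
  case: Hj => [[sel H]|[k [ltk sel frk H]]].
    apply: ok_if => /=; rewrite Ej !E Erk Epv sel => cond.
      apply: ok_set; first by rewrite /= Ej E Erk.
      right; exists j; split=> //=; first by rewrite ?eqxx Ej E Erk addn1.
      rewrite frE; move: cond; case: (s aCHO (vd _)) => [|k]; case: (s aCHO _) => //=.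
    apply: ok_set => //=; left; split=> // k; rewrite ltnS leq_eqVlt => /orP[/eqP->|/H//].
    rewrite frE; move: cond.
    by case: (s aCHO (vd _)) => [|n]; case: (s aCHO _) => //= n; rewrite !mul1n.
  apply: ok_if => /=; rewrite sel /=; first by [].

  by move=> _; apply: ok_set => //=; right; exists k.
move=> s' fr; rewrite addn0 => -[[_ H]|[k [ltk sel frk H]]].
  have [f frf _] := frontier_below rt x0X.
  have fsg := full_seq un sz f.
  have ltf : index f sg < m by rewrite -sz index_mem.
  by have := H _ ltf; rewrite nth_index ?frf.
exists (nth x0 sg k) => //; split=> // f frf.
have fsg := full_seq un sz f.
have ltf : index f sg < m by rewrite -sz index_mem.
rewrite -{1}(nth_index x0 fsg); apply: srt => //.
by rewrite leqNgt; apply/negP => /H; rewrite nth_index ?frf.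
Qed.

Lemma order_ok sg s : ranked sg s -> s aROOT 0 = vid (root I) -> parents rt s ->
  (forall x, s aPZ (vid x) = pz x) -> (forall i, s aCHO i = 0) -> s aLEN 0 = 0 ->
  ok m V order_prog s (fun s' => exists pi, [/\ size pi = m, ordered pi (s' aLEN 0) &
    forall e0 k, k < m -> s' aOUT k = eid (nth e0 pi k)]).
Proof.
move=> rk pr po pp pc pl.
apply: ok_seq; apply: ok_set => /=; first by lia.
rewrite pr; set s1 := upd _ _ _ _.
have rk1 : ranked sg s1 by [].
have os1 : parents rt s1 by [].
apply: (@ok_for _ _ (fun i s' => exists pi : seq (edge I),
  [/\ size pi = i, ordered pi (s' aLEN 0),
      s' aCHO (vid (root I)) != 0, forall e, (s' aCHO (vd e) != 0) = (e \in pi) &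
      forall e0 k, k < i -> s' aOUT k = eid (nth e0 pi k)])) => //.
- by lia.
- exists [::]; split=> //; rewrite /s1 /= ?eqxx // ?pl; first by split.
  by move=> e; rewrite vd_root pc.
- move=> i s2 lti Ei fr2 [pi [sz [un lle run l0 l1] chr chi out]]; rewrite addn0 in lti.
  have rk2 : ranked sg s2.
    by case: rk1 => h1 h2 h3 h4; split=> // e0 j ltj; rewrite fr2 // (h3 e0).
  have os2 : parents rt s2 by move=> e; rewrite !fr2 //; apply: os1.
  have pz2 x : s2 aPZ (vid x) = pz x by rewrite fr2 // /s1 /= pp.
  apply: ok_seq; apply: ok_set => //=.
  have ex : exists e, e \notin [set f in pi].
    apply/existsP; apply: contraT; rewrite negb_exists => /forallP H.
    have : #|edge I| <= size pi.
      rewrite -(card_uniqP un) -cardsT subset_leq_card //; apply/subsetP => e _.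
      by have := H e; rewrite negbK inE.
    by rewrite mE sz leqNgt lti.
  have cpi : closed rt [set f in pi].
    case: pi run {sz un lle l0 l1 chi out ex} => [|e0 pi] run.
      by apply/closedP => e f; rewrite inE.
    by have := run_closed (run e0) (size (e0 :: pi)); rewrite take_size.
  apply: ok_seq; apply: ok_conseq (select_first_ok (sg := sg) (X := [set f in pi]) _ cpi _ _ ex _ _) _ => //.
    by move=> e; rewrite in_set; apply: chi.
  move=> s3 fr3 [v gv sel].
  have fr a k : a \notin [:: aSEL; aSKIP; aJ] -> s3 a k = s2 a k.
    rewrite !inE !negb_or => /and3P[n1 n2 n3]; rewrite fr3 /=.
      by rewrite eqbE (negPf n1).
    by rewrite !inE !negb_or n1 n2 n3.
  have vpi : v \notin pi by case: gv => /frontierP[]; rewrite inE.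
  have leV := vid_leq rt mE (dn rt v).
  apply: ok_seq; apply: ok_set => /=; rewrite sel subn1 /=; first by lia.
  apply: ok_seq; apply: ok_set => /=; first by lia.
  have [hpe _] := os2 v.
  apply: ok_seq; apply: ok_set => /=.
    by rewrite fr // hpe; have := eid_ltm mE v; lia.
  rewrite (fr aPE) // hpe (fr aI) // Ei.
  pose s4 := upd (upd (upd s3 aTMP 0 (vd v)) aCHO (vd v) 1) aOUT i (eid v).
  have run' e0 k : k < size (rcons pi v) ->
      greedy_choice rt [set e in take k (rcons pi v)] (nth e0 (rcons pi v) k).
    rewrite size_rcons ltnS leq_eqVlt => /orP[/eqP->|lt].
      by rewrite nth_rcons ltnn eqxx -cats1 take_size_cat.
    by rewrite nth_rcons lt -cats1 takel_cat; [apply: run | apply: ltnW].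
  have post s5 len : (forall a k, a != aSKIP -> a != aLEN -> s5 a k = s4 a k) ->
      s5 aLEN 0 = len -> ordered (rcons pi v) len ->
      exists pi, [/\ size pi = i.+1, ordered pi (s5 aLEN 0),
      s5 aCHO (vid (root I)) != 0,
      forall e, (s5 aCHO (vd e) != 0) = (e \in pi) &
      forall e0 k, k < i.+1 -> s5 aOUT k = eid (nth e0 pi k)].
    move=> E5 len5 ord; exists (rcons pi v); split.
    + by rewrite size_rcons sz.
    + by rewrite /= len5.
    + by rewrite /= E5 // /s4 /= root_vd fr.
    + move=> e; rewrite /= E5 // /s4 /= vd_eq mem_rcons inE fr //.
      by case: (e == v) => //=; apply: chi.
    + move=> e0 k; rewrite ltnS leq_eqVlt /= E5 // /s4 /= nth_rcons sz.
      case: (eqVneq k i) => [->|nki] /=; first by rewrite ltnn.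
      by move=> ltk; rewrite ltk fr // (out e0).
  apply: ok_if => /=; rewrite fr // pz2 => cond.
    have pv : prize (dn rt v) != 0%R.
      by apply: contraNneq cond => E; rewrite /pz E.
    apply: ok_set; first by rewrite /= fr // Ei; lia.
    apply: (post _ i.+1) => //=; first by move=> a k n1 n2; rewrite /= !eqbE (negPf n2).
      by rewrite fr // Ei addn1.
    split=> //; rewrite ?rcons_uniq ?vpi ?size_rcons ?sz //.
      by move=> e0 k lk; rewrite ltnS leqNgt lk.
    by move=> e0 _; rewrite nth_rcons sz ltnn eqxx.
  have pv : prize (dn rt v) = 0%R.
    by apply/eqP; rewrite -numq_eq0 -absz_eq0; apply/eqP.
  apply: ok_set; first by [].
  apply: (post _ (s2 aLEN 0)) => //=.
  + by move=> a k n1 n2; rewrite /= !eqbE (negPf n1).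
  + by rewrite fr.
  split=> //.
  + by rewrite rcons_uniq vpi.
  + by rewrite size_rcons; apply: leqW.
  + move=> e0 k lk; rewrite size_rcons ltnS leq_eqVlt nth_rcons.
    by case: (eqVneq k (size pi)) => [->|_] /=; [rewrite ltnn | move=> lt; rewrite lt l0].
  + move=> e0 lgt; rewrite nth_rcons; case: ltnP => [_|]; first exact: l1.
    by move=> le; exfalso; lia.
move=> s' _ [pi [sz ord _ _ out]]; rewrite addn0 in sz out.
by exists pi; split.
Qed.

Lemma out_ok pi s : size pi = m -> (forall e0 k, k < m -> s aOUT k = eid (nth e0 pi k)) ->
  s aLEN 0 <= m ->
  ok m V out_prog s (fun s' => [/\ s' aOUT 0 = s aOUT 0, s' 0 0 = s aLEN 0 &
    forall k, 0 < k -> k < m -> s' 0 k.+1 = s aOUT k]).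
Proof.
move=> sz out lenm; have outV k : k < m -> s aOUT k <= V.
  case: pi sz out => [|e0 pi] sz out ltk; first by rewrite -sz in ltk.
  by rewrite (out e0) //; have := eid_ltm mE (nth e0 (e0 :: pi) k); lia.
apply: ok_seq.
apply: (@ok_for _ _ (fun i s' => forall k, 0 < k -> m - i <= k -> k < m ->
  s' 0 k.+1 = s aOUT k)) => //.
- by lia.
- by move=> k k0 lek ltk; lia.
- move=> i s' lti Ei fr Hi; rewrite addn0 in lti.
  have frO k : s' aOUT k = s aOUT k by rewrite fr.
  apply: ok_if => /=; rewrite Ei => cond.
    apply: ok_out => /=; rewrite ?Ei ?frO.
    + by apply: outV; lia.
    + by lia.
    + by lia.
    move=> k k0 lek ltk; rewrite /= ?Ei ?frO.
    case: (eqVneq k.+1 (m - i)) => [E|nE]; first by congr (s aOUT _); lia.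
    by apply: Hi => //; lia.
  by apply: ok_set => //= k k0 lek ltk; apply: Hi => //; lia.
move=> s' fr H; apply: ok_out => /=; rewrite ?(fr aLEN) //.
- by lia.
- by lia.
split=> /=; rewrite ?fr ?eqxx // => k k0 ltk; apply: H => //; lia.
Qed.

End Phases.

(** * Polynomial time *)

Section Assembly.
Variables (I : instance rat) (rt : rooting I).
Variables m V : nat.
Hypothesis mE : #|edge I| = m.
Hypothesis VE : bits_bound I = V.
Implicit Types (e : edge I) (x : vert I) (s : state).

Local Notation enc := (encode_instance I).
Local Notation vd e := (vid (dn rt e)).

Let mV : 2 * m + 1 < V := size_bound rt mE VE.

Definition start_state : state := fun a i => if a is 0 then nth 0 enc i else 0.

Lemma size_enc : size enc = 6 * m + 5.
Proof.
pose f (e : edge I) := [:: nat_of_ord (enum_rank (end1 e)),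
  nat_of_ord (enum_rank (end2 e)) & encode_rat (cost e)].
pose g (v : vert I) := encode_rat (prize v).
rewrite /encode_instance !size_cat (@size_flatten_blocks _ f 4) //.
rewrite (@size_flatten_blocks _ g 2) // [size [:: _; _; _]]/= -!cardE mE.
by rewrite (card_vert rt mE); lia.
Qed.

Lemma rep_start : rep m (initial_memory enc) start_state.
Proof.
have E1 : nth 0 enc 1 = m by rewrite -mE.
split=> // a i lta; rewrite /initial_memory nth_default // size_enc.
by rewrite -addnA leq_addr.
Qed.

Lemma bounded_start : bounded V start_state.
Proof. by case=> [|a] i //=; rewrite -VE ltnW ?enc_bounded. Qed.

Definition final (s : state) : Prop := exists pi : seq (edge I),
  [/\ size pi = m, ordered rt pi (s 0 0),
      forall e0, 0 < m -> s aOUT 0 = eid (nth e0 pi 0) &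
      forall e0 k, 0 < k -> k < m -> s 0 k.+1 = eid (nth e0 pi k)].

Lemma main_ok : ok m V main_prog start_state final.
Proof.
apply: ok_seq; apply: ok_conseq (load_ok rt mE VE _ _) _ => //; first by case.
move=> s1 _ ld1.
apply: ok_seq; apply: ok_conseq (orient_ok rt mE VE ld1) _.
move=> s2 fr2 [or2 cn2 cd2].
have ps2 : prepared rt s2.
  split=> //.
  - by rewrite fr2 // (ld_root ld1).
  - by move=> x; rewrite !fr2 //; apply: (ld_prizes ld1).
  - by move=> i; rewrite fr2 // (ld_zero ld1).
  - by move=> i; rewrite fr2 // (ld_zero ld1).
  - by rewrite fr2 // (ld_zero ld1).
apply: ok_seq; apply: ok_conseq (merge_ok mE VE ps2) _ => s3 fr3 [sg rk3].
have par3 : parents rt s3 by move=> e; rewrite !fr3 //; case: (pr_oriented ps2 e).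
have [pr2 _ pp2 _ _ _ pc2 pl2] := ps2.
apply: ok_seq; apply: ok_conseq (order_ok mE VE rk3 _ par3 _ _ _) _.
- by rewrite fr3.
- by move=> x; rewrite fr3 //; case: (pp2 x).
- by move=> i; rewrite fr3.
- by rewrite fr3.
move=> s4 fr4 [pi [sz ord out]]; have [_ lelen _ _ _] := ord.
apply: ok_conseq (out_ok rt mE VE sz out _) _; first by rewrite -sz.
move=> s5 fr5 [o5 len5 cells5]; exists pi; split=> //; first by rewrite len5.
- by move=> e0 m0; rewrite o5; apply: out.
- by move=> e0 k k0 ltk; rewrite cells5 //; apply: out.
Qed.

Lemma ordered_output (pi : seq (edge I)) len : size pi = m -> ordered rt pi len ->
  greedy_output (take len pi).
Proof.
move=> sz [un lelen run l0 l1].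
have full := full_seq mE un sz.
have e0P k : k < size pi -> exists e0 : edge I, true by case: (pi) => [//|e0 p]; exists e0.
have mem_take_nth e0 k i : i < size pi -> (nth e0 pi i \in take k pi) = (i < k).
  by move=> lti; rewrite in_take ?mem_nth // index_uniq.
have reach k : k <= len -> greedy_reachable (take k pi).
  elim: k => [|k IH] lek; first by rewrite take0; constructor.
  have ltk : k < size pi by apply: leq_trans lelen.
  have [e0 _] := e0P _ ltk; have rk := IH (ltnW lek).
  rewrite (take_nth e0 ltk); apply: greedy_next => //.
  have ck := greedy_reachable_closed_set rt rk.
  apply/(greedy_stepP _ ck); split; last exact: run.
  have len0 : 0 < len by apply: leq_trans lek.
  have ltl : len.-1 < size pi by rewrite prednK.
  rewrite (quotient_total ck); apply: contraNneq (l1 e0 len0) => tot.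
  apply/eqP/le_anti; rewrite prize_ge0 andbT -tot /wt (bigD1 (nth e0 pi len.-1)) /=.
    by rewrite lerDl sumr_ge0 // => f _; apply: prize_ge0.
  by rewrite !inE mem_take_nth // -leqNgt -ltnS prednK.
split; first exact: reach.
have cl := greedy_reachable_closed_set rt (reach _ (leqnn len)).
rewrite (quotient_total cl) /wt big1 // => e; rewrite !inE => et.
have lte : index e pi < size pi by rewrite index_mem full.
have := l0 e (index e pi) _ lte; rewrite nth_index ?full //; apply.
by rewrite leqNgt; apply: contra et => lt; rewrite in_take ?full.
Qed.

Definition full_prog : prog := PSeq main_prog (POut (ANum 1) (reg aOUT)).

Lemma full_exec : exists (M : memory) (t : nat) (pi : seq (edge I)),
  [/\ exec (pcomp full_prog) (initial_memory enc) M t,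
      t <= ptime full_prog m (bitsize V), greedy_output pi &
      holds_list M (encode_edges pi)].
Proof.
have [sf [pi [sz ord out0 outs]]] := main_ok.
have [M1 [t1 [ex1 le1 r1 b1]]] := exec_prog main_wf rep_start bounded_start sf.
set s := prun m main_prog start_state in ord out0 outs r1 b1.
have lelen : s 0 0 <= m by case: ord => _; rewrite sz.
have evO : eval M1 (ccomp (reg aOUT)) = s aOUT 0 by rewrite (eval_ccomp r1).
pose M2 := update M1 (eval M1 (Const 1)) (eval M1 (ccomp (reg aOUT))).
exists M2, (1 + t1 + (1 + eval_cost M1 (Const 1) + eval_cost M1 (ccomp (reg aOUT)))).
exists (take (s 0 0) pi); split.
- exact: exec_seq ex1 (exec_store _ _ M1).
- exact: leq_add (leq_add (leqnn 1) le1) (exec_store_time (Const 1) (ccomp (reg aOUT)) r1 b1).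
- exact: ordered_output.
have [_ _ low _] := r1.
have szt : size (take (s 0 0) pi) = s 0 0 by rewrite size_takel ?sz.
case=> [_|k].
  have l0 : M1 0 = s 0 0 by apply: low; lia.
  by transitivity (M1 0); [| rewrite l0; exact: esym szt].
rewrite /= size_map szt ltnS => ltk.
have ltm : k < m by apply: leq_trans lelen.
have [e0 _] : exists e0 : edge I, true.
  by case: pi sz {ord out0 outs szt} => [sz|e0 p _]; [rewrite -sz in ltm | exists e0].
rewrite (nth_map e0) ?szt // nth_take // -/(eid _).
rewrite /M2 /update evO; case: k ltk ltm => [|k] ltk ltm /=; first exact: out0.
have lk : M1 k.+2 = s 0 k.+2 by apply: low; lia.
by rewrite lk; apply: outs.
Qed.

End Assembly.

Lemma greedy_polytime : greedy_trees_polytime.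
Proof.
have [a [d H]] := ptime_poly full_prog.
exists (pcomp full_prog), (a * 3 ^ d), d => I tI.
have [rt] := tree_rooting tI.
have [M [t [pi [ex le out hold]]]] := full_exec rt erefl erefl.
exists M, t, pi; split=> //; apply: leq_trans le _.
have szV : bitsize (bits_bound I) <= (instance_size I).+1.
  by rewrite /bitsize /bits_bound trunc_expnK.
have szm : #|edge I| <= (instance_size I).+1.
  by apply: leqW; apply: leq_trans (card_bound I); apply: leq_addr.
have sz0 : 0 < instance_size I by rewrite instance_sizeE.
apply: leq_trans (H _ _ _ szm szV) _; apply: leq_trans (leq_addr _ _).
rewrite -mulnA leq_mul2l -expnMn; apply/orP; right.
by case: d {H} => // d; rewrite leq_exp2r //; lia.
Qed.

Local Open Scope ring_scope.

Theorem theorem1 (R : realType) :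
  greedy_trees_polytime /\
  (forall I : instance R, is_tree I ->
     (exists pi : seq (edge I), greedy_output pi) /\
     (forall pi : seq (edge I), greedy_output pi ->
        incremental_solution pi /\
        (forall chi alpha mu B : R,
           is_eccentricity I chi -> chi <= alpha -> 1 <= mu -> 0 <= B ->
           forall T : subgraph I, is_opt B T ->
             prize_of T <= mu * prize_of (alg pi (B + alpha))))) /\
  (forall chi alpha : R, 0 < chi -> 0 <= alpha -> alpha < chi ->
     exists I : instance R,
       [/\ is_tree I, is_eccentricity I chi &
           forall mu : R, 1 <= mu ->
           forall pi : seq (edge I), greedy_output pi ->
           exists (B : R) (T : subgraph I),
             [/\ 0 <= B, is_opt B T &
                 mu * prize_of (alg pi (B + alpha)) < prize_of T]]).
Proof.
split; [exact: greedy_polytime | split=> [I tI|]]; last exact: two_leaves_bad.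
have [rt] := tree_rooting tI; split; first exact: greedy_output_exists rt.
move=> pi opi; split; first exact: (greedy_output_incremental rt opi).
move=> chi alpha mu B ecc le mu1 B0 T [rT cT _].
have le1 : prize_of T <= prize_of (alg pi (B + alpha)).
  have -> : B + alpha = (B + alpha - chi) + chi by rewrite subrK.
  apply: (greedy_output_dominates rt opi ecc rT).
  by apply: le_trans cT _; rewrite -addrA lerDl subr_ge0.
apply: le_trans le1 _; rewrite ler_peMl //.
by apply: sumr_ge0 => v _; apply: prize_ge0.
Qed.
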